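(* Let $n>1$, let $\mathcal{Q}\subseteq H^2(\mathbb{B}^n)$ be a finite-dimensional quotient module, and let $X$ be a nonconstant module map acting on $\mathcal{Q}$. Then $X$ does not admit a norm-preserving lift; that is, there is no $\varphi\in\mathcal{S}(\mathbb{B}^n)$ such that $X=S_\varphi$ and $\|X\|=\|\varphi\|_\infty$.
   Context: $\mathbb{B}^n$ is the open unit ball of $\mathbb{C}^n$, $\mathbb{S}^n=\partial\mathbb{B}^n$, $\sigma$ the normalized surface measure on $\mathbb{S}^n$. $H^\infty(\mathbb{B}^n)$: bounded analytic functions on $\mathbb{B}^n$ with sup norm $\|\cdot\|_\infty$; $\mathcal{S}(\mathbb{B}^n)$: its closed unit ball. $H^2(\mathbb{B}^n)$: the Hardy space of analytic $f$ on $\mathbb{B}^n$ with $\|f\|^2=\sup_{0<r<1}\int_{\mathbb{S}^n}|f(r\zeta)|^2d\sigma(\zeta)<\infty$. For $\varphi\in H^\infty(\mathbb{B}^n)$, $T_\varphi f=\varphi f$ on $H^2(\mathbb{B}^n)$. A quotient module is a nonzero closed subspace $\mathcal{Q}\subseteq H^2(\mathbb{B}^n)$ with $T_{z_i}^*\mathcal{Q}\subseteq\mathcal{Q}$ for $i=1,\dots,n$; $S_\varphi=P_{\mathcal{Q}}T_\varphi|_{\mathcal{Q}}$, where $P_{\mathcal{Q}}$ is the orthogonal projection onto $\mathcal{Q}$. A bounded operator $X$ on $\mathcal{Q}$ is a module map if $XS_{z_i}=S_{z_i}X$ for all $i$; it is nonconstant if it is not a scalar multiple of the identity $I_{\mathcal{Q}}$.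 *)

(* Defs.v *)
From HB Require Import structures.
From mathcomp Require Import all_boot all_order all_algebra.
From mathcomp Require Import complex.
From mathcomp Require Import all_classical all_reals all_analysis measurable_realfun.
From mathcomp Require showcase.summability.
Import Order.TTheory GRing.Theory Num.Theory.
Import numFieldNormedType.Exports.

Set Implicit Arguments.
Unset Strict Implicit.
Unset Printing Implicit Defensive.

Local Open Scope classical_set_scope.
Local Open Scope ring_scope.

(* [R[i]^o] is [R[i]] viewed as a module over itself; it is the form of R[i]
   on which the scaling of functions and the topology are found. *)
Notation Cplx R := (R[i]^o).
Notation Cn R n := 'rV[Cplx R]_n.
Notation fct R n := (Cn R n -> Cplx R).

(* The library norm on [R[i]] takes its values in [R[i]]; this one is real. *)
Notation cmod := ComplexField.Normc.normc.

Section unit_ball.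
Context {R : realType} {n : nat}.

Definition cvnorm (z : Cn R n) : R :=
  Num.sqrt (\sum_(i < n) cmod (z ord0 i) ^+ 2).

Definition unit_ball : set (Cn R n) := [set z | cvnorm z < 1].

End unit_ball.

(* The sigma-finite instance on [m1 \x m2] that inference finds is the one for
   subprobabilities, hence this explicit statement. *)
Lemma sigma_finite_product d1 d2 (T1 : measurableType d1)
    (T2 : measurableType d2) (R : realType)
    (m1 : {measure set T1 -> \bar R})
    (m2 : {sigma_finite_measure set T2 -> \bar R}) :
  sigma_finite setT m1 -> sigma_finite setT (m1 \x m2)%E.
Proof.
move=> /sigma_finiteP[F [TF ndF Foo]].
have /sigma_finiteP[G [TG ndG Goo]] := sigma_finiteT m2.
exists (fun k => F k `*` G k).
  rewrite -setXTT TF TG predeqE => -[x y]; split.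
    move=> [/= [k _ Fkx] [l _ Gly]]; exists (maxn k l) => //; split.
    - by move: x Fkx; exact/subsetPset/ndF/leq_maxl.
    - by move: y Gly; exact/subsetPset/ndG/leq_maxr.
  by move=> [k _ []/= ? ?]; split; exists k.
move=> k; have [? ?] := Foo k; have [? ?] := Goo k.
split; first exact: measurableX.
by rewrite product_measure1E// lte_mul_pinfty// ge0_fin_numE.
Qed.

Section surface_measure.
Context {R : realType}.

(* Real coordinates: C^n is measured as (R * R)^n. *)
Local Notation T := (measurableTypeR R * measurableTypeR R)%type.

Definition to_Cn n (t : n.-tuple T) : Cn R n :=
  \row_i ((tnth t i).1 +i* (tnth t i).2)%C.

Definition tcons n (p : T * n.-tuple T) : n.+1.-tuple T :=
  [tuple of p.1 :: p.2].

Lemma measurable_tcons n : measurable_fun setT (@tcons n).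
Proof. exact: measurable_cons. Qed.

Section step.
Variables (n : nat) (mu : {sigma_finite_measure set (n.-tuple T) -> \bar R}).

Definition lebesgue_cons : set (n.+1.-tuple T) -> \bar R :=
  pushforward ((lebesgue_measure \x lebesgue_measure) \x mu)%E (@tcons n).

Let mtcons A : measurable A -> measurable (@tcons n @^-1` A).
Proof.
by move=> mA; rewrite -[X in measurable X]setTI; exact: measurable_tcons.
Qed.

Let lebesgue_cons0 : lebesgue_cons set0 = 0%E.
Proof. by rewrite /lebesgue_cons /pushforward preimage_set0 measure0. Qed.

Let lebesgue_cons_ge0 A : (0 <= lebesgue_cons A)%E.
Proof. by rewrite /lebesgue_cons /pushforward; exact: measure_ge0. Qed.

Let lebesgue_cons_sigma_additive : semi_sigma_additive lebesgue_cons.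
Proof.
move=> F mF tF mUF; rewrite /lebesgue_cons /pushforward preimage_bigcup.
apply: measure_semi_sigma_additive.
- by move=> k; exact: mtcons.
- apply/trivIsetP => i j _ _ ij; rewrite -preimage_setI.
  by move/trivIsetP : tF => /(_ _ _ _ _ ij) ->//; rewrite preimage_set0.
- by rewrite -preimage_bigcup; exact: mtcons.
Qed.

HB.instance Definition _ := isMeasure.Build _ _ _ lebesgue_cons
  lebesgue_cons0 lebesgue_cons_ge0 lebesgue_cons_sigma_additive.

Let lebesgue_cons_sigma_finite : sigma_finite setT lebesgue_cons.
Proof.
have [F UF mF] : sigma_finite setT
    ((@lebesgue_measure R \x @lebesgue_measure R) \x mu)%E.
  by do 2![apply: sigma_finite_product]; exact: sigma_finiteT.
pose g (t : n.+1.-tuple T) : T * n.-tuple T := (thead t, [tuple of behead t]).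
have mg : measurable_fun setT g.
  apply/measurable_fun_pairP; split; last exact: measurable_behead.
  exact: measurable_tnth.
have tK : cancel (@tcons n) g.
  move=> [x t]; rewrite /g /tcons; congr (_, _).
  exact/val_inj.
exists (fun k => g @^-1` F k); first by rewrite -preimage_bigcup -UF preimage_setT.
move=> k; have [mFk Fk] := mF k; split.
  by rewrite -[X in measurable X]setTI; exact: mg.
rewrite /lebesgue_cons /pushforward -comp_preimage.
by rewrite (_ : g \o _ = id) ?preimage_id//; apply/funext => x; exact: tK.
Qed.

HB.instance Definition _ := Measure_isSigmaFinite.Build _ _ _ lebesgue_cons
  lebesgue_cons_sigma_finite.

End step.

(* Lebesgue measure on C^n; C^0 is a point, of mass 1. *)
Fixpoint lebesgue_Cn n : {sigma_finite_measure set (n.-tuple T) -> \bar R} :=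
  if n is m.+1 then lebesgue_cons (lebesgue_Cn m)
  else dirac ([tuple] : 0.-tuple T).

Section sphere.
Variable n : nat.

Definition punctured_ball : set (n.-tuple T) :=
  [set t | 0 < cvnorm (to_Cn t) < 1].

Definition radial_proj (t : n.-tuple T) : n.-tuple T :=
  let r := cvnorm (to_Cn t) in
  [tuple ((tnth t i).1 / r, (tnth t i).2 / r) | i < n].

Lemma measurable_cvnorm :
  measurable_fun setT (fun t : n.-tuple T => cvnorm (to_Cn t)).
Proof.
have mt i : measurable_fun setT (fun t : n.-tuple T => tnth t i).
  exact: measurable_tnth.
have m1 i : measurable_fun setT (fun t : n.-tuple T => (tnth t i).1).
  exact: measurableT_comp measurable_fst (mt i).
have m2 i : measurable_fun setT (fun t : n.-tuple T => (tnth t i).2).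
  exact: measurableT_comp measurable_snd (mt i).
apply: measurableT_comp.
  by apply: continuous_measurable_fun; exact: sqrt_continuous.
apply: measurable_sum => i; rewrite [X in measurable_fun _ X](_ : _ = fun t =>
    (tnth t i).1 ^+ 2 + (tnth t i).2 ^+ 2 : R); last first.
  by apply/funext => t; rewrite mxE /= sqr_sqrtr// addr_ge0 ?sqr_ge0.
apply: measurable_funD; apply: measurable_funX.
  exact: m1.
exact: m2.
Qed.

Lemma measurable_punctured_ball : measurable punctured_ball.
Proof.
rewrite (_ : punctured_ball =
    setT `&` (fun t : n.-tuple T => cvnorm (to_Cn t)) @^-1` `]0, 1[); last first.
  by rewrite setTI; apply/seteqP; split=> t /=; rewrite in_itv.
exact: measurable_cvnorm.
Qed.

Lemma measurable_radial_proj : measurable_fun setT radial_proj.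
Proof.
have mt i : measurable_fun setT (fun t : n.-tuple T => tnth t i).
  exact: measurable_tnth.
have mV : measurable_fun setT
    (fun t : n.-tuple T => (cvnorm (to_Cn t))^-1 : measurableTypeR R).
  rewrite [X in measurable_fun _ X](_ : _ =
      (@powR R ^~ (-1)) \o (fun t : n.-tuple T => cvnorm (to_Cn t))).
    exact: measurableT_comp (measurable_powR _) measurable_cvnorm.
  by apply/funext => t /=; rewrite powR_inv1// sqrtr_ge0.
apply/measurable_fun_tnthP => i; rewrite [X in measurable_fun _ X](_ : _ = fun t =>
    ((tnth t i).1 / cvnorm (to_Cn t), (tnth t i).2 / cvnorm (to_Cn t)));
  last by apply/funext => t /=; rewrite tnth_mktuple.
apply/measurable_fun_pairP; split => /=.
- apply: measurable_funM mV; exact: measurableT_comp measurable_fst (mt i).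
- apply: measurable_funM mV; exact: measurableT_comp measurable_snd (mt i).
Qed.

(* Normalized surface measure on the unit sphere: the surface measure of A is
   2n times the volume of the solid cone {t | 0 < |t| < 1, t / |t| in A}, and
   the factor 2n cancels in the normalization. *)
Definition sphere_measure (A : set (n.-tuple T)) : \bar R :=
  ((fine (lebesgue_Cn n punctured_ball))^-1%:E *
   lebesgue_Cn n (radial_proj @^-1` A `&` punctured_ball))%E.

Let sphere_measure0 : sphere_measure set0 = 0%E.
Proof.
by rewrite /sphere_measure preimage_set0 set0I measure0 mule0.
Qed.

Let sphere_measure_ge0 A : (0 <= sphere_measure A)%E.
Proof.
by apply: mule_ge0 => //; rewrite lee_fin invr_ge0 fine_ge0.
Qed.

Let sphere_measure_sigma_additive : semi_sigma_additive sphere_measure.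
Proof.
have mrp A : measurable A -> measurable (radial_proj @^-1` A).
  by move=> mA; rewrite -[X in measurable X]setTI; exact: measurable_radial_proj.
have r0 : (0 <= (fine (lebesgue_Cn n punctured_ball))^-1)%R.
  by rewrite invr_ge0 fine_ge0.
move=> F mF tF mUF.
pose G k := radial_proj @^-1` F k `&` punctured_ball.
have mG k : measurable (G k).
  by apply: measurableI (mrp _ (mF k)) measurable_punctured_ball.
have tG : trivIset setT G.
  apply/trivIsetP => i j _ _ ij; rewrite /G setIACA -preimage_setI.
  by move/trivIsetP : tF => /(_ _ _ _ _ ij) ->//; rewrite preimage_set0 set0I.
rewrite /sphere_measure preimage_bigcup setI_bigcupl.
rewrite [X in X @ _ --> _](_ : _ = fun k =>
    ((fine (lebesgue_Cn n punctured_ball))^-1%:E *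
     \sum_(0 <= i < k) lebesgue_Cn n (G i))%E); last first.
  apply/funext => k; rewrite ge0_sume_distrr// => i _; exact: measure_ge0.
apply: cvgeZl => //.
apply: measure_semi_sigma_additive => //.
exact: bigcup_measurable.
Qed.

HB.instance Definition _ := isMeasure.Build _ _ _ sphere_measure
  sphere_measure0 sphere_measure_ge0 sphere_measure_sigma_additive.

End sphere.
End surface_measure.

Section hardy_space.
Context {R : realType} {n : nat}.
Local Notation C := (Cplx R).
Local Notation F := (fct R n).
Implicit Types (f g h phi : F) (Q : set F) (X : F -> F).

(* Near [a], [f] is the sum of a power series in the multi-indices
   [m : {ffun 'I_n -> nat}], summed unconditionally. *)
Definition analytic_at f (a : Cn R n) : Prop :=
  exists (c : {ffun 'I_n -> nat} -> C) (r : R), 0 < r /\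
    forall z, cvnorm (z - a) < r ->
      summability.partial_sum
        (fun m : {ffun 'I_n -> nat} =>
           c m * \prod_(i < n) (z ord0 i - a ord0 i) ^+ m i : C)
        @ summability.totally --> f z.

(* A function on the unit ball is encoded by its extension by 0 to C^n, so that
   Leibniz equality is equality of functions on the ball. *)
Definition analytic_ball : set F :=
  [set f | (forall a, unit_ball a -> analytic_at f a) /\
           (forall z, ~ unit_ball z -> f z = 0)].

Definition supnorm phi : \bar R :=
  ereal_sup [set (cmod (phi z))%:E | z in unit_ball].

Definition Hinfty : set F :=
  [set phi | analytic_ball phi /\ (supnorm phi < +oo)%E].

Definition schur_class : set F :=
  [set phi | Hinfty phi /\ (supnorm phi <= 1)%E].

Definition hardy_sqnorm f : \bar R :=
  ereal_sup [set (\int[@sphere_measure R n]_t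
      (cmod (f ((r%:C)%C *: to_Cn t)) ^+ 2)%:E)%E | r in `]0, 1[].

Definition H2 : set F :=
  [set f | analytic_ball f /\ (hardy_sqnorm f < +oo)%E].

Definition hnorm f : R := Num.sqrt (fine (hardy_sqnorm f)).

(* The inner product inducing [hnorm], by polarization; linear on the left. *)
Definition hdot f g : C :=
  4%:R^-1 * \sum_(k < 4)
    ('i%C : C) ^+ k * ((hnorm (f + (('i%C : C) ^+ k) *: g) ^+ 2)%:C)%C.

Definition mulop phi : F -> F := fun f z => phi z * f z.

(* Not extended by 0: multiplication only sees its values on the ball. *)
Definition coordf (i : 'I_n) : F := fun z => z ord0 i.

(* g = T^* f *)
Definition adjoint_at (T : F -> F) f g : Prop :=
  H2 g /\ forall h, H2 h -> hdot (T h) f = hdot h g.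

Definition subspace_of_H2 Q : Prop :=
  [/\ Q `<=` H2, Q 0 & forall (a : C) f g, Q f -> Q g -> Q (a *: f + g)].

Definition hclosed Q : Prop :=
  forall f, H2 f ->
    (forall e : R, 0 < e -> exists2 g, Q g & hnorm (f - g) < e) -> Q f.

Definition quotient_module Q : Prop :=
  [/\ subspace_of_H2 Q, hclosed Q, (exists2 f, Q f & f <> 0) &
      forall i f, Q f -> exists2 g, Q g & adjoint_at (mulop (coordf i)) f g].

Definition finite_dim Q : Prop :=
  exists (d : nat) (e : 'I_d -> F),
    Q = [set \sum_(j < d) c j *: e j | c in [set: 'I_d -> C]].

Definition hproj Q f : F :=
  xget 0 [set g | Q g /\ forall h, Q h -> hdot (f - g) h = 0].

Definition compression Q phi f : F := hproj Q (mulop phi f).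

Definition opnorm Q X : \bar R :=
  ereal_sup [set (hnorm (X f))%:E | f in [set f | Q f /\ hnorm f <= 1]].

(* Only the restriction of [X] to [Q] is meaningful. *)
Definition bounded_operator Q X : Prop :=
  [/\ forall f, Q f -> Q (X f),
      forall (a : C) f g, Q f -> Q g -> X (a *: f + g) = a *: X f + X g &
      exists M : R, forall f, Q f -> hnorm (X f) <= M * hnorm f].

Definition module_map Q X : Prop :=
  bounded_operator Q X /\
  forall i f, Q f ->
    X (compression Q (coordf i) f) = compression Q (coordf i) (X f).

Definition nonconstant_on Q X : Prop :=
  ~ exists c : C, forall f, Q f -> X f = c *: f.

Definition norm_preserving_lift Q X phi : Prop :=
  [/\ schur_class phi, forall f, Q f -> X f = compression Q phi f &
      opnorm Q X = supnorm phi].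

End hardy_space.

(* Main.v *)
(* Let [f] be a unit vector of [Q] with [|X f| = |X| = M > 0], and [g = X f].  If
   [phi] is a norm preserving lift, [g] is the projection of [phi f] and
   [|phi f| <= M = |g|], hence [phi f = g].  So [|g| <= M |f|] on the ball with
   equal norms, and since [f] and [g] extend continuously to the closed ball,
   [|g| = M |f|] on the sphere.  Near a point [zeta] of the sphere with
   [f zeta <> 0], the maximum principle for [f / g] on small discs orthogonal to
   [zeta] (they exist because [n > 1]) gives an interior point where [|phi| = M].
   So [phi] is constant and [X] is scalar.

   Continuity up to the sphere: let [A_zeta] be the adjoint on [Q] of the
   multiplication by [l_zeta z = <z, zeta>].  For [zeta] and [eta] orthonormal,
   [|l_zeta h|^2 + |l_eta h|^2 <= |h|^2], so [|l_zeta h| < |h|] for [h <> 0] and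
   [A_zeta] is a strict contraction; by compactness [|A_zeta| <= q < 1] for all
   unit [zeta].  The part [F_k] of degree [k] of [f] in [Q] satisfies
   [F_k(zeta) * mean (|l_zeta|^2k) = <f, l_zeta^k> = O(q^k)], while the moments
   decay slower than any geometric sequence of ratio less than 1.  So [F_k]
   decays geometrically on the sphere, uniformly. *)
Require Import Defs.
From HB Require Import structures.
From mathcomp Require Import all_boot all_order all_algebra.
From mathcomp Require Import complex.
From mathcomp Require Import finmap cyclic separable cyclotomic.
From mathcomp Require Import all_classical all_reals all_analysis measurable_realfun.
From mathcomp Require Import ring lra zify.
From mathcomp Require showcase.summability.
Import Order.TTheory GRing.Theory Num.Theory.
Import numFieldNormedType.Exports.

Set Implicit Arguments.
Unset Strict Implicit.
Unset Printing Implicit Defensive.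

Local Open Scope classical_set_scope.
Local Open Scope ring_scope.

(** * Moduli and analytic functions of one variable *)

(** The maximum principle bounds from above, while [|phi|] has to be bounded from below; this is why
    it is applied to [f / g], on a disc where [g] has no zero. In one variable the only disc with
    boundary on the unit circle is the whole disc, and the zeros of [g] cannot be avoided there, as
    Blaschke products show. With [n > 1] such discs shrink to a boundary point, and continuity up to
    the sphere keeps [f] and [g] away from 0 on them.

    Averages over N-th roots of unity take the place of Cauchy's formula. They return the
    coefficients of polynomials of degree less than N exactly, and on an analytic function the error
    is a Taylor remainder, which the maximum principle controls. Likewise, invariance of the sphere
    measure under finitely many rotations takes the place of integration over circles, both for the
    monotonicity of the means in the radius and for the formula that isolates [F_k(zeta)].
    Monotonicity turns the supremum in the Hardy norm into a limit, through which the polarized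
    [hdot] inherits its sesquilinearity. *)

Section cmod_theory.
Variable R : realType.
Implicit Types x y : R[i].

Lemma cmod_ge0 x : 0 <= cmod x.
Proof. by case: x => a b; exact: sqrtr_ge0. Qed.

Lemma cmod_eq0 x : (cmod x == 0) = (x == 0).
Proof.
by apply/eqP/eqP => [/ComplexField.Normc.eq0_normc|->]//; exact: ComplexField.Normc.normc0.
Qed.

Lemma cmod0 : cmod (0 : R[i]) = 0.
Proof. exact: ComplexField.Normc.normc0. Qed.

Lemma cmod1 : cmod (1 : R[i]) = 1.
Proof. exact: ComplexField.Normc.normc1. Qed.

Lemma cmodM x y : cmod (x * y) = cmod x * cmod y.
Proof. exact: ComplexField.Normc.normcM. Qed.

Lemma cmodV x : cmod x^-1 = (cmod x)^-1.
Proof. exact: ComplexField.Normc.normcV. Qed.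

Lemma cmodN x : cmod (- x) = cmod x.
Proof. by rewrite -mulN1r cmodM /= oppr0 sqrrN expr1n expr0n addr0 sqrtr1 mul1r. Qed.

Lemma cmodX x k : cmod (x ^+ k) = cmod x ^+ k.
Proof. by elim: k => [|k ih]; rewrite ?cmod1// !exprS cmodM ih. Qed.

Lemma cmod_norm x : (cmod x)%:C%C = `|x|.
Proof. by case: x. Qed.

Lemma cmodD x y : cmod (x + y) <= cmod x + cmod y.
Proof. by rewrite -lecR rmorphD/= !cmod_norm ler_normD. Qed.

Lemma cmodB x y : cmod (x - y) = cmod (y - x).
Proof. by rewrite -cmodN opprB. Qed.

Lemma cmod_gt0 x : (0 < cmod x) = (x != 0).
Proof. by rewrite lt_neqAle cmod_ge0 andbT eq_sym cmod_eq0. Qed.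

Lemma cmod_real (a : R) : cmod (a%:C)%C = `|a|.
Proof. by rewrite /= expr0n addr0 sqrtr_sqr. Qed.

Lemma cmod_sum I (r : seq I) (P : pred I) (F : I -> R[i]) :
  cmod (\sum_(i <- r | P i) F i) <= \sum_(i <- r | P i) cmod (F i).
Proof.
elim/big_rec2: _ => [|i y z _ h]; first by rewrite cmod0.
by rewrite (le_trans (cmodD _ _))// lerD2l.
Qed.

Lemma cmod_prod I (r : seq I) (P : pred I) (F : I -> R[i]) :
  cmod (\prod_(i <- r | P i) F i) = \prod_(i <- r | P i) cmod (F i).
Proof. by elim/big_rec2: _ => [|i y z _ <-]; rewrite ?cmod1// cmodM. Qed.

Lemma sqr_cmod x : cmod x ^+ 2 = (complex.Re x) ^+ 2 + (complex.Im x) ^+ 2.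
Proof. by case: x => a b /=; rewrite sqr_sqrtr// addr_ge0 ?sqr_ge0. Qed.

Lemma sqr_cmodC x : ((cmod x ^+ 2)%:C)%C = x * (x^*)%C.
Proof. by rewrite rmorphXn/= cmod_norm sqr_normc. Qed.

Lemma Re_le_cmod x : `|complex.Re x| <= cmod x.
Proof. by rewrite -lecR cmod_norm normc_ge_Re. Qed.

Lemma Im_le_cmod x : `|complex.Im x| <= cmod x.
Proof.
rewrite -(@ler_pXn2r _ 2) ?nnegrE ?cmod_ge0// sqr_cmod real_normK ?num_real//.
by rewrite lerDr sqr_ge0.
Qed.

Lemma cmodJ x : cmod (x^*)%C = cmod x.
Proof. by case: x => a b /=; rewrite sqrrN. Qed.

Lemma cmod_distB x y : cmod x - cmod y <= cmod (x - y).
Proof. by rewrite lerBlDr -{1}(subrK y x) cmodD. Qed.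

Lemma cmod_dist x y : `|cmod x - cmod y| <= cmod (x - y).
Proof.
by rewrite ler_norml lerNl opprB {1}cmodB !cmod_distB.
Qed.

Lemma cmod_sqr_dist x y K : cmod x <= K -> cmod y <= K ->
  `|cmod x ^+ 2 - cmod y ^+ 2| <= 2 * K * cmod (x - y).
Proof.
move=> xK yK; rewrite subr_sqr normrM mulrC ler_pM//.
  rewrite ger0_norm ?addr_ge0 ?cmod_ge0//; lra.
exact: cmod_dist.
Qed.

Lemma cmod_le_ReIm x : cmod x <= `|complex.Re x| + `|complex.Im x|.
Proof.
rewrite -(@ler_pXn2r _ 2) ?nnegrE ?cmod_ge0 ?addr_ge0// sqr_cmod.
rewrite sqrrD !real_normK ?num_real// -addrA lerD2l lerDr.
by rewrite mulrn_wge0// mulr_ge0.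
Qed.

Lemma cmod_divr_ge0 x (r : R) : 0 < r -> 0 <= cmod x / r.
Proof. by move=> r0; rewrite divr_ge0 ?cmod_ge0// ltW. Qed.

End cmod_theory.

(** Stands in for the open mapping theorem: it is local, it holds for moduli of quotients of
    analytic functions, and it is all that the maximum principle asks of [u] inside the disc, so
    subharmonicity never appears. *)
Definition loc_max_prop (R : realType) (u : R[i] -> R) (a : R[i]) : Prop :=
  (forall e, 0 < e -> exists2 x, cmod (x - a) < e & u a < u x) \/
  (exists2 e, 0 < e & forall x, cmod (x - a) < e -> u x = u a).

(* Geometric bounds on all the remainders replace the convergence of the power
   series; they imply [cmod (c k) * r ^+ k <= 2 * K]. *)
Definition expansion (R : realType) (h : R[i] -> R[i]) (a : R[i])
    (c : nat -> R[i]) (r K : R) : Prop :=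
  forall x, cmod x <= r -> forall N,
    cmod (h (a + x) - \sum_(k < N) c k * x ^+ k) <= K * (cmod x / r) ^+ N.

Definition analytic1 (R : realType) (h : R[i] -> R[i]) (a : R[i]) : Prop :=
  exists c r K, 0 < r /\ expansion h a c r K.

Section one_variable.
Variable R : realType.
Implicit Types (h f g : R[i] -> R[i]) (a x : R[i]).
Local Notation C := R[i].

Lemma expansion_K_ge0 h a c r K : 0 < r -> expansion h a c r K -> 0 <= K.
Proof.
move=> r0 /(_ 0); rewrite cmod0 => /(_ (ltW r0) 0).
by rewrite expr0 mulr1; apply: le_trans; exact: cmod_ge0.
Qed.

(** The k-th term is the difference of two consecutive remainders, taken at [x = r], where the
    geometric factor is 1. *)
Lemma expansion_coef h a c r K : 0 < r -> expansion h a c r K ->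
  forall k, cmod (c k) * r ^+ k <= 2 * K.
Proof.
move=> r0 hc k; pose x : C := (r%:C)%C.
have xr : cmod x = r by rewrite cmod_real gtr0_norm.
have h1 := hc x; rewrite xr in h1; have {}h1 := h1 (lexx _).
have := h1 k; have := h1 k.+1; rewrite divff ?gt_eqF// !expr1n !mulr1 => {h1}.
rewrite big_ord_recr/=; set S := \sum_(_ < _) _ => p q.
have -> : cmod (c k) * r ^+ k = cmod (c k * x ^+ k) by rewrite cmodM cmodX xr.
have -> : c k * x ^+ k = (h (a + x) - S) - (h (a + x) - (S + c k * x ^+ k)) by ring.
by rewrite (le_trans (cmodD _ _))// cmodN; lra.
Qed.

Lemma expansion_le h a c r r' K K' : 0 < r' -> r' <= r -> K <= K' ->
  expansion h a c r K -> expansion h a c r' K'.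
Proof.
move=> r'0 r'r KK' hc x xr' N; have r0 : 0 < r by exact: lt_le_trans r'r.
apply: (le_trans (hc x (le_trans xr' r'r) N)).
have K0 := expansion_K_ge0 r0 hc.
apply: ler_pM => //.
  by rewrite exprn_ge0// cmod_divr_ge0.
apply: lerXn2r; rewrite ?nnegrE ?cmod_divr_ge0//.
by rewrite ler_wpM2l ?cmod_ge0// lef_pV2.
Qed.

Lemma expansion0 h a c r K : 0 < r -> expansion h a c r K -> c 0 = h a.
Proof.
move=> r0 /(_ 0); rewrite cmod0 => /(_ (ltW r0) 1).
rewrite big_ord_recr big_ord0/= add0r expr0 mulr1 addr0 mul0r expr1 mulr0 => h1.
apply/eqP; rewrite eq_sym -subr_eq0 -cmod_eq0; apply/eqP/le_anti.
by rewrite h1 cmod_ge0.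
Qed.

Lemma expansionD h g a c d r K K' : expansion h a c r K -> expansion g a d r K' ->
  expansion (h \+ g) a (fun k => c k + d k) r (K + K').
Proof.
move=> hc gd x xr N /=.
under eq_bigr do rewrite mulrDl.
rewrite big_split/= mulrDl (le_trans _ (lerD (hc x xr N) (gd x xr N)))//.
by rewrite opprD addrACA cmodD.
Qed.

Lemma expansionZ h a c r K b : expansion h a c r K ->
  expansion (fun x => b * h x) a (fun k => b * c k) r (cmod b * K).
Proof.
move=> hc x xr N /=.
under eq_bigr do rewrite -mulrA.
by rewrite -mulr_sumr -mulrBr cmodM -mulrA ler_wpM2l ?cmod_ge0// hc.
Qed.

Lemma analytic1_ext h g a : h =1 g -> analytic1 h a -> analytic1 g a.
Proof. by move/funext->. Qed.

Lemma analytic1D h g a : analytic1 h a -> analytic1 g a -> analytic1 (h \+ g) a.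
Proof.
move=> [c [r [K [r0 hc]]]] [d [s [L [s0 gd]]]].
have m0 : 0 < Num.min r s by rewrite lt_min r0.
exists (fun k => c k + d k), (Num.min r s), (K + L); split => //.
by apply: expansionD; [move: hc|move: gd]; apply: expansion_le => //;
  rewrite ge_min lexx ?orbT.
Qed.

Lemma analytic1Z h a b : analytic1 h a -> analytic1 (fun x => b * h x) a.
Proof.
move=> [c [r [K [r0 hc]]]].
by exists (fun k => b * c k), r, (cmod b * K); split => //; exact: expansionZ.
Qed.

Lemma analytic1B h g a : analytic1 h a -> analytic1 g a -> analytic1 (fun x => h x - g x) a.
Proof.
move=> ha ga; apply: analytic1_ext (analytic1D ha (analytic1Z (-1) ga)) => x /=.
by rewrite mulN1r.
Qed.

Lemma analytic1_cst b a : analytic1 (fun=> b) a.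
Proof.
exists (fun k => if k == 0 then b else 0), 1, (cmod b); split => // x x1 [|N].
  by rewrite big_ord0 subr0 expr0 mulr1.
rewrite big_ord_recl/= big1 ?addr0 ?mulr1 ?subrr; last by move=> i _; rewrite mul0r.
by rewrite cmod0 mulr_ge0 ?cmod_ge0// exprn_ge0// divr_ge0// cmod_ge0.
Qed.

Lemma expansion_id a : expansion id a (fun k => if k == 0 then a else (k == 1)%:R) 1 (cmod a + 1).
Proof.
move=> x x1 [|[|N]].
- by rewrite big_ord0 subr0 expr0 mulr1 (le_trans (cmodD _ _))// lerD2l.
- rewrite big_ord_recr big_ord0/= add0r expr0 mulr1 addrC addKr expr1 divr1.
  by rewrite ler_peMl ?cmod_ge0// lerDr cmod_ge0.
- rewrite !big_ord_recl/= big1 ?addr0; last by move=> i _; rewrite mul0r.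
  rewrite expr0 mulr1 mul1r expr1 subrr cmod0.
  by rewrite mulr_ge0 ?addr_ge0 ?cmod_ge0// exprn_ge0// divr_ge0// cmod_ge0.
Qed.

Lemma analytic1_id a : analytic1 id a.
Proof. by do 3!eexists; split; last exact: expansion_id. Qed.

Lemma analytic1_sum I (r : seq I) (P : pred I) (F : I -> C -> C) a :
  (forall i, P i -> analytic1 (F i) a) ->
  analytic1 (fun x => \sum_(i <- r | P i) F i x) a.
Proof.
move=> Fa; elim: r => [|i r ih].
  by apply: analytic1_ext (analytic1_cst 0 a) => x; rewrite big_nil.
have [Pi|nPi] := boolP (P i).
  apply: analytic1_ext (analytic1D (Fa _ Pi) ih) => x /=.
  by rewrite big_cons Pi.
by apply: analytic1_ext ih => x; rewrite big_cons (negbTE nPi).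
Qed.

(** Truncating the Cauchy product leaves one error of size [K L rho^N] and N errors of size
    [2 K L rho^N]. Halving the radius replaces [rho^N] by [2^N rho^N], which absorbs
    [1 + 2 N <= 3 * 2^N]; hence the constant 3. *)
Lemma analytic1M h g a : analytic1 h a -> analytic1 g a ->
  analytic1 (fun x => h x * g x) a.
Proof.
move=> [c [r [K [r0 hc]]]] [d [s [L [s0 gd]]]].
set t := Num.min r s; have t0 : 0 < t by rewrite lt_min r0.
have {}hc : expansion h a c t K by move: hc; apply: expansion_le; rewrite // ge_min lexx.
have {}gd : expansion g a d t L by move: gd; apply: expansion_le; rewrite // ge_min lexx orbT.
have K0 := expansion_K_ge0 t0 hc; have L0 := expansion_K_ge0 t0 gd.
exists (fun k => \sum_(i < k.+1) c i * d (k - i)%N), (t / 2), (3 * (K * L)).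
split=> [|x xt N]; first by rewrite divr_gt0.
have xt' : cmod x <= t by lra.
have -> : \sum_(k < N) (\sum_(i < k.+1) c i * d (k - i)%N) * x ^+ k =
          \sum_(i < N) c i * x ^+ i * \sum_(j < N - i) d j * x ^+ j.
  under [RHS]eq_bigr do rewrite mulr_sumr.
  elim: N => [|N ih]; first by rewrite !big_ord0.
  rewrite big_ord_recr/= ih [RHS]big_ord_recr/= subSnn big_ord1.
  rewrite [X in _ = X + _](_ : _ = \sum_(i < N) (\sum_(j < N - i) c i * x ^+ i * (d j * x ^+ j)
      + c i * d (N - i)%N * x ^+ N)); last first.
    apply: eq_bigr => i _; rewrite subSn ?(ltnW (ltn_ord i))// big_ord_recr/=; congr (_ + _).
    by rewrite mulrACA -exprD subnKC// ltnW.
  rewrite big_split/= -addrA; congr (_ + _); rewrite big_ord_recr/= subnn mulrDl mulr_suml.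
  by rewrite expr0; congr (_ + _); ring.
set rho := cmod x / t.
have rho0 : 0 <= rho by rewrite divr_ge0 ?cmod_ge0// ltW.
pose SN := \sum_(i < N) c i * x ^+ i.
have -> : h (a + x) * g (a + x) - \sum_(i < N) c i * x ^+ i * (\sum_(j < N - i) d j * x ^+ j)
  = (h (a + x) - SN) * g (a + x) + \sum_(i < N) c i * x ^+ i * (g (a + x) - \sum_(j < N - i) d j * x ^+ j).
  rewrite mulrBl /SN mulr_suml.
  under [X in _ = _ + X]eq_bigr do rewrite mulrBr.
  rewrite sumrB; ring.
have B1 : cmod ((h (a + x) - SN) * g (a + x)) <= K * L * rho ^+ N.
  rewrite cmodM mulrAC ler_pM ?cmod_ge0//; first exact: hc.
  by have := gd _ xt' 0; rewrite big_ord0 subr0 expr0 mulr1.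
have B2 : cmod (\sum_(i < N) c i * x ^+ i * (g (a + x) - \sum_(j < N - i) d j * x ^+ j))
   <= N%:R * (2 * (K * L) * rho ^+ N).
  apply: (le_trans (cmod_sum _ _ _)).
  rewrite mulr_natl -[N in _ *+ N]card_ord -sumr_const; apply: ler_sum => i _.
  rewrite cmodM cmodM cmodX.
  have -> : 2 * (K * L) * rho ^+ N = (2 * K * rho ^+ i) * (L * rho ^+ (N - i)).
    by rewrite -[in LHS](subnKC (ltnW (ltn_ord i))) exprD; ring.
  apply: ler_pM; rewrite ?mulr_ge0 ?cmod_ge0 ?exprn_ge0 ?cmod_ge0//; last exact: gd.
  rewrite /rho expr_div_n mulrA ler_pdivlMr ?exprn_gt0// mulrAC.
  by rewrite ler_wpM2r ?exprn_ge0 ?cmod_ge0// (expansion_coef t0 hc).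
have -> : cmod x / (t / 2) = 2 * rho by rewrite /rho; field; rewrite gt_eqF.
rewrite (le_trans (cmodD _ _))// (le_trans (lerD B1 B2))//.
rewrite (exprMn N 2 rho).
have N2 : N%:R <= 2 ^+ N :> R by rewrite -natrX ler_nat ltnW// ltn_expl.
have N1 : 1 <= 2 ^+ N :> R by rewrite -natrX ler1n expn_gt0.
have KL : 0 <= K * L * rho ^+ N by rewrite !mulr_ge0// exprn_ge0.
set P := rho ^+ N in KL *; set T := 2 ^+ N in N1 N2 *.
have -> : K * L * P + N%:R * (2 * (K * L) * P) = (1 + 2 * N%:R) * (K * L * P) by ring.
have -> : 3 * (K * L) * (T * P) = (3 * T) * (K * L * P) by ring.
by rewrite ler_wpM2r//; lra.
Qed.

Lemma analytic1X h a k : analytic1 h a -> analytic1 (fun x => h x ^+ k) a.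
Proof.
move=> ha; elim: k => [|k ih]; first exact: analytic1_cst.
by apply: analytic1_ext (analytic1M ha ih) => x; rewrite exprS.
Qed.

Lemma analytic1_affine h a b p : analytic1 h (p + b * a) -> analytic1 (fun x => h (p + b * x)) a.
Proof.
move=> [c [r [K [r0 hc]]]].
(* The [+ 1] covers [b = 0]; the same device recurs wherever a radius is divided by a bound that may
   vanish. *)
pose s := r / (cmod b + 1).
have b0 : 0 < cmod b + 1 by rewrite ltr_wpDl// cmod_ge0.
have s0 : 0 < s by rewrite divr_gt0.
have K0 := expansion_K_ge0 r0 hc.
exists (fun k => c k * b ^+ k), s, K; split => // x xs N.
have -> : p + b * (a + x) = (p + b * a) + b * x by ring.
have bx : cmod (b * x) <= cmod x * (cmod b + 1).
  by rewrite cmodM mulrC ler_wpM2l ?cmod_ge0// lerDl.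
have bxr : cmod (b * x) <= r by rewrite (le_trans bx)// -ler_pdivlMr.
under eq_bigr do rewrite -mulrA -exprMn.
apply: (le_trans (hc _ bxr N)).
rewrite ler_wpM2l// lerXn2r ?nnegrE ?cmod_divr_ge0//.
by rewrite /s invf_div mulrA ler_pM2r// invr_gt0.
Qed.

Lemma analytic1_eq_near h g a e : 0 < e -> (forall x, cmod (x - a) <= e -> h x = g x) ->
  analytic1 h a -> analytic1 g a.
Proof.
move=> e0 hg [c [r [K [r0 hc]]]].
have m0 : 0 < Num.min r e by rewrite lt_min r0.
have {}hc : expansion h a c (Num.min r e) K.
  by move: hc; apply: expansion_le => //; rewrite ge_min lexx.
exists c, (Num.min r e), K; split => // x xm N; rewrite -hg; first exact: hc.
by rewrite addrC addKr (le_trans xm)// ge_min lexx orbT.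
Qed.

End one_variable.

(** * The Hermitian space C^n *)

Definition cip (R : realType) n (z w : Cn R n) : R[i] :=
  \sum_(i < n) z ord0 i * ((w ord0 i)^*)%C.

Section cvnorm_theory.
Variables (R : realType) (n : nat).
Implicit Types z w v : Cn R n.

Lemma cvnorm_ge0 z : 0 <= cvnorm z.
Proof. exact: sqrtr_ge0. Qed.

Lemma sqr_cvnorm z : cvnorm z ^+ 2 = \sum_(i < n) cmod (z ord0 i) ^+ 2.
Proof. by rewrite sqr_sqrtr// sumr_ge0// => i _; rewrite sqr_ge0. Qed.

Lemma cipDl z w v : cip (z + w) v = cip z v + cip w v.
Proof. by rewrite -big_split; apply: eq_bigr => i _; rewrite mxE mulrDl. Qed.

Lemma cipZl (a : R[i]) z v : cip (a *: z) v = a * cip z v.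
Proof. by rewrite mulr_sumr; apply: eq_bigr => i _; rewrite mxE mulrA. Qed.

Lemma cipJ z w : ((cip z w)^*)%C = cip w z.
Proof.
by rewrite rmorph_sum; apply: eq_bigr => i _; rewrite rmorphM/= conjcK mulrC.
Qed.

Lemma cipNl z v : cip (- z) v = - cip z v.
Proof. by rewrite -scaleN1r cipZl mulN1r. Qed.

Lemma cipBl z w v : cip (z - w) v = cip z v - cip w v.
Proof. by rewrite cipDl cipNl. Qed.

Lemma cipDr z w v : cip v (z + w) = cip v z + cip v w.
Proof. by rewrite -cipJ cipDl rmorphD/= !cipJ. Qed.

Lemma cipZr (a : R[i]) z v : cip v (a *: z) = (a^*)%C * cip v z.
Proof. by rewrite -cipJ cipZl rmorphM/= !cipJ. Qed.

Lemma cipBr z w v : cip v (z - w) = cip v z - cip v w.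
Proof. by rewrite -cipJ cipBl rmorphB/= !cipJ. Qed.

Lemma cip_sqr z : cip z z = ((cvnorm z ^+ 2)%:C)%C.
Proof.
by rewrite sqr_cvnorm rmorph_sum; apply: eq_bigr => i _; rewrite -sqr_cmodC.
Qed.

Lemma cvnormZ (a : R[i]) z : cvnorm (a *: z) = cmod a * cvnorm z.
Proof.
apply/eqP; rewrite -(@eqrXn2 _ 2) ?mulr_ge0 ?cmod_ge0 ?cvnorm_ge0//.
rewrite exprMn !sqr_cvnorm mulr_sumr; apply/eqP; apply: eq_bigr => i _.
by rewrite mxE cmodM exprMn.
Qed.

Lemma cvnormN z : cvnorm (- z) = cvnorm z.
Proof. by rewrite -scaleN1r cvnormZ cmodN cmod1 mul1r. Qed.

Lemma cvnormB z w : cvnorm (z - w) = cvnorm (w - z).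
Proof. by rewrite -cvnormN opprB. Qed.

Lemma cvnorm0 : cvnorm (0 : Cn R n) = 0.
Proof. by rewrite -(scale0r (0 : Cn R n)) cvnormZ cmod0 mul0r. Qed.

Lemma cvnorm_eq0 z : (cvnorm z == 0) = (z == 0).
Proof.
apply/eqP/eqP => [z0|->]; last exact: cvnorm0.
have : \sum_(i < n) cmod (z ord0 i) ^+ 2 = 0 by rewrite -sqr_cvnorm z0 expr0n.
move=> /psumr_eq0P h; apply/rowP => i; rewrite mxE; apply/eqP.
rewrite -cmod_eq0 -sqrf_eq0 h// => j _; exact: sqr_ge0.
Qed.

Lemma cvnorm_gt0 z : (0 < cvnorm z) = (z != 0).
Proof. by rewrite lt_neqAle cvnorm_ge0 andbT eq_sym cvnorm_eq0. Qed.

Lemma cvnormD_sqr z w :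
  cvnorm (z + w) ^+ 2 = cvnorm z ^+ 2 + cvnorm w ^+ 2 + 2 * complex.Re (cip z w).
Proof.
have : (cvnorm (z + w) ^+ 2)%:C%C = cip z z + cip w w + (cip z w + (cip z w)^*%C).
  by rewrite -cip_sqr cipDl !cipDr cipJ; ring.
rewrite addcJ !cip_sqr => /(congr1 (@complex.Re R))/= ->.
by case: (cip z w) => a b /=; ring.
Qed.

(** Expand the squared norm of [|w|^2 z - <z, w> w], the component of [z] orthogonal to [w] cleared
    of its denominator. *)
Lemma cip_CS z w : cmod (cip z w) <= cvnorm z * cvnorm w.
Proof.
have [->|w0] := eqVneq w 0.
  rewrite cvnorm0 mulr0 /cip big1 ?cmod0// => i _.
  by rewrite mxE conjc0 mulr0.
set W := cvnorm w; set c := cip z w.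
have W0 : 0 < W by rewrite cvnorm_gt0.
have : (cvnorm ((W ^+ 2)%:C%C *: z - c *: w) ^+ 2)%:C%C =
       ((W ^+ 2) * (W ^+ 2 * cvnorm z ^+ 2 - cmod c ^+ 2))%:C%C.
  rewrite -cip_sqr cipBl !cipBr !cipZl !cipZr !cip_sqr conjc_real -/W -/c.
  rewrite -(cipJ z w) -/c [RHS]rmorphM/= rmorphB/= [X in _ * (X - _)]rmorphM/= (sqr_cmodC c).
  by rewrite !rmorphXn/=; ring.
move=> /complexI h; have := sqr_ge0 (cvnorm ((W ^+ 2)%:C%C *: z - c *: w)).
rewrite h pmulr_rge0 ?exprn_gt0// subr_ge0 -exprMn mulrC.
by rewrite ler_pXn2r// ?nnegrE ?cmod_ge0// mulr_ge0 ?cvnorm_ge0.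
Qed.

Lemma cvnormD z w : cvnorm (z + w) <= cvnorm z + cvnorm w.
Proof.
rewrite -(@ler_pXn2r _ 2) ?nnegrE ?addr_ge0 ?cvnorm_ge0// cvnormD_sqr sqrrD.
have : complex.Re (cip z w) <= cvnorm z * cvnorm w.
  by rewrite (le_trans (ler_norm _))// (le_trans (Re_le_cmod _))// cip_CS.
rewrite -mulr_natl; lra.
Qed.

Lemma cvnorm_distB z w : cvnorm z - cvnorm w <= cvnorm (z - w).
Proof. by rewrite lerBlDr -{1}(subrK w z) cvnormD. Qed.

Lemma coord_le_cvnorm z i : cmod (z ord0 i) <= cvnorm z.
Proof.
rewrite -(@ler_pXn2r _ 2) ?nnegrE ?cmod_ge0 ?cvnorm_ge0// sqr_cvnorm.
by rewrite (bigD1 i)//= lerDl sumr_ge0// => j _; exact: sqr_ge0.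
Qed.

Lemma cvnorm_le_sum z : cvnorm z <= \sum_(i < n) cmod (z ord0 i).
Proof.
have s0 (P : pred 'I_n) : 0 <= \sum_(i | P i) cmod (z ord0 i).
  by rewrite sumr_ge0// => i _; exact: cmod_ge0.
rewrite -(@ler_pXn2r _ 2) ?nnegrE ?cvnorm_ge0// sqr_cvnorm expr2 mulr_suml.
apply: ler_sum => i _; rewrite expr2 ler_wpM2l ?cmod_ge0//.
by rewrite (bigD1 i)//= lerDl.
Qed.

End cvnorm_theory.

(** * Compactness of closed bounded sets of C^n *)

Section compactness.
Variable R : realType.

Definition cont_on n (S : set (Cn R n)) (u : Cn R n -> R) : Prop :=
  forall z, S z -> forall e, 0 < e -> exists2 d, 0 < d &
    forall w, S w -> cvnorm (w - z) < d -> `|u w - u z| < e.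

Definition adherent_closed n (S : set (Cn R n)) : Prop :=
  forall z, (forall e, 0 < e -> exists2 w, S w & cvnorm (w - z) < e) -> S z.

Let cvec n (v : 'rV[R]_(n + n)) : Cn R n :=
  \row_i (v ord0 (lshift n i) +i* v ord0 (rshift n i))%C.

Let cvecB n (v w : 'rV[R]_(n + n)) : cvec (v - w) = cvec v - cvec w.
Proof. by apply/rowP => i; rewrite !mxE. Qed.

Let cvec_surj n (z : Cn R n) : exists v, cvec v = z.
Proof.
exists (\row_i match fintype.split i with
  | inl j => complex.Re (z ord0 j) | inr j => complex.Im (z ord0 j) end).
apply/rowP => i; rewrite !mxE (unsplitK (inl _ i)) (unsplitK (inr _ i)).
by case: (z _ _).
Qed.

Let cvec_le n (v : 'rV[R]_(n + n)) (e : R) : (forall i, `|v ord0 i| < e) ->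
  cvnorm (cvec v) <= n%:R * (2 * e).
Proof.
move=> ve; apply: (le_trans (cvnorm_le_sum _)).
rewrite mulr_natl -[n in _ *+ n]card_ord -sumr_const; apply: ler_sum => i _.
rewrite mxE (le_trans (cmod_le_ReIm _))//=.
by rewrite mulr_natl mulr2n lerD// ltW.
Qed.

(** In the real coordinates [cvec] the set [S] becomes a closed subset of a box of R^(2n), hence
    compact, and the extreme value theorem applies. *)
Lemma cont_attains_max n (S : set (Cn R n)) (u : Cn R n -> R) (rho : R) :
  S !=set0 -> (forall z, S z -> cvnorm z <= rho) -> adherent_closed S ->
  cont_on S u -> exists2 z, S z & forall w, S w -> u w <= u z.
Proof.
move=> [s Ss] Sb Sc Su.
pose A := [set v : 'rV[R]_(n + n) | S (cvec v)].
(* Compares the sup norm of the real coordinates with [cvnorm]: n complex coordinates of two real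
   ones each. *)
pose m : R := n%:R * 2 + 1.
have m0 : 0 < m by rewrite ltr_wpDl.
have nearP (v : 'rV[R]_(n + n)) (e : R) : 0 < e -> \forall w \near v, cvnorm (cvec w - cvec v) < e.
  move=> e0; apply/nbhs_ballP; exists (e / m); first by rewrite /= divr_gt0.
  move=> w [_ vw]; rewrite -cvecB.
  apply: (@le_lt_trans _ _ (n%:R * (2 * (e / m)))).
    by apply: cvec_le => i; rewrite !mxE distrC; exact: vw.
  by rewrite 2!mulrA ltr_pdivrMr// mulrC ltr_pM2l// /m ltrDl.
have cA : compact A.
  apply: (@subclosed_compact _ _ [set v : 'rV[R]_(n + n) | forall i, `[-rho, rho]%classic (v ord0 i)]).
  - move=> v; rewrite /closure/= => Av; apply: Sc => e e0.
    have [w [Sw wv]] := Av _ (nearP v e e0).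
    by exists (cvec w).
  - apply: (@rV_compact R (n + n) (fun=> `[-rho, rho]%classic)) => i.
    exact: segment_compact.
  - move=> v /= Av i; rewrite in_itv/= -ler_norml.
    have := Sb _ Av => h; rewrite -(splitK i); case: (fintype.split i) => j /=.
    + rewrite (le_trans _ h)// (le_trans _ (coord_le_cvnorm _ j))// mxE.
      exact: (Re_le_cmod (_ +i* _)%C).
    + rewrite (le_trans _ h)// (le_trans _ (coord_le_cvnorm _ j))// mxE.
      exact: (Im_le_cmod (_ +i* _)%C).
have cu : {within A, continuous (u \o @cvec n)}.
  apply/subspace_continuousP => v Av; apply/cvgrPdist_lt => e e0.
  have [d d0 hd] := Su _ Av _ e0.
  rewrite near_withinE; near=> w => Aw /=.
  rewrite distrC; apply: hd => //.
  near: w; exact: nearP.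
have A0 : A !=set0 by have [v vs] := cvec_surj s; exists v; rewrite /A/= vs.
have [c cA' hc] := compact_EVT_max A0 cA cu.
exists (cvec c); first by rewrite inE in cA'.
move=> w Sw; have [v vw] := cvec_surj w.
by have := hc v; rewrite inE /A/= vw; apply.
Unshelve. all: end_near. Qed.

End compactness.

(** * The maximum principle *)

Definition cont1_on (R : realType) (D : set R[i]) (u : R[i] -> R) : Prop :=
  forall x, D x -> forall e, 0 < e -> exists2 d, 0 < d &
    forall y, D y -> cmod (y - x) < d -> `|u y - u x| < e.

Section maximum_principle.
Variable R : realType.
Local Notation C := R[i].
Implicit Types (h p : C -> C) (u v : C -> R) (a x : C).

Lemma le_limit (w : nat -> R) (l b : R) :
  w @ \oo --> l -> (forall N, b <= w N) -> b <= l.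
Proof.
move=> wl bw; rewrite -(cvg_lim _ wl)//; apply: limr_ge.
  by apply/cvg_ex; exists l.
by near=> N; exact: bw.
Unshelve. all: end_near. Qed.

Lemma loc_max_prop_near u v a e : 0 < e -> (forall x, cmod (x - a) < e -> u x = v x) ->
  loc_max_prop u a -> loc_max_prop v a.
Proof.
move=> e0 uv [h|[d d0 h]]; [left|right].
  move=> d d0; have [|x xa ux] := h (Num.min d e); first by rewrite lt_min d0.
  move: xa; rewrite lt_min => /andP[xd xe]; exists x => //.
  by rewrite -!uv// subrr cmod0.
exists (Num.min d e); first by rewrite lt_min d0.
by move=> x; rewrite lt_min => /andP[xd xe]; rewrite -!uv ?h// subrr cmod0.
Qed.

Lemma analytic1_lip h a : analytic1 h a -> exists r L, [/\ 0 < r, 0 <= L &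
  forall x, cmod x <= r -> cmod (h (a + x) - h a) <= L * cmod x].
Proof.
move=> [c [r [K [r0 hc]]]]; exists r, (K / r); split => //.
  by rewrite divr_ge0 ?(expansion_K_ge0 r0 hc)// ltW.
move=> x xr; have := hc x xr 1.
by rewrite big_ord1 expr0 mulr1 (expansion0 r0 hc) expr1 mulrA mulrAC.
Qed.

Lemma analytic1_cont h a : analytic1 h a -> forall e, 0 < e -> exists2 d, 0 < d &
  forall x, cmod (x - a) < d -> cmod (h x - h a) < e.
Proof.
move=> /analytic1_lip[r [L [r0 L0 hL]]] e e0.
have L1 : 0 < L + 1 by rewrite ltr_wpDl.
exists (Num.min r (e / (L + 1))); first by rewrite lt_min r0 divr_gt0.
move=> x; rewrite lt_min => /andP[xr xe].
have := hL _ (ltW xr); rewrite subrKC => /le_lt_trans; apply.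
apply: (@le_lt_trans _ _ ((L + 1) * cmod (x - a))).
  by rewrite ler_wpM2r ?cmod_ge0// lerDl.
by rewrite mulrC -ltr_pdivlMr.
Qed.

(** The least index of a nonzero coefficient gives the leading term. If there is none, the
    remainders at half the radius are at most [K / 2^N] for every N, so [h] vanishes there. *)
Lemma analytic1_germ h a : analytic1 h a -> h a = 0 ->
  (exists2 r, 0 < r & forall x, cmod x <= r -> h (a + x) = 0) \/
  exists k b r K, [/\ (0 < k)%N, b != 0, 0 < r, 0 <= K &
    forall x, cmod x <= r -> cmod (h (a + x) - b * x ^+ k) <= K * cmod x ^+ k.+1].
Proof.
move=> [c [r [K [r0 hc]]]] ha; have K0 := expansion_K_ge0 r0 hc.
have [[k ck]|c0] := pselect (exists k, c k != 0); last first.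
  have {}c0 k : c k = 0 by apply/eqP/negP => /negP ck; apply: c0; exists k.
  left; exists (r / 2); first by rewrite divr_gt0.
  move=> x xr; apply/eqP; rewrite -cmod_eq0 eq_le cmod_ge0 andbT.
  have xr' : cmod x <= r by lra.
  have hN N : cmod (h (a + x)) <= K * (2^-1) ^+ N.
    have := hc x xr' N; rewrite big1 ?subr0; last by move=> i _; rewrite c0 mul0r.
    move=> /le_trans; apply; rewrite ler_wpM2l// lerXn2r ?nnegrE ?cmod_divr_ge0//.
    by rewrite ler_pdivrMr// mulrC.
  have h2 : `|2^-1 : R| < 1 by rewrite ger0_norm//; lra.
  have : (fun N => K * (2^-1 : R) ^+ N) @ \oo --> K * 0.
    by apply: cvgMr; exact: cvg_expr.
  rewrite mulr0 => cv.
  exact: le_limit cv hN.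
right; have exc : exists k, c k != 0 by exists k.
pose m := ex_minn exc; have [cm mmin] : c m != 0 /\ forall j, (j < m)%N -> c j = 0.
  rewrite /m; case: ex_minnP => i ci imin; split => // j ji; apply/eqP/negP => /negP.
  by move=> /imin; rewrite leqNgt ji.
exists m, (c m), r, (K / r ^+ m.+1); split => //.
- rewrite lt0n; apply: contraNneq cm => m0; rewrite m0 (expansion0 r0 hc) ha//.
- by rewrite divr_ge0// exprn_ge0// ltW.
move=> x xr; have := hc x xr m.+1; rewrite big_ord_recr/= big1 ?add0r; last first.
  by move=> i _; rewrite mmin ?mul0r.
by rewrite expr_div_n mulrA mulrAC.
Qed.

(** With [c = h a / p a] one compares [|h|] with [|c p|], so the germ of [h - c p], which vanishes
    at [a], decides: if it is zero the ratio is locally constant, otherwise a k-th root turns its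
    leading term [b x^k] in the direction of [h a]. *)
Lemma loc_max_ratio h p a : analytic1 h a -> analytic1 p a -> p a != 0 ->
  loc_max_prop (fun x => cmod (h x) / cmod (p x)) a.
Proof.
move=> ha pa pa0; set c := h a / p a.
have ga : analytic1 (fun x => h x - c * p x) a.
  by apply: analytic1B => //; exact: analytic1Z.
have g0 : (fun x => h x - c * p x) a = 0 by rewrite /= divfK// subrr.
have P0 : 0 < cmod (p a) by rewrite cmod_gt0.
have [r1 r10 hp] : exists2 r, 0 < r & forall x, cmod x < r ->
    cmod (p a) / 2 < cmod (p (a + x)).
  have [|d d0 hd] := analytic1_cont pa (e := cmod (p a) / 2); first by rewrite divr_gt0.
  exists d => // x xd; have := hd (a + x); rewrite [a + x]addrC addrK => /(_ xd).
  by rewrite cmodB => /(le_lt_trans (cmod_distB _ _)); lra.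
have [[r r0 gz]|[k [b [r [K [k0 b0 r0 K0 hg]]]]]] := analytic1_germ ga g0.
  right; exists (Num.min r r1); first by rewrite lt_min r0.
  move=> x; rewrite lt_min => /andP[xr xr1].
  have := gz _ (ltW xr); have := hp _ xr1.
  rewrite addrC subrK => px /eqP; rewrite subr_eq0 => /eqP ->.
  rewrite cmodM mulfK; last by rewrite gt_eqF//; lra.
  by rewrite -cmodV -cmodM.
left => e e0.
have [l [L [l0 L0 hL]]] := analytic1_lip pa.
(* If [h a = 0] any direction increases the modulus, and [y = 1] serves. *)
have [y y0 hy] : exists2 y, y != 0 & b * y ^+ k = if h a == 0 then b else h a.
  have [_|ha0] := eqVneq (h a) 0; first by exists 1; rewrite ?oner_eq0// expr1n mulr1.
  exists (k.-root (h a / b)); last by rewrite rootCK// mulrC divfK.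
  by rewrite rootC_eq0// mulf_neq0// invr_eq0.
set Y := cmod y; have Y0 : 0 < Y by rewrite cmod_gt0.
set B := K * Y ^+ k.+1 + cmod c * L * Y.
have B0 : 0 <= B by rewrite addr_ge0 ?mulr_ge0 ?exprn_ge0 ?cmod_ge0// ltW.
set hb := if h a == 0 then b else h a in hy.
have hb0 : hb != 0 by rewrite /hb; case: (eqVneq (h a) 0).
(* The perturbation [b x^k] of size [t^k |hb|], pointing in the direction of
   [h a], dominates all the error terms, of size [t^(k+1) B]. *)
have [t [[t0 t1 tr tr1 tl] [te tB]]] : exists t : R,
   [/\ 0 < t, t < 1, t * Y < r, t * Y < r1 & t * Y < l] /\ t * Y < e /\
     t * B < cmod hb / 2.
  pose t := (Num.min 1 (Num.min (Num.min r r1) (Num.min l e) / Y)) / 2.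
  pose t' := Num.min t (cmod hb / (4 * (B + 1))).
  have B1 : 0 < B + 1 by rewrite ltr_wpDl.
  have hb0' : 0 < cmod hb by rewrite cmod_gt0.
  have m0 : 0 < Num.min (Num.min r r1) (Num.min l e) by rewrite !lt_min r0 r10 l0 e0.
  have t0 : 0 < t by rewrite divr_gt0// lt_min ltr01 divr_gt0.
  have t'0 : 0 < t' by rewrite lt_min t0 divr_gt0// mulr_gt0.
  have t'Y z : 0 < z -> Num.min (Num.min r r1) (Num.min l e) <= z -> t' * Y < z.
    move=> z0 hz; rewrite -ltr_pdivlMr//.
    apply: (@le_lt_trans _ _ t); first by rewrite ge_min lexx.
    have m1 : Num.min 1 (Num.min (Num.min r r1) (Num.min l e) / Y) <= z / Y.
      by rewrite ge_min ler_pM2r ?invr_gt0// hz orbT.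
    have zY : 0 < z / Y by rewrite divr_gt0.
    rewrite /t; lra.
  exists t'; split; [split|split] => //.
  - apply: (@le_lt_trans _ _ t); first by rewrite ge_min lexx.
    have : Num.min 1 (Num.min (Num.min r r1) (Num.min l e) / Y) <= 1 by rewrite ge_min lexx.
    rewrite /t; lra.
  - by apply: t'Y => //; rewrite !ge_min lexx.
  - by apply: t'Y => //; rewrite !ge_min lexx ?orbT.
  - by apply: t'Y => //; rewrite !ge_min lexx ?orbT.
  - by apply: t'Y => //; rewrite !ge_min lexx ?orbT.
  - have h1 : t' <= cmod hb / (4 * (B + 1)) by rewrite ge_min lexx orbT.
    apply: (@le_lt_trans _ _ (t' * (B + 1))); first by rewrite ler_wpM2l ?lerDl// ltW.
    apply: (@le_lt_trans _ _ (cmod hb / (4 * (B + 1)) * (B + 1))).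
      by rewrite ler_wpM2r// ltW.
    rewrite invfM !mulrA mulfVK ?gt_eqF//; lra.
pose x := t%:C%C * y.
have xn : cmod x = t * Y by rewrite cmodM cmod_real gtr0_norm.
have hgx := hg x; rewrite xn in hgx; have {hgx} := hgx (ltW tr).
have hLx := hL x; rewrite xn in hLx; have {hLx} := hLx (ltW tl).
have hpx := hp x; rewrite xn in hpx; have {hpx} := hpx tr1.
set px := p (a + x); set hx := h (a + x) => hpx hLx hgx.
exists (a + x); first by rewrite addrC addKr xn.
have px0 : 0 < cmod px by lra.
rewrite -/px -/hx ltr_pdivlMr//.
have -> : cmod (h a) / cmod (p a) * cmod px = cmod (c * px) by rewrite /c !cmodM cmodV.
have bx : b * x ^+ k = (t ^+ k)%:C%C * hb.
  by rewrite /x exprMn mulrCA -rmorphXn hy.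
have tk0 : 0 < t ^+ k by rewrite exprn_gt0.
rewrite bx in hgx.
have : cmod (hx - (c * px + (t ^+ k)%:C%C * hb)) <= K * (t * Y) ^+ k.+1.
  by rewrite opprD addrA.
move=> {}hgx.
have [ha0|ha0] := eqVneq (h a) 0.
  have c0 : c = 0 by rewrite /c ha0 mul0r.
  move: hgx; rewrite c0 !mul0r cmod0 add0r => hgx.
  have : cmod ((t ^+ k)%:C%C * hb) - cmod hx <= K * (t * Y) ^+ k.+1.
    by apply: le_trans hgx; rewrite cmodB; exact: cmod_distB.
  rewrite cmodM cmod_real gtr0_norm// => h1.
  have : K * (t * Y) ^+ k.+1 <= t ^+ k * (t * B).
    rewrite exprMn exprSr mulrCA -!mulrA ler_wpM2l ?(ltW tk0)// ler_wpM2l ?(ltW t0)//.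
    by rewrite /B lerDl !mulr_ge0 ?cmod_ge0// ltW.
  have : t ^+ k * (t * B) < t ^+ k * (cmod hb / 2) by rewrite ltr_pM2l.
  have : 0 < t ^+ k * cmod hb by rewrite mulr_gt0// cmod_gt0.
  lra.
have hbE : hb = c * p a by rewrite /hb (negbTE ha0) /c divfK.
(* Since [h a = c * p a], adding [t^k h a] amounts to multiplying [c p] by [1 + t^k], up to
   replacing [p (a + x)] by [p a]; the Lipschitz term of [B] pays for this. *)
have : cmod (hx - (1 + t ^+ k)%:C%C * (c * px)) <= t ^+ k * (t * B).
  have -> : hx - (1 + t ^+ k)%:C%C * (c * px) =
     (hx - (c * px + (t ^+ k)%:C%C * hb)) - (t ^+ k)%:C%C * c * (px - p a).
    by rewrite hbE rmorphD rmorph1; ring.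
  apply: (le_trans (cmodD _ _)); rewrite cmodN (cmodM _ (px - p a)) (cmodM _ c) cmod_real gtr0_norm//.
  rewrite /B !mulrDr lerD//.
    by apply: (le_trans hgx); rewrite exprMn exprSr; rewrite le_eqVlt; apply/orP; left; apply/eqP; ring.
  rewrite -!mulrA ler_wpM2l ?(ltW tk0)// mulrCA ler_wpM2l ?cmod_ge0//.
  by apply: (le_trans hLx); rewrite le_eqVlt; apply/orP; left; apply/eqP; ring.
move=> {}hgx.
have : (1 + t ^+ k) * cmod (c * px) - cmod hx <= t ^+ k * (t * B).
  apply: le_trans hgx; rewrite cmodB -[X in X * _]ger0_norm; last by rewrite addr_ge0// ltW.
  by rewrite -cmod_real -cmodM; exact: cmod_distB.
have : t ^+ k * (t * B) < t ^+ k * (cmod hb / 2) by rewrite ltr_pM2l.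
have : t ^+ k * (cmod hb / 2) <= t ^+ k * cmod (c * px).
  rewrite ler_wpM2l ?(ltW tk0)// hbE (cmodM c (p a)) (cmodM c px) -mulrA ler_wpM2l ?cmod_ge0//; exact: ltW.
lra.
Qed.

End maximum_principle.

Section disc.
Variable R : realType.
Local Notation C := R[i].
Implicit Types (h p : C -> C) (u v : C -> R) (a x : C).

Lemma cont1_attains_max (D : set C) u rho : D !=set0 ->
  (forall x, D x -> cmod x <= rho) ->
  (forall x, (forall e, 0 < e -> exists2 y, D y & cmod (y - x) < e) -> D x) ->
  cont1_on D u -> exists2 x, D x & forall y, D y -> u y <= u x.
Proof.
move=> [d Dd] Db Dc Du.
pose toC (z : Cn R 1) : C := z ord0 ord0.
have toCn z : cvnorm z = cmod (toC z).
  by rewrite /cvnorm big_ord1 sqrtr_sqr ger0_norm// cmod_ge0.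
have toCB z w : toC (z - w) = toC z - toC w by rewrite /toC !mxE.
have toK x : toC (\row_(i < 1) x) = x by rewrite /toC mxE.
have [||||z Sz hz] := @cont_attains_max R 1 (toC @^-1` D) (u \o toC) rho.
- by exists (\row__ d); rewrite /= toK.
- by move=> z /Db; rewrite toCn.
- move=> z hz; apply: Dc => e e0; have [w Sw] := hz _ e0.
  by rewrite toCn toCB => we; exists (toC w).
- move=> z Sz e e0; have [r r0 hr] := Du _ Sz _ e0.
  by exists r => // w Sw; rewrite toCn toCB; exact: hr.
exists (toC z) => // y Dy.
by have := hz (\row__ y); rewrite /= toK; apply.
Qed.

(** At a maximum point of largest modulus lying inside the disc, the first alternative of
    [loc_max_prop] contradicts maximality and the second lets the point move outward. *)
Lemma maximum_principle u rho B : 0 < rho ->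
  cont1_on [set x | cmod x <= rho] u ->
  (forall x, cmod x < rho -> loc_max_prop u x) ->
  (forall x, cmod x = rho -> u x <= B) ->
  forall x, cmod x <= rho -> u x <= B.
Proof.
move=> rho0 cu lu uB.
have Dc x : (forall e, 0 < e -> exists2 y, cmod y <= rho & cmod (y - x) < e) -> cmod x <= rho.
  move=> h; rewrite leNgt; apply/negP => rx.
  have [|y yr] := h (cmod x - rho); first by rewrite subr_gt0.
  by rewrite cmodB => /(le_lt_trans (cmod_distB _ _)); lra.
have [||//||x0 x0D x0max] := @cont1_attains_max [set x | cmod x <= rho] u rho.
- by exists 0; suff: cmod (0 : C) <= rho by []; rewrite cmod0 ltW.
- by [].
- by [].
pose S := [set x | cmod x <= rho /\ u x0 <= u x].
(* Among the maximum points, one of largest modulus lies on the circle. *)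
have [||||x1 [x1D x1m] x1max] := @cont1_attains_max S (@ComplexField.Normc.normc R) rho.
- by exists x0.
- by move=> x [].
- move=> x h; have xr : cmod x <= rho by apply: Dc => e /h[y [yr _]] ?; exists y.
  split=> //; rewrite leNgt; apply/negP => ux.
  have e0 : 0 < u x0 - u x by rewrite subr_gt0.
  have [d d0 hd] := cu _ xr _ e0.
  have [y [yr uy] yx] := h _ d0.
  have := hd _ yr yx; rewrite ltr_norml; lra.
- by move=> x _ e e0; exists e => // y _; exact: le_lt_trans (cmod_dist _ _).
suff x1r : cmod x1 = rho.
  by move=> x xr; rewrite (le_trans (x0max _ xr))// (le_trans x1m)// uB.
apply/eqP; rewrite eq_le x1D/= leNgt; apply/negP => x1r.
case: (lu _ x1r) => [/(_ (rho - cmod x1))|[e e0 he]].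
  rewrite subr_gt0 => /(_ x1r)[x xx1 ux].
  have xr : cmod x <= rho.
    have := cmod_distB x x1; lra.
  by have := x0max _ xr; rewrite leNgt (le_lt_trans x1m).
(* The outward direction at [x1]; at the centre any unit number serves. *)
pose w : C := if x1 == 0 then 1 else ((cmod x1)^-1)%:C%C * x1.
have w1 : cmod w = 1.
  rewrite /w; case: (eqVneq x1 0) => [_|x10]; first by rewrite cmod1.
  by rewrite cmodM cmod_real ger0_norm ?invr_ge0 ?cmod_ge0// mulVf// cmod_eq0.
have x1w : x1 = (cmod x1)%:C%C * w.
  rewrite /w; case: (eqVneq x1 0) => [->|x10]; first by rewrite cmod0 mul0r.
  by rewrite mulrA -rmorphM divff ?mul1r// cmod_eq0.
pose t := Num.min e (rho - cmod x1) / 2.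
have m0 : 0 < Num.min e (rho - cmod x1) by rewrite lt_min e0 subr_gt0.
have me : Num.min e (rho - cmod x1) <= e by rewrite ge_min lexx.
have mr : Num.min e (rho - cmod x1) <= rho - cmod x1 by rewrite ge_min lexx orbT.
pose y := x1 + t%:C%C * w.
have yn : cmod y = cmod x1 + t.
  rewrite /y {1}x1w -mulrDl -rmorphD cmodM w1 mulr1 cmod_real ger0_norm//.
  by rewrite addr_ge0 ?cmod_ge0// /t; lra.
have yx1 : cmod (y - x1) < e.
  rewrite /y addrAC subrr add0r cmodM w1 mulr1 cmod_real ger0_norm; rewrite /t; lra.
have Sy : S y.
  split; first by rewrite yn /t; lra.
  by rewrite (he _ yx1).
have := x1max _ Sy; rewrite yn /t; lra.
Qed.

Lemma analytic1_max h rho r B : 0 < r -> r < rho ->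
  (forall x, cmod x < rho -> analytic1 h x) ->
  (forall x, cmod x = r -> cmod (h x) <= B) ->
  forall x, cmod x <= r -> cmod (h x) <= B.
Proof.
move=> r0 rrho ha hB; apply: (maximum_principle r0) => //.
- move=> x xr e e0.
  have [d d0 hd] := analytic1_cont (ha _ (le_lt_trans xr rrho)) e0.
  by exists d => // y _ yx; rewrite (le_lt_trans (cmod_dist _ _))// hd.
- move=> x xr.
  have ax := ha _ (lt_trans xr rrho).
  apply: loc_max_prop_near ltr01 _ (loc_max_ratio ax (analytic1_cst 1 x) _).
    by move=> y _; rewrite cmod1 divr1.
  exact: oner_neq0.
Qed.

Lemma analytic1_inv a : a != 0 -> analytic1 (fun x => x^-1) a.
Proof.
move=> a0; have A0 : 0 < cmod a by rewrite cmod_gt0.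
exists (fun k => (-1) ^+ k / a ^+ k.+1), (cmod a / 2), (2 / cmod a).
split=> [|x xa N]; first by rewrite divr_gt0.
have ax : cmod a / 2 <= cmod (a + x).
  have := cmod_distB a (- x); rewrite opprK cmodN; lra.
have ax0 : a + x != 0 by rewrite -cmod_gt0; lra.
have -> : (a + x)^-1 - \sum_(k < N) (-1) ^+ k / a ^+ k.+1 * x ^+ k = (- x / a) ^+ N / (a + x).
  elim: N => [|N ih]; first by rewrite big_ord0 subr0 expr0 mul1r.
  rewrite big_ord_recr/= opprD addrA ih.
  have -> : (-1) ^+ N / a ^+ N.+1 * x ^+ N = (- x / a) ^+ N / a.
    by rewrite -[- x]mulN1r 2!exprMn exprVn exprS invfM; ring.
  rewrite exprS; set P := (_ / _) ^+ N.
  by field; rewrite ax0 a0.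
rewrite cmodM cmodX cmodV cmodM cmodN cmodV.
rewrite [leLHS]mulrC ler_pM// ?invr_ge0 ?cmod_ge0 ?exprn_ge0 ?cmod_divr_ge0//.
  rewrite -[2 / _]invrK invf_div lef_pV2 ?posrE// ?cmod_gt0// divr_gt0//.
rewrite lerXn2r ?nnegrE ?cmod_divr_ge0// ?divr_gt0//.
rewrite ler_wpM2l ?cmod_ge0// lef_pV2 ?posrE ?divr_gt0//; lra.
Qed.

(** The value at 0 fills the removable singularity, so that the maximum principle applies to the
    quotient. This is the device of the Schwarz lemma, and it yields both the Cauchy estimates and
    the remainder bounds. *)
Definition taylor_quot h (c : nat -> C) N : C -> C := fun x =>
  if x == 0 then c N else (h x - \sum_(k < N) c k * x ^+ k) / x ^+ N.

Lemma analytic1_taylor_quot h c r K rho N : 0 < r -> expansion h 0 c r K ->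
  (forall x, cmod x < rho -> analytic1 h x) ->
  forall x, cmod x < rho -> analytic1 (taylor_quot h c N) x.
Proof.
move=> r0 hc ha a arho; have [->|a0] := eqVneq a 0.
  have K0 := expansion_K_ge0 r0 hc.
  exists (fun k => c (N + k)%N), r, (2 * K / r ^+ N); split=> // x xr M.
  rewrite add0r /taylor_quot; have [->|x0] := eqVneq x 0.
    have F0 : 0 <= 2 * K / r ^+ N * (cmod (0 : C) / r) ^+ M.
      by rewrite !mulr_ge0// ?invr_ge0 ?exprn_ge0 ?cmod_divr_ge0// ltW.
    case: M F0 => [|M F0]; first rewrite big_ord0 subr0 !expr0 !mulr1 => _.
      rewrite ler_pdivlMr ?exprn_gt0//; exact: expansion_coef hc _.
    rewrite big_ord_recl/= addn0 expr0 mulr1 big1 ?addr0 ?subrr ?cmod0//.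
    by move=> i _; rewrite exprS mul0r mulr0.
  have xN0 : x ^+ N != 0 by rewrite expf_neq0.
  have := hc _ xr (N + M)%N; rewrite add0r.
  have -> : \sum_(k < N + M) c k * x ^+ k =
      \sum_(k < N) c k * x ^+ k + x ^+ N * \sum_(k < M) c (N + k)%N * x ^+ k.
    rewrite big_split_ord/=; congr (_ + _); rewrite mulr_sumr.
    by apply: eq_bigr => i _; rewrite exprD mulrCA.
  set S1 := \sum_(k < N) _; set S2 := \sum_(k < M) _ => hh.
  have -> : (h x - S1) / x ^+ N - S2 = (h x - (S1 + x ^+ N * S2)) / x ^+ N.
    by field.
  rewrite cmodM cmodV ler_pdivrMr ?cmod_gt0// (le_trans hh)// cmodX.
  rewrite exprD expr_div_n -!mulrA.
  have -> : 2 * (K * ((r ^+ N)^-1 * ((cmod x / r) ^+ M * cmod x ^+ N))) =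
            2 * (K * (cmod x ^+ N * ((r ^+ N)^-1 * (cmod x / r) ^+ M))) by ring.
  rewrite ler_peMl ?ler1n// !mulr_ge0 ?exprn_ge0 ?cmod_ge0 ?invr_ge0 ?exprn_ge0//.
  - exact: ltW.
  - by rewrite cmod_divr_ge0.
apply: (@analytic1_eq_near _ (fun x => (h x - \sum_(k < N) c k * x ^+ k) * x^-1 ^+ N)
   _ _ (cmod a / 2)).
- by rewrite divr_gt0// cmod_gt0.
- move=> x xa; rewrite /taylor_quot ifF ?exprVn//.
  apply/negbTE/negP => /eqP x0; move: xa; rewrite x0 add0r cmodN.
  have : 0 < cmod a by rewrite cmod_gt0.
  lra.
- apply: analytic1M; last by apply: analytic1X; exact: analytic1_inv.
  apply: analytic1B; first exact: ha.
  apply: analytic1_sum => i _; apply: analytic1Z; apply: analytic1X.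
  exact: analytic1_id.
Qed.

(** [X^N - 1] splits and is separable over C, and N distinct N-th roots of unity include a primitive
    one. *)
Lemma prim_root_exists N : (0 < N)%N -> exists w : C, N.-primitive_root w.
Proof.
pose p : {poly C} := 'X^N - 1; have [r Dp] := closed_field_poly_normal p.
move=> n_gt0; rewrite (monicP _) ?monicXnsubC // scale1r in Dp.
have rn1 : all N.-unity_root r by apply/allP=> z; rewrite -root_prod_XsubC -Dp.
have sz_r : (N < (size r).+1)%N.
  by rewrite -(size_prod_XsubC r id) -Dp size_XnsubC.
have [|z] := hasP (has_prim_root n_gt0 rn1 _ sz_r); last by exists z.
by rewrite -separable_prod_XsubC -Dp separable_Xn_sub_1 // pnatr_eq0 -lt0n.
Qed.

Lemma cmod_prim_root N (w : C) : N.-primitive_root w -> forall j, cmod (w ^+ j) = 1.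
Proof.
move=> wN j; rewrite cmodX; suff -> : cmod w = 1 by rewrite expr1n.
have N0 := prim_order_gt0 wN.
apply/eqP; rewrite -(@eqrXn2 _ N) ?cmod_ge0//.
by rewrite -cmodX (prim_expr_order wN) cmod1 expr1n.
Qed.

Lemma prim_root_orth N (w : C) : N.-primitive_root w -> forall m k, (m < N)%N -> (k < N)%N ->
  \sum_(j < N) (w ^+ j) ^- k * (w ^+ j) ^+ m = if m == k then N%:R else 0.
Proof.
move=> wN m k mN kN.
have w0 j : w ^+ j != 0 by rewrite -cmod_eq0 (cmod_prim_root wN) oner_eq0.
pose q := w ^+ m / w ^+ k.
have qE (j : nat) : (w ^+ j) ^- k * (w ^+ j) ^+ m = q ^+ j.
  by rewrite /q expr_div_n mulrC -!exprM mulnC [(j * k)%N]mulnC.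
under eq_bigr do rewrite qE.
have [mk|mk] := eqVneq m k.
  rewrite /q mk divff//; under eq_bigr do rewrite expr1n.
  by rewrite sumr_const card_ord.
have q1 : q - 1 != 0.
  rewrite subr_eq0; apply: contra mk => /eqP q1.
  have : w ^+ m = w ^+ k by rewrite -[LHS](divfK (w0 k)) -/q q1 mul1r.
  by move/eqP; rewrite (eq_prim_root_expr wN) !modn_small.
apply: (mulfI q1); rewrite mulr0 -subrX1.
by rewrite /q expr_div_n -!exprM ![(_ * N)%N]mulnC !exprM (prim_expr_order wN) !expr1n divr1 subrr.
Qed.

End disc.

(** * Taylor expansions *)

Section taylor.
Variables (R : realType) (h : R[i] -> R[i]) (rho r K : R).
Local Notation C := R[i].
Hypotheses (r_gt0 : 0 < r) (r_rho : r < rho).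
Hypothesis h_an : forall x, cmod x < rho -> analytic1 h x.
Hypothesis h_le : forall x, cmod x <= r -> cmod (h x) <= K.
Variables (c : nat -> C) (s L : R).
Hypotheses (s_gt0 : 0 < s) (h_exp : expansion h 0 c s L).

Let K_ge0 : 0 <= K.
Proof. by rewrite (le_trans (cmod_ge0 (h 0)))// h_le// cmod0 ltW. Qed.

(** A discrete Fourier filter: for [w] a primitive N-th root of unity it keeps the degrees congruent
    to [k] modulo N in the Taylor series of [h], and it inherits the bound on [h]. *)
Let avg N (w : C) k x : C := N%:R^-1 * \sum_(j < N) (w ^+ j) ^- k * h (w ^+ j * x).

Let avg_expansion N w k : N.-primitive_root w ->
  expansion (avg N w k) 0
    (fun m => N%:R^-1 * (\sum_(j < N) (w ^+ j) ^- k * (w ^+ j) ^+ m) * c m) s L.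
Proof.
move=> wN x xs M; have N0 := prim_order_gt0 wN.
have -> : avg N w k (0 + x) - \sum_(m < M)
    N%:R^-1 * (\sum_(j < N) (w ^+ j) ^- k * (w ^+ j) ^+ m) * c m * x ^+ m =
  N%:R^-1 * \sum_(j < N) (w ^+ j) ^- k *
    (h (0 + w ^+ j * x) - \sum_(m < M) c m * (w ^+ j * x) ^+ m).
  rewrite /avg !add0r; under [in RHS]eq_bigr do rewrite mulrBr add0r.
  rewrite sumrB mulrBr; congr (_ - _).
  under [in RHS]eq_bigr do rewrite mulr_sumr.
  rewrite exchange_big/= mulr_sumr; apply: eq_bigr => m _.
  rewrite -!mulrA; congr (_ * _); rewrite mulr_suml; apply: eq_bigr => j _.
  by rewrite exprMn; ring.
rewrite cmodM cmodV -[N%:R](rmorph_nat (real_complex R)) cmod_real ger0_norm//.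
rewrite mulrC ler_pdivrMr ?ltr0n//.
apply: (le_trans (cmod_sum _ _ _)).
rewrite mulr_natr -[N in _ *+ N]card_ord -sumr_const; apply: ler_sum => j _.
rewrite cmodM cmodV cmodX (cmod_prim_root wN) expr1n invr1 mul1r.
have wx : cmod (w ^+ j * x) = cmod x by rewrite cmodM (cmod_prim_root wN) mul1r.
by rewrite (le_trans (h_exp _ _))// wx.
Qed.

(** With [N = k + 1] the filter kills every degree below [k], so its quotient by [x^k] has no
    polynomial to subtract. The maximum principle on the circle of radius [r] then bounds the value
    at 0, which is [c k]. *)
Lemma cauchy_estimate k : cmod (c k) * r ^+ k <= K.
Proof.
have [w wN] := prim_root_exists R (ltn0Sn k).
set N := k.+1 in wN.
have He := avg_expansion k wN; set e := fun m => _ in He.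
have N0 : N%:R != 0 :> C by rewrite pnatr_eq0.
have ek : e k = c k by rewrite /e (prim_root_orth wN)// eqxx mulVf// mul1r.
have em m : (m < k)%N -> e m = 0.
  move=> mk; rewrite /e (prim_root_orth wN) ?ltnS// ?(ltnW mk)//.
  by rewrite (ltn_eqF mk) mulr0 mul0r.
have Han x : cmod x < rho -> analytic1 (avg N w k) x.
  move=> xr; apply: analytic1Z; apply: analytic1_sum => j _; apply: analytic1Z.
  have : analytic1 (fun x => h (0 + w ^+ j * x)) x.
    apply: analytic1_affine; rewrite add0r; apply: h_an.
    by rewrite cmodM (cmod_prim_root wN) mul1r.
  by apply: analytic1_ext => y; rewrite add0r.
rewrite -ler_pdivlMr ?exprn_gt0//.
have -> : cmod (c k) = cmod (taylor_quot (avg N w k) e k 0).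
  by rewrite /taylor_quot eqxx ek.
apply: (analytic1_max r_gt0 r_rho (analytic1_taylor_quot k s_gt0 He Han)); last first.
  by rewrite cmod0 ltW.
move=> x xr; have x0 : x != 0 by rewrite -cmod_eq0 xr gt_eqF.
rewrite /taylor_quot (negbTE x0) big1 ?subr0; last by move=> i _; rewrite em ?mul0r.
rewrite cmodM cmodV cmodX xr ler_wpM2r ?invr_ge0 ?exprn_ge0 ?(ltW r_gt0)//.
rewrite /avg cmodM cmodV -[N%:R](rmorph_nat (real_complex R)) cmod_real ger0_norm//.
rewrite mulrC ler_pdivrMr ?ltr0n//.
apply: (le_trans (cmod_sum _ _ _)).
rewrite mulr_natr -[N in _ *+ N]card_ord -sumr_const; apply: ler_sum => j _.
rewrite cmodM cmodV cmodX (cmod_prim_root wN) expr1n invr1 mul1r.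
by rewrite h_le// cmodM (cmod_prim_root wN) mul1r xr.
Qed.

(** The maximum principle for [taylor_quot] reduces the bound to the circle of radius [r], where [h]
    and, by [cauchy_estimate], each of the N subtracted terms are at most [K]; hence the factor
    [N + 1]. *)
Lemma taylor_remainder x N : cmod x <= r ->
  cmod (h x - \sum_(k < N) c k * x ^+ k) <= N.+1%:R * K * (cmod x / r) ^+ N.
Proof.
move=> xr; have [x0|x0] := eqVneq x 0.
  have B0 : 0 <= N.+1%:R * K * (cmod x / r) ^+ N.
    by rewrite !mulr_ge0// exprn_ge0// cmod_divr_ge0.
  case: N B0 => [_|N]; first by rewrite big_ord0 subr0 expr0 mulr1 mul1r h_le.
  set B := _ * (_ / r) ^+ _ => B0.
  rewrite x0 big_ord_recl/= expr0 mulr1 big1 ?addr0; last first.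
    by move=> i _; rewrite exprS mul0r mulr0.
  by rewrite (expansion0 s_gt0 h_exp) subrr cmod0.
have tq := analytic1_max r_gt0 r_rho (analytic1_taylor_quot N s_gt0 h_exp h_an).
have {tq} := tq (N.+1%:R * K / r ^+ N).
rewrite /taylor_quot => /(_ _ x xr); rewrite (negbTE x0) cmodM cmodV cmodX.
rewrite ler_pdivrMr ?exprn_gt0 ?cmod_gt0// expr_div_n => h1.
rewrite (le_trans (h1 _))// => [y yr|]; last by rewrite mulrAC mulrA.
have y0 : y != 0 by rewrite -cmod_eq0 yr gt_eqF.
rewrite (negbTE y0) cmodM cmodV cmodX yr ler_wpM2r ?invr_ge0 ?exprn_ge0 ?(ltW r_gt0)//.
rewrite (le_trans (cmodD _ _))// cmodN mulrSr mulrDl mul1r addrC lerD ?h_le ?yr//.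
apply: (le_trans (cmod_sum _ _ _)).
rewrite mulr_natl -[N in _ *+ N]card_ord -sumr_const; apply: ler_sum => j _.
by rewrite cmodM cmodX yr cauchy_estimate.
Qed.

(** The discrete Cauchy formula is exact on the Taylor polynomial of degree less than N, so the
    error is the average of the remainders on the unit circle. It tends to 0 geometrically, up to
    the factor [N + 1], when [r > 1]. *)
Lemma taylor_coef_avg N w k : N.-primitive_root w -> (k < N)%N -> 1 <= r ->
  cmod (N%:R^-1 * (\sum_(j < N) (w ^+ j) ^- k * h (w ^+ j)) - c k)
    <= N.+1%:R * K * r^-1 ^+ N.
Proof.
move=> wN kN r1; have N0 := prim_order_gt0 wN.
have N0' : N%:R != 0 :> C by rewrite pnatr_eq0 -lt0n.
have -> : c k = N%:R^-1 * (\sum_(j < N) (w ^+ j) ^- k * \sum_(m < N) c m * (w ^+ j) ^+ m).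
  under eq_bigr do rewrite mulr_sumr.
  rewrite exchange_big/= (bigD1 (Ordinal kN))//= [X in _ * (_ + X)]big1 ?addr0 => [|m mk].
    under eq_bigr do rewrite mulrCA.
    by rewrite -mulr_sumr (prim_root_orth wN)// eqxx mulrCA mulVf// mulr1.
  under eq_bigr do rewrite mulrCA.
  by rewrite -mulr_sumr (prim_root_orth wN)// -val_eqE/= in mk *; rewrite (negbTE mk) mulr0.
rewrite -mulrBr -sumrB cmodM cmodV -[N%:R](rmorph_nat (real_complex R)) cmod_real ger0_norm//.
rewrite mulrC ler_pdivrMr ?ltr0n//.
apply: (le_trans (cmod_sum _ _ _)).
rewrite [leRHS]mulr_natr -[N in _ *+ N]card_ord -sumr_const; apply: ler_sum => j _.
rewrite -mulrBr cmodM cmodV cmodX (cmod_prim_root wN) expr1n invr1 mul1r.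
rewrite (le_trans (taylor_remainder _ _))// ?(cmod_prim_root wN)//.
by rewrite div1r.
Qed.

Lemma parseval N w (a : nat -> C) : N.-primitive_root w ->
  N%:R^-1 * \sum_(j < N) cmod (\sum_(k < N) a k * (w ^+ j) ^+ k) ^+ 2 =
  \sum_(k < N) cmod (a k) ^+ 2.
Proof.
move=> wN; have N0 := prim_order_gt0 wN.
have N0' : N%:R != 0 :> R by rewrite pnatr_eq0 -lt0n.
apply: (mulfI N0'); rewrite mulrA mulfV// mul1r.
apply: complexI; rewrite rmorphM rmorph_nat !rmorph_sum/=.
have wJ j k : (((w ^+ j) ^+ k)^*)%C = (w ^+ j) ^- k.
  have w0 : (w ^+ j) ^+ k != 0.
    by rewrite -cmod_eq0 cmodX (cmod_prim_root wN) expr1n oner_eq0.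
  apply: (mulfI w0); rewrite mulfV// -sqr_cmodC cmodX (cmod_prim_root wN).
  by rewrite !expr1n.
under eq_bigr => j _.
  rewrite sqr_cmodC rmorph_sum/= big_distrlr/=.
  under eq_bigr => m _ do under eq_bigr => k _ do
    rewrite rmorphM/= wJ mulrACA [X in _ * X]mulrC.
  over.
rewrite exchange_big/= mulr_sumr; apply: eq_bigr => m _.
rewrite exchange_big/= (bigD1 m)//= [X in _ + X]big1 ?addr0 => [|k km].
  by rewrite -mulr_sumr (prim_root_orth wN)// eqxx sqr_cmodC mulrC.
rewrite -mulr_sumr (prim_root_orth wN)//.
by rewrite -val_eqE eq_sym/= in km; rewrite (negbTE km) mulr0.
Qed.

(** For Taylor polynomials [parseval] makes the discrete mean a sum of [|c k|^2 t^(2k)], visibly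
    nondecreasing in [t]. Passing between [h] and its polynomial costs [2 (K + d) d] at each of the
    two radii. *)
Lemma mean_sqr_le N w t u d : N.-primitive_root w -> 0 <= t -> t <= u -> u <= r ->
  N.+1%:R * K * (u / r) ^+ N <= d ->
  N%:R^-1 * \sum_(j < N) cmod (h (w ^+ j * t%:C%C)) ^+ 2 <=
  N%:R^-1 * \sum_(j < N) cmod (h (w ^+ j * u%:C%C)) ^+ 2 + 4 * (K + d) * d.
Proof.
move=> wN t0 tu ur hd; have N0 := prim_order_gt0 wN.
have d0 : 0 <= d.
  by rewrite (le_trans _ hd)// !mulr_ge0// exprn_ge0// divr_ge0 ?(le_trans t0 tu)// ltW.
pose T v j := \sum_(k < N) (c k * v%:C%C ^+ k) * (w ^+ j) ^+ k.
have nearT v j : 0 <= v -> v <= u ->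
    `|cmod (h (w ^+ j * v%:C%C)) ^+ 2 - cmod (T v j) ^+ 2| <= 2 * (K + d) * d.
  move=> v0 vu; have wv : cmod (w ^+ j * v%:C%C) = v.
    by rewrite cmodM (cmod_prim_root wN) mul1r cmod_real ger0_norm.
  have vr : v <= r by rewrite (le_trans vu).
  have e1 : cmod (h (w ^+ j * v%:C%C) - T v j) <= d.
    have := @taylor_remainder (w ^+ j * v%:C%C) N; rewrite wv => /(_ vr).
    have -> : \sum_(k < N) c k * (w ^+ j * v%:C%C) ^+ k = T v j.
      by apply: eq_bigr => k _; rewrite exprMn mulrCA mulrC.
    move=> /le_trans; apply; rewrite (le_trans _ hd)// ler_wpM2l ?mulr_ge0//.
    have r0' := ltW r_gt0.
    rewrite lerXn2r ?nnegrE ?divr_ge0// ?(le_trans v0)//.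
    by rewrite ler_pM2r ?invr_gt0.
  have e2 : cmod (h (w ^+ j * v%:C%C)) <= K by rewrite h_le// wv.
  rewrite (le_trans (cmod_sqr_dist (K := K + d) _ _))//.
  - by rewrite (le_trans e2)// lerDl.
  - by have := cmod_distB (T v j) (h (w ^+ j * v%:C%C)); rewrite cmodB; lra.
  - by rewrite ler_wpM2l// mulr_ge0// addr_ge0.
have avg_le (e : R) (F G : nat -> R) : (forall j, F j <= G j + e) ->
    N%:R^-1 * \sum_(j < N) F j <= N%:R^-1 * \sum_(j < N) G j + e.
  move=> FG; rewrite mulrC ler_pdivrMr ?ltr0n// mulrDl mulrAC mulVf ?mul1r; last first.
    by rewrite pnatr_eq0 -lt0n.
  rewrite mulr_natr -[N in _ *+ N]card_ord -sumr_const -big_split/=.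
  by apply: ler_sum => j _; exact: FG.
have absle (x y e : R) : `|x - y| <= e -> x <= y + e /\ y <= x + e.
  by rewrite ler_norml => /andP[]; lra.
have u0 := le_trans t0 tu.
have P v : N%:R^-1 * \sum_(j < N) cmod (T v j) ^+ 2 = \sum_(k < N) cmod (c k * v%:C%C ^+ k) ^+ 2.
  exact: (parseval (fun k => c k * v%:C%C ^+ k) wN).
clearbody T.
have h1 := avg_le (2 * (K + d) * d) (fun j => cmod (h (w ^+ j * t%:C%C)) ^+ 2)
  (fun j => cmod (T t j) ^+ 2).
apply: (le_trans (h1 _)) => [j|].
  exact: (absle _ _ _ (nearT t j t0 tu)).1.
have h2 := avg_le (2 * (K + d) * d) (fun j => cmod (T u j) ^+ 2)
  (fun j => cmod (h (w ^+ j * u%:C%C)) ^+ 2).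
have -> : 4 * (K + d) * d = 2 * (K + d) * d + 2 * (K + d) * d by ring.
rewrite addrA lerD2r; apply: le_trans (h2 _) => [|j]; last first.
  exact: (absle _ _ _ (nearT u j u0 (lexx _))).2.
rewrite (P t) (P u); apply: ler_sum => k _.
have tk : cmod (t%:C%C ^+ k) <= cmod (u%:C%C ^+ k).
  by rewrite !cmodX !cmod_real !ger0_norm// lerXn2r.
move: (c k) (t%:C%C ^+ k) (u%:C%C ^+ k) tk => x y y' yy.
by rewrite lerXn2r ?nnegrE ?cmod_ge0// !cmodM ler_wpM2l ?cmod_ge0.
Qed.

End taylor.

(** Write [q = p^2]: the product [(N + 1) p^N] stays below the geometric sum [1 / (1 - p)], and the
    remaining factor [p^N] tends to 0. *)
Lemma natmul_expr_small (R : realType) (q e : R) : 0 <= q -> q < 1 -> 0 < e ->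
  exists N0, forall N, (N0 <= N)%N -> N.+1%:R * q ^+ N < e.
Proof.
move=> q0 q1 e0; pose p := Num.sqrt q.
have p0 : 0 <= p by exact: sqrtr_ge0.
have p1 : p < 1 by rewrite -sqrtr1 ltr_sqrt.
have pq : q = p ^+ 2 by rewrite sqr_sqrtr.
have p1' : 0 < 1 - p by rewrite subr_gt0.
have bd N : N.+1%:R * p ^+ N <= (1 - p)^-1.
  rewrite -[leRHS]mul1r ler_pdivlMr//.
  apply: (@le_trans _ _ ((\sum_(i < N.+1) p ^+ i) * (1 - p))).
    rewrite ler_wpM2r ?(ltW p1')// mulr_natl -[X in _ *+ X]card_ord -sumr_const.
    apply: ler_sum => i _; rewrite ler_wiXn2l ?(ltW p1)//.
    by rewrite -ltnS.
  rewrite mulrC -opprB mulNr -subrX1 opprB gerBl exprn_ge0//.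
have : p ^+ N @[N --> \oo] --> (0 : R) by apply: cvg_expr; rewrite ger0_norm.
have e1 : 0 < e * (1 - p) by rewrite mulr_gt0.
move=> /cvgrPdist_lt/(_ _ e1)[N0 _ hN]; exists N0 => N /hN.
rewrite /= sub0r normrN ger0_norm ?exprn_ge0// => h.
rewrite pq -exprM mulnC muln2 -addnn exprD mulrA.
apply: (@le_lt_trans _ _ ((1 - p)^-1 * p ^+ N)).
  by rewrite ler_wpM2r// exprn_ge0.
by rewrite mulrC ltr_pdivrMr.
Qed.

(** * Power series in several variables *)

Section unconditional_sums.
Variables (R : realType) (I : choiceType).
Local Notation C := R[i].
Implicit Types (x y : I -> R[i]^o) (l : R[i]^o) (A B J : {fset I}).

Lemma partial_sum_cvgP x l :
  (summability.partial_sum x @ summability.totally --> l) <->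
  (forall e : R, 0 < e -> exists A, forall B, (A `<=` B)%fset ->
     cmod (l - \sum_(i <- B) x i) < e).
Proof.
have FF : ProperFilter (@summability.totally I) := summability.totally_filter.
split => [/cvgrPdist_lt h e e0|h].
  have [|A _ hA] := h (e%:C)%C; first by rewrite ltcR.
  exists A => B AB; rewrite -ltcR cmod_norm big_seq_fsetE; exact: (hA B).
apply/cvgrPdist_lt => -[a b]; rewrite ltcE/= => /andP[/eqP -> a0].
have [A hA] := h _ a0; exists A => // B /hA.
by rewrite -ltcR cmod_norm big_seq_fsetE.
Qed.

Let sum_split A B (V : nmodType) (F : I -> V) : (A `<=` B)%fset ->
  (\sum_(i <- B) F i = \sum_(i <- A) F i + \sum_(i <- B | i \notin A) F i)%R.
Proof.
move=> AB; rewrite (bigID (mem A))/=; congr (_ + _)%R.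
rewrite big_fset_condE; congr (bigop _ _ _); congr (enum_fset _).
by apply/fsetP => i; rewrite !inE/=; apply: andb_idl; exact/fsubsetP.
Qed.

(** The sums over [A] and over [A] enlarged by the selected indices are both within [e] of [l]; the
    sum in question is their difference. *)
Lemma unconditional_tail x l e A :
  (forall B, (A `<=` B)%fset -> cmod (l - \sum_(i <- B) x i) < e) ->
  forall B (P : pred I), cmod (\sum_(i <- B | P i && (i \notin A)) x i) <= e + e.
Proof.
move=> hA B P; pose J := [fset i in B | P i && (i \notin A)]%fset.
rewrite big_fset_condE -/J.
have hAJ := hA _ (fsubsetUl A J).
have := hA _ (fsubset_refl A).
have SE : (\sum_(i <- (A `|` J)%fset) x i = \sum_(i <- A) x i + \sum_(i <- J) x i)%R.
  rewrite (sum_split _ (fsubsetUl A J)); congr (_ + _)%R.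
  rewrite big_fset_condE; congr (bigop _ _ _); congr (enum_fset _).
  apply/fsetP => i; rewrite !inE/=; case: (i \in A) => //=; rewrite ?andbF//.
  by rewrite andbT.
rewrite SE in hAJ => hA0.
have -> : (\sum_(i <- J) x i = (l - \sum_(i <- A) x i) -
    (l - (\sum_(i <- A) x i + \sum_(i <- J) x i)))%R by ring.
by rewrite (le_trans (cmodD _ _))// cmodN; lra.
Qed.

(** Outside [A] the real and the imaginary parts are split by sign into four sums of constant sign.
    Each is at most 2 by [unconditional_tail], whence the 8. *)
Lemma unconditional_abs x l :
  summability.partial_sum x @ summability.totally --> l ->
  exists2 M : R, 0 <= M & forall B, \sum_(i <- B) cmod (x i) <= M.
Proof.
move=> /partial_sum_cvgP/(_ _ ltr01)[A hA].
exists (\sum_(i <- A) cmod (x i) + 8)%R.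
  by rewrite addr_ge0// sumr_ge0// => i _; exact: cmod_ge0.
move=> B; have tail := unconditional_tail hA B.
have part (f : C -> R) : (forall u, `|f u| <= cmod u) -> f 0 = 0 -> {morph f : u v / (u + v)%R} ->
    \sum_(i <- B | i \notin A) `|f (x i)| <= 4.
  move=> fle f0 fD; rewrite (bigID (fun i => 0 <= f (x i)))/=.
  have fS (P : pred I) : `|\sum_(i <- B | (i \notin A) && P i) f (x i)| <= 2.
    rewrite -(big_morph f fD f0) (le_trans (fle _))//.
    by under eq_bigl do rewrite andbC; exact: tail.
  have -> : \sum_(i <- B | (i \notin A) && (0 <= f (x i))) `|f (x i)| =
            \sum_(i <- B | (i \notin A) && (0 <= f (x i))) f (x i).
    by apply: eq_bigr => i /andP[_ fi]; rewrite ger0_norm.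
  have -> : \sum_(i <- B | (i \notin A) && ~~ (0 <= f (x i))) `|f (x i)| =
          (- \sum_(i <- B | (i \notin A) && ~~ (0 <= f (x i))) f (x i))%R.
    rewrite -sumrN; apply: eq_bigr => i /andP[_]; rewrite -ltNge => fi.
    by rewrite ltr0_norm.
  have := fS (fun i => 0 <= f (x i)); have := fS (fun i => ~~ (0 <= f (x i))).
  by rewrite !ler_norml; lra.
rewrite (bigID (mem A))/= lerD//.
  rewrite big_fset_condE.
  have sA : ([fset i in B | i \in A] `<=` A)%fset.
    by apply/fsubsetP => i; rewrite !inE/= => /andP[].
  by rewrite (sum_split _ sA) lerDl sumr_ge0// => i _; exact: cmod_ge0.
apply: (@le_trans _ _ (\sum_(i <- B | i \notin A)
   (`|complex.Re (x i)| + `|complex.Im (x i)|))).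
  by apply: ler_sum => i _; exact: cmod_le_ReIm.
rewrite big_split/= (_ : 8 = 4 + 4)%R; last by ring.
apply: lerD; apply: part => //; first exact: Re_le_cmod.
- by move=> [? ?] [? ?].
- exact: Im_le_cmod.
- by move=> [? ?] [? ?].
Qed.

End unconditional_sums.

Section power_series.
Variables (R : realType) (n : nat).
Local Notation C := R[i].
Local Notation midx := {ffun 'I_n -> nat}.
Implicit Types (c : midx -> R[i]^o) (f : fct R n) (z w a : Cn R n) (m : midx).

Definition mdegree m : nat := (\sum_i m i)%N.

Lemma finite_low_degree N :
  exists A : {fset midx}, forall m, (m \in A) = (mdegree m < N)%N.
Proof.
exists [fset m : midx in [seq ([ffun i => val (g i)] : midx) |
  g : {ffun 'I_n -> 'I_N} <- enum {: {ffun 'I_n -> 'I_N}}] | (mdegree m < N)%N]%fset.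
move=> m; rewrite !inE/= andb_idl// => mN; apply/mapP.
have mi i : (m i < N)%N.
  by rewrite (leq_ltn_trans _ mN)// /mdegree (bigD1 i)//= leq_addr.
by exists [ffun i => Ordinal (mi i)]; rewrite ?mem_enum//; apply/ffunP => i; rewrite !ffunE.
Qed.

Definition low_degree N := sval (cid (finite_low_degree N)).

Lemma in_low_degree N m : (m \in low_degree N) = (mdegree m < N)%N.
Proof. exact: (svalP (cid (finite_low_degree N))). Qed.

Definition homog_part c k w : C :=
  \sum_(m <- low_degree k.+1 | mdegree m == k) c m * \prod_i w ord0 i ^+ m i.

Lemma sum_homog_part c N w :
  \sum_(k < N) homog_part c k w =
  \sum_(m <- low_degree N) c m * \prod_i w ord0 i ^+ m i.
Proof.
elim: N => [|N ih].
  rewrite big_ord0 big_seq big1// => m; by rewrite in_low_degree.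
rewrite big_ord_recr/= ih [RHS](bigID (fun m => (mdegree m < N)%N))/=.
congr (_ + _).
  rewrite [RHS]big_fset_condE/=; congr (bigop _ _ _); congr (enum_fset _).
  apply/fsetP => m; rewrite !inE/= !in_low_degree.
  by apply/idP/andP => [mN|[]//]; split => //; rewrite ltnW.
rewrite /homog_part big_seq_cond [RHS]big_seq_cond; apply: eq_bigl => m.
rewrite in_low_degree; lia.
Qed.

Lemma homog_partZ c k (x : C) w : homog_part c k (x *: w) = x ^+ k * homog_part c k w.
Proof.
rewrite mulr_sumr; apply: eq_bigr => m /eqP mk; rewrite mulrCA; congr (_ * _).
rewrite -mk -prodrXr -big_split/=; apply: eq_bigr => i _.
by rewrite mxE exprMn.
Qed.

(* Absolute convergence at one point with nonzero coordinates gives a uniform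
   geometric control of the remainders. *)
Lemma analytic_at_homog f a : analytic_at f a ->
  exists c (t M : R), [/\ 0 < t, 0 <= M & forall w, cvnorm w <= t -> forall N,
    cmod (f (a + w) - \sum_(k < N) homog_part c k w) <= M * (cvnorm w / t) ^+ N].
Proof.
move=> [c [r [r0 hc]]].
have n1 : 0 < n%:R + 1 :> R by rewrite ltr_wpDl.
pose t := r / (n%:R + 1); have t0 : 0 < t by rewrite divr_gt0.
pose v : Cn R n := \row__ t%:C%C.
have vn : cvnorm v < r.
  rewrite (le_lt_trans (cvnorm_le_sum _))//.
  under eq_bigr do rewrite mxE cmod_real gtr0_norm//.
  rewrite sumr_const card_ord -mulr_natl /t mulrA ltr_pdivrMr// mulrC ltr_pM2l//.
  by rewrite ltrDl.
have := hc (a + v); rewrite addrAC subrr add0r => /(_ vn) /unconditional_abs[M M0 hM].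
have term m : cmod (c m * \prod_(i < n) ((a + v) ord0 i - a ord0 i) ^+ m i) =
    cmod (c m) * t ^+ mdegree m.
  rewrite cmodM cmod_prod -prodrXr; congr (_ * _); apply: eq_bigr => i _.
  by rewrite !mxE addrAC subrr add0r cmodX cmod_real gtr0_norm.
have tr : t <= r by rewrite /t ler_pdivrMr// ler_peMr ?(ltW r0)// lerDr.
(* [t <= r] is an equality for [n = 0]; halving makes the inequality strict. *)
pose t' := t / 2; have t'0 : 0 < t' by rewrite divr_gt0.
have t't : t' < t by rewrite /t'; lra.
exists c, t', M; split => // w wt N.
have wr : cvnorm ((a + w) - a) < r.
  by rewrite addrAC subrr add0r (le_lt_trans wt)// (lt_le_trans t't).
have /partial_sum_cvgP cw := hc _ wr.
set rho := cvnorm w / t; have rho0 : 0 <= rho by rewrite divr_ge0 ?cvnorm_ge0// ltW.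
have rho1 : rho <= 1.
  by rewrite ler_pdivrMr// mul1r (le_trans wt)// ltW.
have wE (m : midx) : \prod_(i < n) ((a + w) ord0 i - a ord0 i) ^+ m i = \prod_(i < n) w ord0 i ^+ m i.
  by apply: eq_bigr => i _; rewrite !mxE addrAC subrr add0r.
rewrite sum_homog_part.
have bound e : 0 < e ->
  cmod (f (a + w) - \sum_(m <- low_degree N) c m * \prod_i w ord0 i ^+ m i) <= e + M * rho ^+ N.
  move=> e0; have [A hA] := cw _ e0.
  have := hA _ (fsubsetUl A (low_degree N)).
  under eq_bigr do rewrite wE.
  set B := (A `|` _)%fset.
  rewrite (bigID (fun m => (mdegree m < N)%N))/= [X in _ - (X + _)]big_fset_condE/=.
  have -> : [fset i in B | (mdegree i < N)%N]%fset = low_degree N.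
    apply/fsetP => m; rewrite !inE/= !in_low_degree.
    by rewrite andb_idl// => ->; rewrite orbT.
  set S1 := \sum_(m <- low_degree N) _; set S2 := \sum_(_ <- _ | _) _ => h.
  have -> : f (a + w) - S1 = (f (a + w) - (S1 + S2)) + S2 by ring.
  rewrite (le_trans (cmodD _ _))// lerD ?(ltW h)//.
  apply: (le_trans (cmod_sum _ _ _)).
  apply: (@le_trans _ _ (\sum_(m <- B | ~~ (mdegree m < N)%N) cmod (c m) * t ^+ mdegree m * rho ^+ N)).
    apply: ler_sum => m; rewrite -leqNgt => Nm.
    rewrite cmodM cmod_prod -mulrA ler_wpM2l ?cmod_ge0//.
    apply: (@le_trans _ _ (cvnorm w ^+ mdegree m)).
      rewrite -prodrXr; apply: ler_prod => i _; rewrite cmod_ge0/= cmodX.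
      by rewrite lerXn2r ?nnegrE ?cmod_ge0 ?cvnorm_ge0// coord_le_cvnorm.
    have -> : cvnorm w = t * rho by rewrite mulrC divfK// gt_eqF.
    rewrite exprMn ler_wpM2l ?exprn_ge0 ?(ltW t0)//.
    by rewrite ler_wiXn2l.
  rewrite -mulr_suml ler_wpM2r ?exprn_ge0//.
  apply: le_trans (hM B); under [leRHS]eq_bigr do rewrite term.
  rewrite [leRHS](bigID (fun m => (mdegree m < N)%N))/= lerDr.
  by rewrite sumr_ge0// => m _; rewrite mulr_ge0 ?cmod_ge0// exprn_ge0// ltW.
apply: (@le_trans _ _ (M * rho ^+ N)).
  by apply/ler_addgt0Pl => e e0; exact: bound.
rewrite ler_wpM2l// lerXn2r ?nnegrE//.
  by apply: divr_ge0; [exact: cvnorm_ge0|exact: ltW].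
by rewrite ler_wpM2l ?cvnorm_ge0// lef_pV2// ltW.
Qed.

Lemma homog_expansion f a c (t M : R) b : 0 < t -> 0 <= M ->
  (forall w, cvnorm w <= t -> forall N,
    cmod (f (a + w) - \sum_(k < N) homog_part c k w) <= M * (cvnorm w / t) ^+ N) ->
  exists2 s, 0 < s & expansion (fun x : C => f (a + x *: b)) 0 (fun k => homog_part c k b) s M.
Proof.
move=> t0 M0 hc; have b1 : 0 < cvnorm b + 1 by rewrite ltr_wpDl// cvnorm_ge0.
exists (t / (cvnorm b + 1)) => [|x xt N]; first by rewrite divr_gt0.
rewrite add0r.
have xb : cvnorm (x *: b) <= cmod x * (cvnorm b + 1).
  by rewrite cvnormZ ler_wpM2l ?cmod_ge0// lerDl.
have xbt : cvnorm (x *: b) <= t by rewrite (le_trans xb)// -ler_pdivlMr.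
have := hc _ xbt N.
under eq_bigr do rewrite homog_partZ mulrC.
move=> /le_trans; apply; rewrite ler_wpM2l// lerXn2r ?nnegrE//.
- by rewrite divr_ge0 ?cvnorm_ge0// ltW.
- by rewrite cmod_divr_ge0// divr_gt0.
- by rewrite invf_div mulrA ler_pM2r ?invr_gt0.
Qed.

End power_series.

(** * Functions on the ball that are continuous and analytic along complex lines *)

Definition cont_at (R : realType) n (f : fct R n) (a : Cn R n) : Prop :=
  forall e, 0 < e -> exists2 d, 0 < d &
    forall w, cvnorm (w - a) < d -> cmod (f w - f a) < e.

(* Analyticity along complex lines is all that the proof uses of the analyticity
   on the ball, and it is stable under sums and products. *)
Definition ball_regular (R : realType) n (f : fct R n) : Prop :=
  (forall a, unit_ball a -> cont_at f a) /\
  (forall a b, unit_ball a -> analytic1 (fun x => f (a + x *: b)) 0).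

Definition ball_fun (R : realType) n (f : fct R n) : Prop :=
  ball_regular f /\ forall z, ~ unit_ball z -> f z = 0.

Definition ball_restr (R : realType) n (f : fct R n) : fct R n :=
  fun z => if cvnorm z < 1 then f z else 0.

Section regular.
Variables (R : realType) (n : nat).
Local Notation C := R[i].
Implicit Types (f g : fct R n) (a b z w : Cn R n).

Lemma cont_at_cst (c : R[i]^o) a : cont_at (fun=> c) a.
Proof. by move=> e e0; exists 1 => // w _; rewrite subrr cmod0. Qed.

Lemma cont_at_coord i a : cont_at (coordf i) a.
Proof.
move=> e e0; exists e => // w; apply: le_lt_trans.
by rewrite /coordf -[w ord0 i - _](_ : (w - a) ord0 i = _) ?coord_le_cvnorm// !mxE.
Qed.

Lemma cont_atD f g a : cont_at f a -> cont_at g a -> cont_at (f + g) a.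
Proof.
move=> fa ga e e0; have e2 : 0 < e / 2 by rewrite divr_gt0.
have [d d0 hd] := fa _ e2; have [d' d'0 hd'] := ga _ e2.
exists (Num.min d d'); first by rewrite lt_min d0.
move=> w; rewrite lt_min => /andP[wd wd'].
rewrite [X in cmod X](_ : _ = (f w - f a) + (g w - g a)); last by rewrite fctE; ring.
rewrite (le_lt_trans (cmodD _ _))//.
have := hd _ wd; have := hd' _ wd'; lra.
Qed.

Lemma cont_atM f g a : cont_at f a -> cont_at g a -> cont_at (fun z => f z * g z) a.
Proof.
move=> fa ga e e0.
set Kf := cmod (f a) + 1; set Kg := cmod (g a) + 1.
have Kf0 : 0 < Kf by rewrite ltr_wpDl// cmod_ge0.
have Kg0 : 0 < Kg by rewrite ltr_wpDl// cmod_ge0.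
have [d d0 hd] := fa _ (divr_gt0 e0 (mulr_gt0 (ltr0n R 2) Kg0)).
have [d' d'0 hd'] := ga _ (divr_gt0 e0 (mulr_gt0 (ltr0n R 2) Kf0)).
have [d1 d10 hd1] := ga _ ltr01.
exists (Num.min d (Num.min d' d1)); first by rewrite !lt_min d0 d'0.
move=> w; rewrite !lt_min => /and3P[wd wd' wd1].
rewrite [X in cmod X](_ : _ = (f w - f a) * g w + f a * (g w - g a)); last by ring.
rewrite (le_lt_trans (cmodD _ _))// !cmodM.
have gw : cmod (g w) <= Kg.
  have := cmod_distB (g w) (g a); have := hd1 _ wd1; rewrite /Kg; lra.
have fK : cmod (f a) <= Kf by rewrite lerDl.
have e1 : cmod (f w - f a) * cmod (g w) <= e / (2 * Kg) * Kg.
  by rewrite ler_pM ?cmod_ge0// ltW// hd.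
have e2 : cmod (f a) * cmod (g w - g a) < Kf * (e / (2 * Kf)).
  apply: (@le_lt_trans _ _ (Kf * cmod (g w - g a))).
    by rewrite ler_wpM2r ?cmod_ge0.
  by rewrite ltr_pM2l// hd'.
have h1 : e / (2 * Kg) * Kg = e / 2 by field; rewrite gt_eqF.
have h2 : Kf * (e / (2 * Kf)) = e / 2 by field; rewrite gt_eqF.
rewrite h1 in e1; rewrite h2 in e2; lra.
Qed.

Lemma cont_at_near f g a r : 0 < r -> (forall z, cvnorm (z - a) < r -> f z = g z) ->
  cont_at f a -> cont_at g a.
Proof.
move=> r0 fg fa e e0; have [d d0 hd] := fa _ e0.
exists (Num.min d r); first by rewrite lt_min d0.
move=> w; rewrite lt_min => /andP[wd wr].
by rewrite -!fg ?subrr ?cvnorm0//; exact: hd.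
Qed.

Lemma ball_nbhs a : unit_ball a -> exists2 r, 0 < r &
  forall z, cvnorm (z - a) < r -> unit_ball z.
Proof.
rewrite /unit_ball/= => a1; exists (1 - cvnorm a); first by rewrite subr_gt0.
move=> z za; have := cvnorm_distB z a; lra.
Qed.

Lemma line_near a b r : 0 < r -> exists2 d, 0 < d &
  forall x : C, cmod x <= d -> cvnorm (a + x *: b - a) < r.
Proof.
move=> r0; have b1 : 0 < cvnorm b + 1 by rewrite ltr_wpDl// cvnorm_ge0.
exists (r / (cvnorm b + 1)); first by rewrite divr_gt0.
move=> x xr; rewrite addrAC subrr add0r cvnormZ.
apply: (@le_lt_trans _ _ (r / (cvnorm b + 1) * cvnorm b)).
  by rewrite ler_wpM2r ?cvnorm_ge0.
by rewrite mulrAC ltr_pdivrMr// ltr_pM2l// ltrDl.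
Qed.

Lemma ball_regular_near f g : (forall z, unit_ball z -> f z = g z) ->
  ball_regular f -> ball_regular g.
Proof.
move=> fg [fc fa]; split=> [a a1|a b a1].
  have [r r0 hr] := ball_nbhs a1.
  by apply: cont_at_near r0 _ (fc _ a1) => z /hr; exact: fg.
have [r r0 hr] := ball_nbhs a1.
have [d d0 hd] := line_near a b r0.
apply: analytic1_eq_near d0 _ (fa a b a1) => x; rewrite subr0 => xd.
by rewrite fg//; apply: hr; exact: hd.
Qed.

Lemma ball_restrE f z : unit_ball z -> ball_restr f z = f z.
Proof. by rewrite /unit_ball/ball_restr/= => ->. Qed.

Lemma ball_restr_out f z : ~ unit_ball z -> ball_restr f z = 0.
Proof. by rewrite /unit_ball/ball_restr/= => /negP/negbTE ->. Qed.

Lemma ball_fun_restr f : ball_regular f -> ball_fun (ball_restr f).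
Proof.
move=> rf; split; last by move=> z; exact: ball_restr_out.
by apply: ball_regular_near rf => z z1; rewrite ball_restrE.
Qed.

Lemma ball_regularD f g : ball_regular f -> ball_regular g -> ball_regular (f + g).
Proof.
move=> [fc fa] [gc ga]; split=> [a a1|a b a1]; first exact: cont_atD (fc _ a1) (gc _ a1).
exact: analytic1D (fa a b a1) (ga a b a1).
Qed.

Lemma ball_regularM f g : ball_regular f -> ball_regular g ->
  ball_regular (fun z => f z * g z).
Proof.
move=> [fc fa] [gc ga]; split=> [a a1|a b a1]; first exact: cont_atM (fc _ a1) (gc _ a1).
exact: analytic1M (fa a b a1) (ga a b a1).
Qed.

Lemma ball_regular_cst (c : R[i]^o) : ball_regular (fun _ : Cn R n => c).
Proof.
by split=> [a _|a b _]; [exact: cont_at_cst|exact: analytic1_cst].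
Qed.

Lemma ball_regularZ (c : R[i]^o) f : ball_regular f -> ball_regular (c *: f).
Proof. by move=> rf; exact: ball_regularM (ball_regular_cst c) rf. Qed.

Lemma ball_regular_coord i : ball_regular (@coordf R n i).
Proof.
split=> [a _|a b _]; first exact: cont_at_coord.
rewrite /coordf.
have := analytic1D (analytic1_cst (a ord0 i) 0) (analytic1Z (b ord0 i) (analytic1_id 0)).
by apply: analytic1_ext => x; rewrite !mxE /= mulrC.
Qed.

Lemma ball_regular_sum I (r : seq I) (P : pred I) (F : I -> fct R n) :
  (forall i, P i -> ball_regular (F i)) -> ball_regular (\sum_(i <- r | P i) F i).
Proof.
move=> FP; elim/big_rec: _ => [|i f Pi rf]; first exact: ball_regular_cst.
exact: ball_regularD (FP i Pi) rf.
Qed.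

Lemma ball_regularX f k : ball_regular f -> ball_regular (fun z => f z ^+ k).
Proof.
move=> rf; elim: k => [|k ih]; first exact: ball_regular_cst.
by apply: ball_regular_near (ball_regularM rf ih) => z _; rewrite exprS.
Qed.

Lemma cip_sum w : (fun z => cip z w) = \sum_i ((w ord0 i)^*)%C *: @coordf R n i.
Proof.
by apply/funext => z; rewrite /cip fct_sumE; apply: eq_bigr => i _; rewrite mulrC.
Qed.

Lemma ball_regular_cip w : ball_regular (fun z => cip z w).
Proof.
rewrite cip_sum; apply: ball_regular_sum => i _.
by apply: ball_regularZ; exact: ball_regular_coord.
Qed.

Lemma ball_regular_line f a b (x : C) : ball_regular f -> unit_ball (a + x *: b) ->
  analytic1 (fun y => f (a + y *: b)) x.
Proof.
move=> [_ fa] /(fa _ b) h0.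
have : analytic1 (fun y => f (a + x *: b + (- x + 1 * y) *: b)) x.
  apply: (@analytic1_affine _ (fun t => f (a + x *: b + t *: b))).
  by rewrite mul1r addNr.
apply: analytic1_ext => y; congr (f _).
by rewrite mul1r scalerDl -addrA scaleNr addNKr.
Qed.

Lemma ball_funD f g : ball_fun f -> ball_fun g -> ball_fun (f + g).
Proof.
move=> [rf f0] [rg g0]; split; first exact: ball_regularD.
by move=> z z1; rewrite fctE f0// g0// addr0.
Qed.

Lemma ball_funZ (c : R[i]^o) f : ball_fun f -> ball_fun (c *: f).
Proof.
move=> [rf f0]; split; first exact: ball_regularZ.
by move=> z z1; rewrite fctE f0// scaler0.
Qed.

Lemma ball_fun_mulop g f : ball_regular g -> ball_fun f -> ball_fun (mulop g f).
Proof.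
move=> rg [rf f0]; split; first exact: ball_regularM.
by move=> z z1; rewrite /mulop f0// mulr0.
Qed.

Lemma analytic_at_regular f : (forall a, unit_ball a -> analytic_at f a) -> ball_regular f.
Proof.
move=> fa; have F0 c (w : Cn R n) : homog_part c 0 w = homog_part c 0 0.
  by have := homog_partZ c 0 0 w; rewrite scale0r expr0 mul1r.
split=> [a|a b] /fa/analytic_at_homog[c [t [M [t0 M0 hc]]]].
  have fE : f a = homog_part c 0 0.
    have := hc 0; rewrite cvnorm0 => /(_ (ltW t0) 1).
    rewrite addr0 big_ord1 mul0r expr1 mulr0 => h.
    by apply/eqP; rewrite -subr_eq0 -cmod_eq0 eq_le h cmod_ge0.
  move=> e e0; have M1 : 0 < M + 1 by rewrite ltr_wpDl.
  exists (Num.min t (e * t / (M + 1))); first by rewrite lt_min t0 divr_gt0// mulr_gt0.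
  move=> w; rewrite lt_min => /andP[wt we].
  have := hc _ (ltW wt) 1; rewrite subrKC big_ord1 F0 -fE expr1 => /le_lt_trans; apply.
  rewrite mulrA ltr_pdivrMr// (@le_lt_trans _ _ ((M + 1) * cvnorm (w - a)))//.
    by rewrite ler_wpM2r ?cvnorm_ge0// lerDl.
  by rewrite mulrC -ltr_pdivlMr.
have [s s0 hs] := homog_expansion b t0 M0 hc.
by exists (fun k => homog_part c k b), s, M.
Qed.

Lemma analytic_ball_fun f : analytic_ball f -> ball_fun f.
Proof. by move=> [fa f0]; split => //; exact: analytic_at_regular. Qed.

Lemma cont_at_sum I (r : seq I) (P : pred I) (F : I -> fct R n) a :
  (forall i, P i -> cont_at (F i) a) ->
  cont_at (fun z => \sum_(i <- r | P i) F i z) a.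
Proof.
move=> Fa; elim: r => [|i r ih].
  by apply: cont_at_near ltr01 _ (cont_at_cst 0 a) => z _; rewrite big_nil.
have [Pi|nPi] := boolP (P i).
  apply: cont_at_near ltr01 _ (cont_atD (Fa _ Pi) ih) => z _.
  by rewrite big_cons Pi.
by apply: cont_at_near ltr01 _ ih => z _; rewrite big_cons (negbTE nPi).
Qed.

Lemma cont_at_prod I (r : seq I) (F : I -> fct R n) a :
  (forall i, cont_at (F i) a) -> cont_at (fun z => \prod_(i <- r) F i z : R[i]^o) a.
Proof.
move=> Fa; elim: r => [|i r ih].
  by apply: cont_at_near ltr01 _ (cont_at_cst 1 a) => z _; rewrite big_nil.
by apply: cont_at_near ltr01 _ (cont_atM (Fa i) ih) => z _; rewrite big_cons.
Qed.

Lemma cont_atX f k a : cont_at f a -> cont_at (fun z => f z ^+ k : R[i]^o) a.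
Proof.
move=> fa; elim: k => [|k ih]; first exact: cont_at_cst.
by apply: cont_at_near ltr01 _ (cont_atM fa ih) => z _; rewrite exprS.
Qed.

Lemma cont_at_homog_part c k a : cont_at (homog_part c k : fct R n) a.
Proof.
apply: cont_at_sum => m _; apply: cont_atM; first exact: cont_at_cst.
by apply: cont_at_prod => i; apply: cont_atX; exact: cont_at_coord.
Qed.

End regular.

(** * Analyticity in several variables of powers of linear forms, which puts them in [H2] *)

Section analytic_at_closure.
Variables (R : realType) (n : nat).
Local Notation C := R[i].
Implicit Types (f g : fct R n) (a b z w : Cn R n).
Local Notation midx := {ffun 'I_n -> nat}.

Lemma analytic_at_near f g a r : 0 < r -> (forall z, cvnorm (z - a) < r -> f z = g z) ->
  analytic_at f a -> analytic_at g a.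
Proof.
move=> r0 fg [c [s [s0 hc]]]; exists c, (Num.min r s); split; first by rewrite lt_min r0.
by move=> z; rewrite lt_min => /andP[zr zs]; rewrite -fg//; exact: hc.
Qed.

Lemma analytic_at_cst (b : R[i]^o) a : analytic_at (fun _ : Cn R n => b) a.
Proof.
exists (fun m => if m == [ffun=> 0%N] then b else 0), 1; split; first exact: ltr01.
move=> z _.
apply/partial_sum_cvgP => e e0; exists [fset [ffun=> 0%N]]%fset => B.
rewrite fsub1set => B0; rewrite (big_fsetD1 _ B0) eqxx /= big1 ?mulr1; last first.
  by move=> i _; rewrite ffunE expr0.
rewrite opprD addrA subrr add0r big_seq big1 ?oppr0 ?cmod0// => m.
by rewrite !inE => /andP[/negbTE -> _]; rewrite mul0r.
Qed.

Lemma analytic_atD f g a : analytic_at f a -> analytic_at g a -> analytic_at (f + g) a.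
Proof.
move=> [c [r [r0 hc]]] [d [s [s0 hd]]].
exists (fun m => c m + d m), (Num.min r s); split; first by rewrite lt_min r0.
move=> z; rewrite lt_min => /andP[zr zs]; apply/partial_sum_cvgP => e e0.
have e2 : 0 < e / 2 by rewrite divr_gt0.
have /partial_sum_cvgP/(_ _ e2)[A hA] := hc _ zr.
have /partial_sum_cvgP/(_ _ e2)[A' hA'] := hd _ zs.
exists (A `|` A')%fset => B; rewrite fsubUset => /andP[/hA h1 /hA' h2].
under eq_bigr do rewrite mulrDl.
rewrite big_split/= fctE opprD addrACA (le_lt_trans (cmodD _ _))//; lra.
Qed.

Lemma analytic_atZ (b : R[i]^o) f a : analytic_at f a -> analytic_at (b *: f) a.
Proof.
move=> [c [r [r0 hc]]].
exists (fun m => b * c m), r; split; first exact: r0.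
move=> z zr; apply/partial_sum_cvgP => e e0.
have b1 : 0 < cmod b + 1 by rewrite ltr_wpDl// cmod_ge0.
have /partial_sum_cvgP/(_ _ (divr_gt0 e0 b1))[A hA] := hc _ zr.
exists A => B /hA; under [in X in _ -> X]eq_bigr do rewrite -mulrA.
rewrite -mulr_sumr ltr_pdivlMr// => h.
have -> : (b *: f) z = b * f z by [].
rewrite -mulrBr cmodM (le_lt_trans _ h)// mulrC.
by rewrite ler_wpM2l ?cmod_ge0// lerDl.
Qed.

Let shift (i : 'I_n) (m : midx) : midx := [ffun j => (m j + (j == i))%N].
Let unshift (i : 'I_n) (m : midx) : midx := [ffun j => (m j - (j == i))%N].

Let shiftK i : cancel (shift i) (unshift i).
Proof. by move=> m; apply/ffunP => j; rewrite !ffunE addnK. Qed.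

Let unshiftK i (m : midx) : (0 < m i)%N -> shift i (unshift i m) = m.
Proof.
by move=> mi; apply/ffunP => j; rewrite !ffunE subnK//; case: eqP => // ->.
Qed.

(** Multiplication by one centred coordinate shifts the multi-indices. Together with sums and
    scalings this gives the powers of a linear form by induction, without products of general power
    series. *)
Lemma analytic_at_coord_sub f i a : analytic_at f a ->
  analytic_at (fun z => (z ord0 i - a ord0 i) * f z : R[i]^o) a.
Proof.
move=> [c [r [r0 hc]]].
exists (fun m : midx => if (0 < m i)%N then c (unshift i m) else 0), r; split; first exact: r0.
move=> z zr.
apply/partial_sum_cvgP => e e0; set x := z ord0 i - a ord0 i.
have b1 : 0 < cmod x + 1 by rewrite ltr_wpDl// cmod_ge0.
have /partial_sum_cvgP/(_ _ (divr_gt0 e0 b1))[A hA] := hc _ zr.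
exists [fset shift i m | m in A]%fset => B AB.
(* Terms of [B] with [m i = 0] have coefficient 0; the others correspond to [B'] through [shift]. *)
pose B' := [fset unshift i m | m in [fset m : midx in B | (0 < m i)%N]]%fset.
have AB' : (A `<=` B')%fset.
  apply/fsubsetP => m mA; apply/imfsetP; exists (shift i m); rewrite ?shiftK//.
  rewrite !inE/= !ffunE eqxx addn1 andbT; apply: (fsubsetP AB).
  by apply/imfsetP; exists m.
have := hA _ AB'.
have -> : \sum_(m <- B) (if (0 < m i)%N then c (unshift i m) else 0) *
     \prod_(j < n) (z ord0 j - a ord0 j) ^+ m j =
   x * \sum_(m <- B') c m * \prod_(j < n) (z ord0 j - a ord0 j) ^+ m j.
  rewrite (bigID (fun m : midx => (0 < m i)%N))/= [X in _ + X]big1 ?addr0; last first.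
    by move=> m /negbTE ->; rewrite mul0r.
  rewrite big_imfset/=; last first.
    move=> m m'; rewrite !inE/= => /andP[_ m0] /andP[_ m'0] /(congr1 (shift i)).
    by rewrite !unshiftK.
  rewrite mulr_sumr [LHS]big_fset_condE/= !big_seq; apply: eq_bigr => m.
  rewrite !inE/= => /andP[_ mi]; rewrite mi mulrCA; congr (_ * _).
  rewrite (bigD1 i)//= [in RHS](bigD1 i)//= mulrA ffunE eqxx -/x -exprS.
  rewrite subn1 prednK//; congr (_ * _); apply: eq_bigr => j ji.
  by rewrite ffunE (negbTE ji) subn0.
rewrite ltr_pdivlMr// -mulrBr cmodM => h.
by rewrite (le_lt_trans _ h)// mulrC ler_wpM2l ?cmod_ge0// lerDl.
Qed.

Lemma analytic_at_coord f i a : analytic_at f a ->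
  analytic_at (fun z => z ord0 i * f z : R[i]^o) a.
Proof.
move=> fa; apply: analytic_at_near ltr01 _
  (analytic_atD (analytic_at_coord_sub i fa) (analytic_atZ (a ord0 i) fa)) => z _.
transitivity ((z ord0 i - a ord0 i) * f z + a ord0 i * f z); first by [].
by ring.
Qed.

Lemma analytic_at_sum I (r : seq I) (F : I -> fct R n) a :
  (forall i, analytic_at (F i) a) -> analytic_at (\sum_(i <- r) F i) a.
Proof.
move=> Fa; elim/big_rec: _ => [|i f _ fa]; first exact: analytic_at_cst.
exact: analytic_atD (Fa i) fa.
Qed.

Lemma analytic_at_cipX w k a : analytic_at (fun z => cip z w ^+ k : R[i]^o) a.
Proof.
elim: k => [|k ih]; first exact: analytic_at_cst.
apply: analytic_at_near ltr01 _ (analytic_at_sum (index_enum 'I_n)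
  (fun i => analytic_atZ ((w ord0 i)^*)%C (analytic_at_coord i ih))) => z _.
rewrite fct_sumE exprS {2}/cip mulr_suml; apply: eq_bigr => i _.
by rewrite [LHS]mulrA [X in X * _]mulrC.
Qed.

Lemma analytic_ball_cipX w k : analytic_ball (ball_restr (fun z => cip z w ^+ k : R[i]^o)).
Proof.
split=> [a a1|z z1]; last exact: ball_restr_out.
have [r r0 hr] := ball_nbhs a1.
by apply: analytic_at_near r0 _ (analytic_at_cipX w k a) => z /hr zb; rewrite ball_restrE.
Qed.

End analytic_at_closure.

(** * Invariance of Lebesgue measure and of the sphere measure *)

Definition preserves d (T : measurableType d) (R : realType)
    (mu : {measure set T -> \bar R}) (phi : T -> T) : Prop :=
  measurable_fun setT phi /\ forall A, measurable A -> mu (phi @^-1` A) = mu A.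

Section preserves.
Context d1 d2 (T1 : measurableType d1) (T2 : measurableType d2) (R : realType).

Lemma measurable_preimage (phi : T1 -> T2) A : measurable_fun setT phi ->
  measurable A -> measurable (phi @^-1` A).
Proof. by move=> mphi mA; rewrite -[X in measurable X]setTI; exact: mphi. Qed.

Lemma preserves_ge0_integral (mu : {measure set T1 -> \bar R}) (phi : T1 -> T1)
    (f : T1 -> \bar R) : preserves mu phi -> measurable_fun setT f ->
  (forall x, 0 <= f x)%E -> (\int[mu]_x f (phi x) = \int[mu]_x f x)%E.
Proof.
move=> [mphi muphi] mf f0.
transitivity (\int[mu]_(x in phi @^-1` setT) (f \o phi) x)%E; first by rewrite preimage_setT.
rewrite -(ge0_integral_pushforward mphi)//.
by apply: eq_measure_integral => A mA _; exact: muphi.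
Qed.

Lemma product_measure_eq_xsection (m1 : {measure set T1 -> \bar R})
    (m2 : {sigma_finite_measure set T2 -> \bar R}) A B :
  (forall x, m2 (xsection A x) = m2 (xsection B x)) -> (m1 \x m2)%E A = (m1 \x m2)%E B.
Proof. by move=> AB; apply: eq_integral => x _ /=; rewrite AB. Qed.

(** [\x] integrates the measures of the x-sections; uniqueness of the product measure identifies it
    with the integral in the other order. *)
Lemma product_measure_eq_ysection (m1 : {sigma_finite_measure set T1 -> \bar R})
    (m2 : {sigma_finite_measure set T2 -> \bar R}) A B :
  measurable A -> measurable B ->
  (forall y, m1 (ysection A y) = m1 (ysection B y)) -> (m1 \x m2)%E A = (m1 \x m2)%E B.
Proof.
move=> mA mB AB.
have E X : measurable X -> (m1 \x m2)%E X = (m1 \x^ m2)%E X.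
  by move=> mX; apply: product_measure_unique => //= *; rewrite product_measure2E.
by rewrite !E//; apply: eq_integral => y _ /=; rewrite AB.
Qed.

Lemma preserves_product (m1 : {measure set T1 -> \bar R})
    (m2 : {sigma_finite_measure set T2 -> \bar R}) f1 f2 :
  preserves m1 f1 -> preserves m2 f2 ->
  forall A, measurable A -> (m1 \x m2)%E ((fun p => (f1 p.1, f2 p.2)) @^-1` A) = (m1 \x m2)%E A.
Proof.
move=> p1 [mf2 p2] A mA; rewrite /product_measure1/=.
rewrite -(preserves_ge0_integral (f := m2 \o xsection A) p1)//.
- apply: eq_integral => x _ /=; rewrite -[RHS]p2; last exact: measurable_xsection.
  by congr (m2 _); apply/seteqP; split=> y; rewrite /xsection/= !inE.
- exact: measurable_fun_xsection.
Qed.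

End preserves.

Section lebesgue_Cn.
Variable R : realType.
Local Notation C := R[i].
Local Notation T := (measurableTypeR R * measurableTypeR R)%type.
Local Notation mu := (@lebesgue_measure R).

Lemma preserves_translation (a : R) : preserves mu (fun x : measurableTypeR R => x + a).
Proof.
have mf : measurable_fun setT (fun x : measurableTypeR R => x + a : measurableTypeR R).
  by apply: measurable_funD; [exact: measurable_id|exact: measurable_cst].
split=> // A mA.
pose phi (x : measurableTypeR R) : measurableTypeR R := x + a.
pose nu : {measure set (measurableTypeR R) -> \bar R} := pushforward mu phi.
apply/esym; apply: (@lebesgue_measure_unique R (nu mf)) mA => _ [[x y] _ <-].
rewrite /nu /= /pushforward.
have -> : phi @^-1` `]x, y]%classic = `]x - a, y - a]%classic.
  by apply/seteqP; split => z /=; rewrite !in_itv/= ltrBlDr lerBrDr.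
rewrite !lebesgue_measure_itv/= !lte_fin ltrD2r; case: ifPn => // _.
by rewrite -!EFinD; congr EFin; ring.
Qed.

Definition tuple_add n (s t : n.-tuple T) : n.-tuple T :=
  [tuple ((tnth t i).1 + (tnth s i).1, (tnth t i).2 + (tnth s i).2) | i < n].

Lemma measurable_tuple_add n (s : n.-tuple T) : measurable_fun setT (tuple_add s).
Proof.
apply/measurable_fun_tnthP => i; apply/measurable_fun_pairP; split.
- rewrite [X in measurable_fun _ X](_ : _ = fun t : n.-tuple T => (tnth t i).1 + (tnth s i).1); last first.
    by apply/funext => t /=; rewrite tnth_mktuple.
  apply: measurable_funD; last exact: measurable_cst.
  by apply: measurableT_comp; [exact: measurable_fst|exact: measurable_tnth].
- rewrite [X in measurable_fun _ X](_ : _ = fun t : n.-tuple T => (tnth t i).2 + (tnth s i).2); last first.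
    by apply/funext => t /=; rewrite tnth_mktuple.
  apply: measurable_funD; last exact: measurable_cst.
  by apply: measurableT_comp; [exact: measurable_snd|exact: measurable_tnth].
Qed.

Lemma preserves_tuple_add n (s : n.-tuple T) : preserves (@lebesgue_Cn R n) (tuple_add s).
Proof.
split; first exact: measurable_tuple_add.
elim: n s => [|n ih] s A mA.
  rewrite (_ : tuple_add s @^-1` A = A)//; apply/seteqP.
  suff E t : tuple_add s t = t by split=> t /=; rewrite E.
  exact: etrans (tuple0 _) (esym (tuple0 _)).
rewrite /= /lebesgue_cons /pushforward.
pose a := thead s; pose s' := [tuple of behead s].
pose f1 (p : T) : T := (p.1 + a.1, p.2 + a.2).
have p1 : preserves (mu \x mu)%E f1.
  split; last first.
    exact: (preserves_product (preserves_translation a.1) (preserves_translation a.2)).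
  apply/measurable_fun_pairP; split=> /=.
    by apply: measurable_funD; [exact: measurable_fst|exact: measurable_cst].
  by apply: measurable_funD; [exact: measurable_snd|exact: measurable_cst].
have mA' : measurable (@tcons R n @^-1` A).
  exact: measurable_preimage (@measurable_tcons R n) mA.
rewrite -(preserves_product p1 (conj (measurable_tuple_add s') (ih s')) mA').
congr (product_measure1 _ _ _); apply/seteqP.
suff E p : tuple_add s (tcons p) = tcons (f1 p.1, tuple_add s' p.2).
  by split=> p /=; rewrite E.
apply: eq_from_tnth => i; rewrite tnth_mktuple.
case: (unliftP ord0 i) => [j ->|->]; last by rewrite !tnth0/= /f1 /a /thead.
rewrite !tnthS tnth_mktuple /= /s'.
by rewrite !(tnth_nth (0, 0)) /= nth_behead.
Qed.

End lebesgue_Cn.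

(** * Borel sets of C^n in the product sigma-algebra of real coordinates *)

Section tuple_topology.
Variables (R : realType) (n : nat).
Local Notation C := R[i].
Local Notation T := (measurableTypeR R * measurableTypeR R)%type.
Implicit Types (t s : n.-tuple T) (z w : Cn R n) (O D : set (Cn R n)).

Definition of_Cn z : n.-tuple T :=
  [tuple (complex.Re (z ord0 i), complex.Im (z ord0 i)) | i < n].

Lemma of_CnK z : to_Cn (of_Cn z) = z.
Proof. by apply/rowP => i; rewrite !mxE tnth_mktuple /=; case: (z _ _). Qed.

Lemma to_CnK t : of_Cn (to_Cn t) = t.
Proof.
by apply: eq_from_tnth => i; rewrite tnth_mktuple !mxE /=; case: (tnth t i).
Qed.

Lemma to_Cn_add s t : to_Cn (tuple_add s t) = to_Cn t + to_Cn s.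
Proof. by apply/rowP => i; rewrite !mxE tnth_mktuple. Qed.

Lemma tuple_addE s t : tuple_add s t = of_Cn (to_Cn t + to_Cn s).
Proof. by rewrite -to_Cn_add to_CnK. Qed.

Definition cn_open O := forall z, O z -> exists2 d : R, 0 < d &
  forall w, cvnorm (w - z) < d -> O w.

Lemma rational_dense z (e : R) : 0 < e ->
  exists q : n.-tuple (rat * rat),
    cvnorm (z - \row_i (ratr (tnth q i).1 +i* ratr (tnth q i).2)%C) < e.
Proof.
move=> e0; have n1 : 0 < n%:R * 2 + 1 :> R by rewrite ltr_wpDl// mulr_ge0.
pose d := e / (n%:R * 2 + 1); have d0 : 0 < d by rewrite divr_gt0.
have ex (x : R) : exists q : rat, `|x - ratr q| <= d.
  have [q] : exists q, ratr q \in `](x - d), (x + d)[.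
    by apply: rat_in_itvoo; lra.
  by rewrite in_itv/= => /andP[xq qx]; exists q; rewrite ler_norml; lra.
have [q1 hq1] := choice (fun i => ex (complex.Re (z ord0 i))).
have [q2 hq2] := choice (fun i => ex (complex.Im (z ord0 i))).
exists [tuple (q1 i, q2 i) | i < n].
apply: (le_lt_trans (cvnorm_le_sum _)).
apply: (@le_lt_trans _ _ (\sum_(i < n) (d + d))).
  apply: ler_sum => i _; rewrite !mxE tnth_mktuple/=.
  apply: (le_trans (cmod_le_ReIm _)).
  have := hq1 i; have := hq2 i.
  by case: (z _ _) => a b /= hb ha; rewrite lerD.
rewrite sumr_const card_ord -[_ *+ n]mulr_natl.
have -> : n%:R * (d + d) = n%:R * 2 * d by ring.
by rewrite /d mulrA ltr_pdivrMr// mulrC ltr_pM2l// ltrDl.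
Qed.

(** An open set is the union of the countably many balls of rational centre and radius [1 / (k + 1)]
    that it contains, and each ball is measurable because the norm is. *)
Lemma measurable_cn_open O : cn_open O -> measurable (@to_Cn R n @^-1` O).
Proof.
move=> oO.
pose c (q : n.-tuple (rat * rat)) : n.-tuple T :=
  [tuple (- ratr (tnth q i).1, - ratr (tnth q i).2) | i < n].
pose B (p : n.-tuple (rat * rat) * nat) : set (n.-tuple T) :=
  [set t | cvnorm (to_Cn (tuple_add (c p.1) t)) < p.2.+1%:R^-1].
have mB p : measurable (B p).
  pose g t := cvnorm (to_Cn (tuple_add (c p.1) t)) : measurableTypeR R.
  rewrite (_ : B p = g @^-1` `]-oo, p.2.+1%:R^-1[); last first.
    by apply/seteqP; split => t; rewrite /B/= in_itv.
  apply: measurable_preimage; last exact: measurable_itv.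
  apply: (measurableT_comp (@measurable_cvnorm R n)).
  exact: measurable_tuple_add.
pose F p := if `[< B p `<=` @to_Cn R n @^-1` O >] then B p else set0.
rewrite (_ : _ @^-1` _ = \bigcup_p F p).
  apply: countable_bigcupT_measurable; first exact: countableP.
  by move=> p; rewrite /F; case: ifP.
apply/seteqP; split=> [t Ot|t [p _]]; last first.
  by rewrite /F; case: asboolP => // + Bt; apply.
have [d d0 hd] := oO _ Ot.
(* Two radii must fit in [d]: the ball contains the given point but is not centred there. *)
pose k := Num.truncn (2 / d); have kd : k.+1%:R^-1 + k.+1%:R^-1 < d.
  have : 2 / d < k.+1%:R by exact: truncnS_gt.
  rewrite ltr_pdivrMr// => h.
  by rewrite -[X in X + X]mul1r -mulrDl ltr_pdivrMr ?ltr0n// mulrC.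
have k0 : 0 < k.+1%:R^-1 :> R by rewrite invr_gt0.
have [q hq] := rational_dense (to_Cn t) k0.
have cq : to_Cn (c q) = - \row_i (ratr (tnth q i).1 +i* ratr (tnth q i).2)%C.
  by apply/rowP => i; rewrite !mxE tnth_mktuple.
exists (q, k) => //; rewrite /F.
have Bt : B (q, k) t by rewrite /B/= to_Cn_add cq.
case: asboolP => // BO; exfalso; apply: BO => s; rewrite /B/= to_Cn_add cq => hs.
apply: hd; set Q : Cn R n := \row__ _ in hs hq.
have -> : to_Cn s - to_Cn t = (to_Cn s - Q) - (to_Cn t - Q).
  by rewrite opprB addrA subrK.
apply: le_lt_trans (cvnormD _ _) _; rewrite cvnormN.
by apply: lt_trans kd; exact: ltrD.
Qed.

(** Shaped for functions extended by 0: the dilation of a function on the ball is continuous on an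
    open set and 0 off it, possibly with a jump in between. *)
Lemma measurable_cont D (u : Cn R n -> R) : cn_open D ->
  (forall z, D z -> forall e, 0 < e -> exists2 d, 0 < d &
     forall w, cvnorm (w - z) < d -> `|u w - u z| < e) ->
  (forall z, ~ D z -> u z = 0) ->
  measurable_fun setT (fun t : n.-tuple T => u (to_Cn t) : measurableTypeR R).
Proof.
move=> oD cu u0; have mD := measurable_cn_open oD.
have -> : [set: n.-tuple T] = (@to_Cn R n @^-1` D) `|` ~` (@to_Cn R n @^-1` D).
  by rewrite setUv.
apply/measurable_funU => //; first exact: measurableC.
split.
  move=> _; apply: (measurability _ (RGenOInfty.measurableE R)) => //.
  move=> _ [_ [a ->] <-].
  rewrite [X in measurable X](_ : _ =
      @to_Cn R n @^-1` [set z | D z /\ a < u z]); last first.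
    by apply/seteqP; split=> t /=; rewrite in_itv/= andbT.
  apply: measurable_cn_open => z [Dz az].
  have az' : 0 < u z - a by rewrite subr_gt0.
  have [d d0 hd] := cu _ Dz _ az'; have [d' d'0 hd'] := oD _ Dz.
  exists (Num.min d d'); first by rewrite lt_min d0.
  move=> w; rewrite lt_min => /andP[/hd wd /hd' Dw]; split=> //.
  by move: wd; rewrite ltr_norml; lra.
have h : {in ~` (@to_Cn R n @^-1` D), (fun=> 0 : measurableTypeR R) =1
    (fun t : n.-tuple T => u (to_Cn t) : measurableTypeR R)}.
  by move=> t; rewrite inE /= => /u0 ->.
apply: (eq_measurable_fun _ h); exact: measurable_cst.
Qed.

End tuple_topology.

Section unitary_invariance.
Variables (R : realType) (n : nat).
Local Notation C := R[i].
Local Notation T := (measurableTypeR R * measurableTypeR R)%type.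
Local Notation nu := (@lebesgue_Cn R n).
Implicit Types (t s : n.-tuple T) (z w : Cn R n) (U V : Cn R n -> Cn R n).

Definition tuple_map U t : n.-tuple T := of_Cn (U (to_Cn t)).

Lemma measurable_tuple_map U : (forall z w, cvnorm (U z - U w) = cvnorm (z - w)) ->
  measurable_fun setT (tuple_map U).
Proof.
move=> Un; apply/measurable_fun_tnthP => i; apply/measurable_fun_pairP; split.
- rewrite [X in measurable_fun _ X](_ : _ =
     fun t => complex.Re (U (to_Cn t) ord0 i) : measurableTypeR R); last first.
    by apply/funext => t /=; rewrite tnth_mktuple.
  apply: (@measurable_cont _ _ setT (fun z => complex.Re (U z ord0 i))).
  + by move=> z _; exists 1.
  + move=> z _ e e0; exists e => // w; apply: le_lt_trans.
    rewrite -Un (le_trans _ (coord_le_cvnorm _ i))// !mxE.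
    rewrite (le_trans _ (Re_le_cmod _))//.
    by case: (U w _ _) => a b; case: (U z _ _).
  + by move=> z /(_ I).
- rewrite [X in measurable_fun _ X](_ : _ =
     fun t => complex.Im (U (to_Cn t) ord0 i) : measurableTypeR R); last first.
    by apply/funext => t /=; rewrite tnth_mktuple.
  apply: (@measurable_cont _ _ setT (fun z => complex.Im (U z ord0 i))).
  + by move=> z _; exists 1.
  + move=> z _ e e0; exists e => // w; apply: le_lt_trans.
    rewrite -Un (le_trans _ (coord_le_cvnorm _ i))// !mxE.
    rewrite (le_trans _ (Im_le_cmod _))//.
    by case: (U w _ _) => a b; case: (U z _ _).
  + by move=> z /(_ I).
Qed.

Lemma measurable_tuple_add2 d (X : measurableType d) (f g : X -> n.-tuple T) :
  measurable_fun setT f -> measurable_fun setT g ->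
  measurable_fun setT (fun x => tuple_add (f x) (g x)).
Proof.
move=> mf mg; apply/measurable_fun_tnthP => i.
have mt (h : X -> n.-tuple T) : measurable_fun setT h ->
    measurable_fun setT (fun x => tnth (h x) i).
  by move=> mh; exact: measurableT_comp (measurable_tnth i) mh.
apply/measurable_fun_pairP; split.
- rewrite [X in measurable_fun _ X](_ : _ =
     fun x => (tnth (g x) i).1 + (tnth (f x) i).1); last first.
    by apply/funext => t /=; rewrite tnth_mktuple.
  apply: measurable_funD; [exact: measurableT_comp measurable_fst (mt _ mg)|
    exact: measurableT_comp measurable_fst (mt _ mf)].
- rewrite [X in measurable_fun _ X](_ : _ =
     fun x => (tnth (g x) i).2 + (tnth (f x) i).2); last first.
    by apply/funext => t /=; rewrite tnth_mktuple.
  apply: measurable_funD; [exact: measurableT_comp measurable_snd (mt _ mg)|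
    exact: measurableT_comp measurable_snd (mt _ mf)].
Qed.

Definition tuple_ball (r : R) : set (n.-tuple T) := [set t | cvnorm (to_Cn t) < r].

Lemma measurable_norm_ball z (r : R) :
  measurable [set t : n.-tuple T | cvnorm (to_Cn t - z) < r].
Proof.
apply: (@measurable_cn_open _ _ [set w | cvnorm (w - z) < r]) => w /= wr.
exists (r - cvnorm (w - z)) => [|v vw]; first by rewrite subr_gt0.
have -> : v - z = (v - w) + (w - z) by rewrite addrA subrK.
by rewrite (le_lt_trans (cvnormD _ _))// -ltrBrDr.
Qed.

Lemma measurable_tuple_ball r : measurable (tuple_ball r).
Proof.
rewrite (_ : tuple_ball r = [set t | cvnorm (to_Cn t - 0) < r]).
  exact: measurable_norm_ball.
by apply/seteqP; split=> t; rewrite /tuple_ball/= subr0.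
Qed.

(* The translation invariance of [nu] gives [nu (U^-1 A) nu(B) = nu(B) nu(-A)]
   by Fubini's theorem and the substitutions [y := y + U x], [x := x - V y],
   [y := y + U x]; for [U = id] this reads [nu(A) nu(B) = nu(B) nu(-A)]. *)
Lemma lebesgue_Cn_unitary_neg U V A : {morph U : z w / z + w} ->
  (forall z, cvnorm (U z) = cvnorm z) -> cancel V U -> measurable A ->
  let B := tuple_ball 1 in
  (nu (tuple_map U @^-1` A) * nu B = nu B * nu (tuple_map -%R @^-1` A))%E.
Proof.
move=> UD Un VU mA B; have mB : measurable B := measurable_tuple_ball 1.
have UB z w : U (z - w) = U z - U w.
  have U0 : U 0 = 0 by apply: (addrI (U 0)); rewrite -UD !addr0.
  have UN : U (- w) = - U w by apply: (addrI (U w)); rewrite -UD !subrr U0.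
  by rewrite UD UN.
have mU : measurable_fun setT (tuple_map U).
  by apply: measurable_tuple_map => z w; rewrite -UB Un.
have mN : measurable_fun setT (tuple_map -%R).
  by apply: measurable_tuple_map => z w; rewrite -opprD cvnormN.
have mU1 : measurable_fun setT (fun p : n.-tuple T * n.-tuple T => tuple_map U p.1).
  exact: measurableT_comp mU measurable_fst.
have mN2 : measurable_fun setT (fun p : n.-tuple T * n.-tuple T => tuple_map -%R p.2).
  exact: measurableT_comp mN measurable_snd.
pose S1 := (tuple_map U @^-1` A) `*` B.
pose S2 := (fun p : n.-tuple T * n.-tuple T => tuple_map U p.1) @^-1` A `&`
  (fun p => tuple_add (tuple_map U p.1) p.2) @^-1` B.
pose S3 := (fun p => tuple_add (tuple_map -%R p.2) (tuple_map U p.1)) @^-1` A `&`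
  (fun p : n.-tuple T * n.-tuple T => tuple_map U p.1) @^-1` B.
pose S4 := (tuple_map U @^-1` B) `*` (tuple_map -%R @^-1` A).
have mUA : measurable (tuple_map U @^-1` A) by exact: measurable_preimage.
have mUB : measurable (tuple_map U @^-1` B) by exact: measurable_preimage.
have mNA : measurable (tuple_map -%R @^-1` A) by exact: measurable_preimage.
have mS1 : measurable S1 by exact: measurableX.
have mS2 : measurable S2.
  apply: measurableI; first exact: measurable_preimage mU1 mA.
  exact: measurable_preimage (measurable_tuple_add2 mU1 measurable_snd) mB.
have mS3 : measurable S3.
  apply: measurableI; last exact: measurable_preimage mU1 mB.
  exact: measurable_preimage (measurable_tuple_add2 mN2 mU1) mA.
have UBB : tuple_map U @^-1` B = B.
  by apply/seteqP; split=> t; rewrite /B/tuple_ball/= /tuple_map of_CnK Un.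
have -> : (nu (tuple_map U @^-1` A) * nu B = (nu \x nu) S1)%E.
  by rewrite product_measure1E.
have -> : (nu B * nu (tuple_map -%R @^-1` A) = (nu \x nu) S4)%E.
  by rewrite product_measure1E// UBB.
transitivity ((nu \x nu)%E S2).
  apply: product_measure_eq_xsection => x.
  rewrite -(preserves_tuple_add (tuple_map U x)).2; last exact: measurable_xsection.
  by congr (nu _); apply/seteqP; split=> y; rewrite /xsection/= !inE.
transitivity ((nu \x nu)%E S3).
  apply: product_measure_eq_ysection => // y.
  rewrite -[RHS](preserves_tuple_add (tuple_map V y)).2; last exact: measurable_ysection.
  congr (nu _); apply/seteqP; split=> x; rewrite /ysection/= !inE /S2 /S3/=;
    rewrite !tuple_addE /tuple_map !of_CnK UD VU addrK ?addrA [to_Cn y + _]addrC;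
    by move=> [].
apply: product_measure_eq_xsection => x.
rewrite -[LHS](preserves_tuple_add (tuple_map U x)).2; last exact: measurable_xsection.
congr (nu _); apply/seteqP; split=> y; rewrite /xsection/= !inE /S3 /S4/=;
  rewrite !tuple_addE /tuple_map !of_CnK opprD addrCA subrr addr0;
  by move=> [].
Qed.

End unitary_invariance.

(** * Volumes of cubes and balls, and unitary invariance *)

Section volumes.
Variable R : realType.
Local Notation C := R[i].
Local Notation T := (measurableTypeR R * measurableTypeR R)%type.
Local Notation nu := (@lebesgue_Cn R _).

(** Cubes have an explicit volume; a ball contains one and is contained in another, so its volume is
    positive and finite. *)
Definition cube n (r : R) : set (n.-tuple T) :=
  [set t | forall i, `|(tnth t i).1| < r /\ `|(tnth t i).2| < r].

Lemma measurable_cube n r : measurable (@cube n r).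
Proof.
rewrite (_ : @cube n r = @to_Cn R n @^-1` [set z | forall i,
    `|complex.Re (z ord0 i)| < r /\ `|complex.Im (z ord0 i)| < r]); last first.
  by apply/seteqP; split=> t h i; have := h i; rewrite mxE.
apply: measurable_cn_open => z hz.
pose d := \big[Num.min/1]_(i < n)
  Num.min (r - `|complex.Re (z ord0 i)|) (r - `|complex.Im (z ord0 i)|).
exists d.
  rewrite /d; elim/big_ind: _ => // [x y x0 y0|i _]; first by rewrite lt_min x0.
  by have [h1 h2] := hz i; rewrite lt_min !subr_gt0 h1.
move=> w wd i.
have di : d <= Num.min (r - `|complex.Re (z ord0 i)|) (r - `|complex.Im (z ord0 i)|).
  by rewrite /d; apply: bigmin_le_cond.
have wi : cmod (w ord0 i - z ord0 i) < d.
  apply: le_lt_trans wd; rewrite -[X in cmod X](_ : (w - z) ord0 i = _).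
    exact: coord_le_cvnorm.
  by rewrite !mxE.
move: (lt_le_trans wi di); rewrite lt_min.
have h1 := Re_le_cmod (w ord0 i - z ord0 i).
have h2 := Im_le_cmod (w ord0 i - z ord0 i).
move: h1 h2; case: (w ord0 i) (z ord0 i) => a b [a' b'] /= h1 h2 /andP[h3 h4]; split.
  have -> : a = (a - a') + a' by ring.
  rewrite (le_lt_trans (ler_normD _ _))//; lra.
have -> : b = (b - b') + b' by ring.
rewrite (le_lt_trans (ler_normD _ _))//; lra.
Qed.

Lemma lebesgue_cube n r : 0 < r ->
  nu (@cube n r) = (((r *+ 2) ^+ 2) ^+ n)%:E.
Proof.
move=> r0; elim: n => [|n ih].
  by rewrite /= diracE mem_set// => -[].
have muI : lebesgue_measure (`]-r, r[%classic : set (measurableTypeR R)) = (r *+ 2)%:E.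
  rewrite lebesgue_measure_itv/= lte_fin gtrN// -EFinD; congr EFin; ring.
pose I : set (measurableTypeR R) := `]-r, r[%classic.
have mI : measurable I by exact: measurable_itv.
have E : @tcons R n @^-1` (@cube n.+1 r) = (I `*` I) `*` (@cube n r).
  apply/seteqP; split=> [[[x y] t]|[[x y] t]] /=.
    move=> h; split; last by move=> i; have := h (lift ord0 i); rewrite tnthS.
    by have := h ord0; rewrite tnth0 /I/= !in_itv/= -!ltr_norml.
  rewrite /I/= !in_itv/= -!ltr_norml => -[[hx hy] h] i.
  case: (unliftP ord0 i) => [j ->|->]; last by rewrite tnth0.
  by rewrite tnthS.
rewrite /= /lebesgue_cons /pushforward E product_measure1E//; last 2 first.
- exact: measurableX.
- exact: measurable_cube.
have mII : (lebesgue_measure \x lebesgue_measure)%E (I `*` I) = (r *+ 2 * r *+ 2)%:E.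
  rewrite product_measure1E// [X in (X * _)%E]muI [X in (_ * X)%E]muI -EFinM.
  by rewrite mulrnAr.
rewrite [X in (X * _)%E]mII ih -EFinM (exprS ((r *+ 2) ^+ 2)); congr EFin.
by set P := (_ ^+ n); ring.
Qed.

Lemma lebesgue_norm_ball n z (r : R) :
  nu [set t : n.-tuple T | cvnorm (to_Cn t - z) < r] = nu (@tuple_ball R n r).
Proof.
rewrite -(preserves_tuple_add (of_Cn z)).2; last exact: measurable_norm_ball.
by congr (lebesgue_Cn n _); apply/seteqP; split=> t; rewrite /tuple_ball/= to_Cn_add of_CnK addrK.
Qed.

Lemma lebesgue_ball_gt0 n (r : R) : 0 < r -> (0 < nu (@tuple_ball R n r))%E.
Proof.
move=> r0; have n1 : 0 < n%:R * 2 + 1 :> R by rewrite ltr_wpDl// mulr_ge0.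
pose d := r / (n%:R * 2 + 1); have d0 : 0 < d by rewrite divr_gt0.
apply: (@lt_le_trans _ _ (nu (@cube n d))).
  by rewrite lebesgue_cube// lte_fin !exprn_gt0// mulrn_wgt0.
apply: le_measure; rewrite ?inE; [exact: measurable_cube|exact: measurable_tuple_ball|].
move=> t ht; rewrite /tuple_ball/= (le_lt_trans (cvnorm_le_sum _))//.
apply: (@le_lt_trans _ _ (\sum_(i < n) (d + d))).
  apply: ler_sum => i _; rewrite mxE (le_trans (cmod_le_ReIm _))//=.
  by have [h1 h2] := ht i; rewrite lerD// ltW.
rewrite sumr_const card_ord -[_ *+ n]mulr_natl.
have -> : n%:R * (d + d) = n%:R * 2 * d by ring.
by rewrite /d mulrA ltr_pdivrMr// mulrC ltr_pM2l// ltrDl.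
Qed.

Lemma lebesgue_ball_fin n (r : R) : 0 < r -> nu (@tuple_ball R n r) \is a fin_num.
Proof.
move=> r0; rewrite ge0_fin_numE ?measure_ge0//.
apply: (@le_lt_trans _ _ (nu (@cube n r))); last by rewrite lebesgue_cube// ltry.
apply: le_measure; rewrite ?inE; [exact: measurable_tuple_ball|exact: measurable_cube|].
move=> t; rewrite /tuple_ball/= => tr i.
have := coord_le_cvnorm (to_Cn t) i; rewrite mxE => h.
split; apply: le_lt_trans tr; apply: le_trans h.
  exact: (Re_le_cmod (_ +i* _)%C).
exact: (Im_le_cmod (_ +i* _)%C).
Qed.

(** For [U] and for the identity alike, the measure of the preimage of [A] times [nu(B)] equals
    [nu(B) nu(-A)]; cancel [nu(B)], which is positive and finite. *)
Lemma preserves_unitary n (U V : Cn R n -> Cn R n) : {morph U : z w / z + w} ->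
  (forall z, cvnorm (U z) = cvnorm z) -> cancel V U ->
  preserves (lebesgue_Cn n) (tuple_map U).
Proof.
move=> UD Un VU; split.
  by apply: measurable_tuple_map => z w; rewrite -{1}(subrK w z) UD addrK Un.
move=> A mA.
have h1 := lebesgue_Cn_unitary_neg UD Un VU mA.
have h2 := @lebesgue_Cn_unitary_neg R n id id A (fun _ _ => erefl) (fun _ => erefl) (fun _ => erefl) mA.
have idA : tuple_map id @^-1` A = A.
  by apply/seteqP; split=> t; rewrite /tuple_map/= to_CnK.
rewrite /= idA -h1 in h2.
have B0 := lebesgue_ball_gt0 n (@ltr01 R); have Bf := lebesgue_ball_fin n (@ltr01 R).
by apply/le_anti/andP; split; rewrite -(lee_pmul2r Bf B0) h2.
Qed.

End volumes.

(** * The normalized surface measure and means over the sphere *)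

Section sphere.
Variables (R : realType) (n : nat).
Hypothesis n_gt0 : (0 < n)%N.
Local Notation C := R[i].
Local Notation T := (measurableTypeR R * measurableTypeR R)%type.
Local Notation nu := (@lebesgue_Cn R n).
Local Notation sigma := (@sphere_measure R n).
Local Notation PB := (@punctured_ball R n).
Implicit Types (t : n.-tuple T) (z w : Cn R n) (u v : Cn R n -> R).

Lemma unit_vector_exists : exists z : Cn R n, cvnorm z = 1.
Proof.
exists (delta_mx ord0 (Ordinal n_gt0)).
apply/eqP; rewrite -(@eqrXn2 _ 2) ?cvnorm_ge0// sqr_cvnorm expr1n.
rewrite (bigD1 (Ordinal n_gt0))//= big1 ?addr0 => [|i /negbTE i0].
  by rewrite mxE !eqxx cmod1 expr1n.
by rewrite mxE i0 andbF cmod0 expr0n.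
Qed.

Lemma to_Cn_radial_proj t :
  to_Cn (radial_proj t) = ((cvnorm (to_Cn t))^-1)%:C%C *: to_Cn t.
Proof.
apply/rowP => i; rewrite !mxE tnth_mktuple /=; apply/eqP.
by rewrite eq_complex/= !mul0r subr0 addr0 ![_^-1 * _]mulrC !eqxx.
Qed.

Lemma cvnorm_radial_proj t : PB t -> cvnorm (to_Cn (radial_proj t)) = 1.
Proof.
move=> /andP[t0 _]; rewrite to_Cn_radial_proj cvnormZ cmod_real.
by rewrite ger0_norm ?invr_ge0 ?cvnorm_ge0// mulVf// gt_eqF.
Qed.

Definition sphere_tuple : set (n.-tuple T) := [set t | cvnorm (to_Cn t) = 1].

Lemma measurable_sphere_tuple : measurable sphere_tuple.
Proof.
rewrite (_ : sphere_tuple =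
    (fun t => cvnorm (to_Cn t) : measurableTypeR R) @^-1` [set 1]) //.
exact: measurable_preimage (@measurable_cvnorm R n) (measurable_set1 _).
Qed.

Lemma punctured_ball_fin : nu PB \is a fin_num.
Proof.
rewrite ge0_fin_numE ?measure_ge0//.
have := lebesgue_ball_fin n (@ltr01 R); rewrite ge0_fin_numE ?measure_ge0//.
apply: le_lt_trans; apply: le_measure; rewrite ?inE.
- exact: measurable_punctured_ball.
- exact: measurable_tuple_ball.
- by move=> t /andP[].
Qed.

(* The ball of radius [min (e / 8) (1 / 8)] around [z / 2] lies in the solid cone
   over the cap of radius [e] around [z]; its volume does not depend on [z]. *)
Definition cap_mass (e : R) : R :=
  (fine (nu PB))^-1 * fine (nu (@tuple_ball R n (Num.min (e / 8) 8^-1))).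

(** The centre [z / 2] keeps the ball away from the origin and from the sphere. The displacement of
    [w] and the change of its norm are both below [e / 8], and dividing their sum by [|w| > 1 / 4]
    leaves less than [e]. *)
Lemma cap_subset z (e : R) : 0 < e -> cvnorm z = 1 ->
  [set t | cvnorm (to_Cn t - 2^-1%:C%C *: z) < Num.min (e / 8) 8^-1] `<=`
  @radial_proj R n @^-1` [set t | cvnorm (to_Cn t - z) < e] `&` PB.
Proof.
move=> e0 z1 t /=; set w := to_Cn t; rewrite lt_min => /andP[we w8].
have hz : cvnorm (2^-1%:C%C *: z) = 2^-1.
  by rewrite cvnormZ z1 mulr1 cmod_real ger0_norm.
have h1 := cvnorm_distB w (2^-1%:C%C *: z).
have h2 := cvnorm_distB (2^-1%:C%C *: z) w.
rewrite cvnormB in h2; rewrite hz in h1 h2.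
have n1 : 0 < cvnorm w < 1 by apply/andP; split; lra.
split; last by rewrite /punctured_ball/=.
rewrite to_Cn_radial_proj -/w.
case/andP: n1 => w0 w1.
have -> : (cvnorm w)^-1%:C%C *: w - z =
  (cvnorm w)^-1%:C%C *: ((w - 2^-1%:C%C *: z) + (2^-1 - cvnorm w)%:C%C *: z).
  rewrite rmorphB scalerBl addrA subrK scalerBr; congr (_ - _).
  by rewrite scalerA -rmorphM mulVf ?scale1r// gt_eqF.
rewrite cvnormZ cmod_real ger0_norm ?invr_ge0 ?cvnorm_ge0//.
rewrite mulrC ltr_pdivrMr//.
apply: le_lt_trans (cvnormD _ _) _; rewrite cvnormZ z1 mulr1 cmod_real.
have h3 : `|2^-1 - cvnorm w| <= cvnorm (w - 2^-1%:C%C *: z).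
  by rewrite ler_norml; lra.
apply: (@lt_le_trans _ _ (e * 4^-1)); first lra.
by rewrite ler_wpM2l ?(ltW e0)//; lra.
Qed.

Lemma punctured_ball_gt0 : 0 < fine (nu PB).
Proof.
have [z z1] := unit_vector_exists.
have m0 : 0 < Num.min (1 / 8) 8^-1 :> R by rewrite lt_min; apply/andP; split; lra.
rewrite fine_gt0//; apply/andP; split; last by rewrite -ge0_fin_numE ?measure_ge0// punctured_ball_fin.
apply: (lt_le_trans (lebesgue_ball_gt0 n m0)).
rewrite -(lebesgue_norm_ball (2^-1%:C%C *: z)).
apply: le_measure; rewrite ?inE.
- exact: measurable_norm_ball.
- exact: measurable_punctured_ball.
- by apply: (subset_trans (cap_subset ltr01 z1)) => t [].
Qed.

Lemma cap_mass_gt0 e : 0 < e -> 0 < cap_mass e.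
Proof.
move=> e0; have m0 : 0 < Num.min (e / 8) 8^-1 by rewrite lt_min; apply/andP; split; lra.
rewrite mulr_gt0 ?invr_gt0 ?punctured_ball_gt0// fine_gt0//.
rewrite lebesgue_ball_gt0//=.
by rewrite -ge0_fin_numE ?measure_ge0// lebesgue_ball_fin.
Qed.

Lemma sphere_measure_cap z e : 0 < e -> cvnorm z = 1 ->
  ((cap_mass e)%:E <= sigma [set t | (cvnorm (to_Cn t - z) < e)%R])%E.
Proof.
move=> e0 z1; have m0 : 0 < Num.min (e / 8) 8^-1 by rewrite lt_min; apply/andP; split; lra.
rewrite /cap_mass EFinM fineK ?lebesgue_ball_fin// /sphere_measure.
rewrite lee_pmul2l//; last by rewrite lte_fin invr_gt0 punctured_ball_gt0.
rewrite -(lebesgue_norm_ball (2^-1%:C%C *: z)).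
apply: le_measure; rewrite ?inE.
- exact: measurable_norm_ball.
- apply: measurableI; last exact: measurable_punctured_ball.
  by apply: measurable_preimage (@measurable_radial_proj R n) _; exact: measurable_norm_ball.
- exact: cap_subset.
Qed.

Lemma sphere_measureT : sigma setT = 1%E.
Proof.
rewrite /sphere_measure preimage_setT setTI -[X in (_ * X)%E]fineK ?punctured_ball_fin//.
by rewrite -EFinM mulVf// gt_eqF// punctured_ball_gt0.
Qed.

Lemma sphere_measureC : sigma (~` sphere_tuple) = 0%E.
Proof.
rewrite /sphere_measure (_ : _ `&` _ = set0) ?measure0 ?mule0//.
by apply/seteqP; split=> // t [/= h /cvnorm_radial_proj].
Qed.

Lemma preserves_sphere_measure (U V : Cn R n -> Cn R n) : {morph U : z w / z + w} ->
  (forall (a : C) z, U (a *: z) = a *: U z) ->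
  (forall z, cvnorm (U z) = cvnorm z) -> cancel V U ->
  preserves sigma (tuple_map U).
Proof.
move=> UD UZ Un VU; have [mU pU] := preserves_unitary UD Un VU.
split=> // A mA; rewrite /sphere_measure; congr (_ * _)%E.
have mA' : measurable (@radial_proj R n @^-1` A `&` PB).
  apply: measurableI; last exact: measurable_punctured_ball.
  exact: measurable_preimage (@measurable_radial_proj R n) mA.
rewrite -[RHS]pU//; congr (nu _); apply/seteqP.
have E t : radial_proj (tuple_map U t) = tuple_map U (radial_proj t).
  apply: (can_inj (@to_CnK R n)); rewrite /tuple_map of_CnK !to_Cn_radial_proj.
  by rewrite of_CnK Un UZ.
have P t : PB (tuple_map U t) = PB t by rewrite /punctured_ball/= of_CnK Un.
by split=> t; rewrite /setI/= P E.
Qed.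

(** The bound is asked on the sphere only, because linear forms are unbounded on C^n. For the same
    reason [mean] integrates over [sphere_tuple], whose complement is negligible. *)
Definition nice u := measurable_fun setT (fun t => u (to_Cn t) : measurableTypeR R) /\
  exists K : R, forall z, cvnorm z = 1 -> `|u z| <= K.

Definition mean u : R := (\int[sigma]_(t in sphere_tuple) u (to_Cn t))%R.

Lemma sphere_measure_sphere : sigma sphere_tuple = 1%E.
Proof.
rewrite -sphere_measureT -(setUv sphere_tuple) measureU//.
- by rewrite [X in (_ + X)%E]sphere_measureC adde0.
- exact: measurable_sphere_tuple.
- by apply: measurableC; exact: measurable_sphere_tuple.
- by rewrite setICr.
Qed.

Lemma nice_integrable u : nice u ->
  sigma.-integrable sphere_tuple (EFin \o (fun t => u (to_Cn t))).
Proof.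
move=> [mu [K hK]]; apply: measurable_bounded_integrable.
- exact: measurable_sphere_tuple.
- by rewrite [X in (X < _)%E]sphere_measure_sphere ltry.
- exact: measurable_funTS.
- exists K; split; first exact: num_real.
  by move=> M KM t t1 /=; rewrite (le_trans (hK _ t1))// ltW.
Qed.

Lemma meanD u v : nice u -> nice v -> mean (u \+ v) = mean u + mean v.
Proof.
move=> nu nv; apply: RintegralD; first exact: measurable_sphere_tuple.
  exact: nice_integrable.
exact: nice_integrable.
Qed.

Lemma meanZ (c : R) u : nice u -> mean (fun z => c * u z) = c * mean u.
Proof.
move=> nu; apply: RintegralZl; first exact: measurable_sphere_tuple.
exact: nice_integrable.
Qed.

Lemma le_mean u v : nice u -> nice v -> (forall z, cvnorm z = 1 -> u z <= v z) ->
  mean u <= mean v.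
Proof.
move=> nu nv uv; apply: le_Rintegral; first exact: measurable_sphere_tuple.
- exact: nice_integrable.
- exact: nice_integrable.
- by move=> t; exact: uv.
Qed.

Lemma eq_mean u v : (forall z, cvnorm z = 1 -> u z = v z) -> mean u = mean v.
Proof. by move=> uv; apply: eq_Rintegral => t; rewrite inE; exact: uv. Qed.

Lemma mean_cst (c : R) : mean (fun=> c) = c.
Proof.
rewrite /mean Rintegral_cst; last exact: measurable_sphere_tuple.
by rewrite [X in fine X]sphere_measure_sphere mulr1.
Qed.

Lemma nice_cst (c : R) : nice (fun=> c).
Proof. by split; [exact: measurable_cst|exists `|c|]. Qed.

Lemma niceD u v : nice u -> nice v -> nice (u \+ v).
Proof.
move=> [mu [K hK]] [mv [L hL]]; split; first exact: measurable_funD.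
exists (K + L) => z z1; rewrite (le_trans (ler_normD _ _))// lerD//.
  exact: hK.
exact: hL.
Qed.

Lemma niceM u v : nice u -> nice v -> nice (fun z => u z * v z).
Proof.
move=> [mu [K hK]] [mv [L hL]]; split; first exact: measurable_funM.
exists (K * L) => z z1; rewrite normrM ler_pM//.
  exact: hK.
exact: hL.
Qed.

Lemma niceZ c u : nice u -> nice (fun z => c * u z).
Proof. by move=> nu; apply: niceM => //; exact: nice_cst. Qed.

Lemma nice_sum (I : Type) (r : seq I) (F : I -> Cn R n -> R) : (forall i, nice (F i)) ->
  nice (fun z => \sum_(i <- r) F i z).
Proof.
move=> nF; elim: r => [|i r ih].
  by have := nice_cst 0; congr nice; apply/funext => z; rewrite big_nil.
have := niceD (nF i) ih; congr nice; apply/funext => z; by rewrite big_cons.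
Qed.

Lemma mean_sum (I : Type) (r : seq I) (F : I -> Cn R n -> R) : (forall i, nice (F i)) ->
  mean (fun z => \sum_(i <- r) F i z) = \sum_(i <- r) mean (F i).
Proof.
move=> nF; elim: r => [|i r ih].
  by rewrite big_nil -[RHS](mean_cst 0); apply: eq_mean => z _; rewrite big_nil.
rewrite big_cons -ih -meanD//; last exact: nice_sum.
by apply: eq_mean => z _; rewrite big_cons.
Qed.

Lemma mean_unitary (U V : Cn R n -> Cn R n) u : {morph U : z w / z + w} ->
  (forall (a : C) z, U (a *: z) = a *: U z) ->
  (forall z, cvnorm (U z) = cvnorm z) -> cancel V U -> nice u ->
  nice (u \o U) /\ mean (u \o U) = mean u.
Proof.
move=> UD UZ Un VU [mu [K hK]].
have [mU pU] := preserves_sphere_measure UD UZ Un VU.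
have muU : measurable_fun setT (fun t => u (U (to_Cn t)) : measurableTypeR R).
  rewrite [X in measurable_fun _ X](_ : _ = (fun t => u (to_Cn t)) \o tuple_map U).
    exact: measurableT_comp mu mU.
  by apply/funext => t /=; rewrite of_CnK.
have nuU : nice (u \o U) by split => //; exists K => z z1; apply: hK; rewrite Un.
split=> //.
have K0 : 0 <= K by have [z z1] := unit_vector_exists; exact: le_trans (hK _ z1).
(* Positive functions are enough, after adding a constant on the sphere. *)
pose f t : \bar R := (\1_sphere_tuple t * (u (to_Cn t) + K))%:E.
have mf : measurable_fun setT f.
  apply/measurable_EFinP; apply: measurable_funM.
    by apply: measurable_indic; exact: measurable_sphere_tuple.
  by apply: measurable_funD => //; exact: measurable_cst.
have f0 t : (0 <= f t)%E.
  rewrite lee_fin indicE; case: (boolP (t \in _)) => [|_]; last by rewrite mul0r.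
  rewrite inE => /hK; rewrite ler_norml mul1r => /andP[h _]; lra.
have meanE (v : Cn R n -> R) : nice v ->
    mean v + K = fine (\int[sigma]_t (\1_sphere_tuple t * (v (to_Cn t) + K))%:E)%E.
  move=> nv; rewrite -[X in _ + X](mean_cst K) -meanD//; last exact: nice_cst.
  rewrite /mean /Rintegral integral_mkcond; congr fine; apply: eq_integral => t _.
  by rewrite patchE indicE; case: ifP => _; rewrite ?mul1r ?mul0r.
have niu : nice u by split => //; exists K.
apply: (addIr K); rewrite !meanE//; congr fine.
rewrite -(preserves_ge0_integral (conj mU pU) mf f0).
apply: eq_integral => t _; rewrite /f !indicE /tuple_map of_CnK; congr ((nat_of_bool _)%:R * _)%:E.
by apply/idP/idP; rewrite !inE /sphere_tuple/= of_CnK Un.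
Qed.

End sphere.

(** * Means on spheres and the Hardy inner product *)

Section dilation_means.
Variables (R : realType) (n : nat).
Hypothesis n_gt0 : (0 < n)%N.
Local Notation C := R[i].
Local Notation T := (measurableTypeR R * measurableTypeR R)%type.
Local Notation sigma := (@sphere_measure R n).
Implicit Types (t : n.-tuple T) (z w : Cn R n) (u v : Cn R n -> R) (F G : fct R n).

(** A Markov inequality on a cap, whose mass has a lower bound independent of its centre.
    Definiteness of the norm, the lower bound of the moments and the equality of moduli on the
    sphere all rest on it. *)
Lemma mean_ge_cap u z (c e : R) : nice u -> (forall w, cvnorm w = 1 -> 0 <= u w) ->
  cvnorm z = 1 -> 0 < e -> 0 <= c ->
  (forall w, cvnorm w = 1 -> cvnorm (w - z) < e -> c <= u w) ->
  c * cap_mass n e <= mean u.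
Proof.
move=> nu u0 z1 e0 c0 uc.
pose A : set (n.-tuple T) := [set t | cvnorm (to_Cn t - z) < e].
have mA : measurable A by exact: measurable_norm_ball.
pose v w : R := (cvnorm (w - z) < e)%R%:R.
have vA t : v (to_Cn t) = \1_A t.
  by rewrite /v indicE; congr (nat_of_bool _)%:R; apply/idP/idP; rewrite inE.
have nv : nice v.
  split; first by under eq_fun do rewrite vA; exact: measurable_indic.
  by exists 1 => w _; rewrite /v; case: (_ < _); rewrite ?normr1 ?normr0.
have cv : mean (fun w => c * v w) <= mean u.
  apply: le_mean => //; first exact: niceZ.
  move=> w w1; rewrite /v; case: ltP => we; last by rewrite mulr0 u0.
  by rewrite mulr1 uc.
apply: le_trans cv; rewrite meanZ// ler_wpM2l// /mean /Rintegral.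
under eq_integral do rewrite vA.
have mS := @measurable_sphere_tuple R n.
rewrite integral_indic// -lee_fin fineK; last first.
  have le1 : (sigma (A `&` (@sphere_tuple R n)) <= sigma (@sphere_tuple R n))%E.
    by apply: le_measure; rewrite ?inE//; exact: measurableI.
  rewrite ge0_fin_numE ?measure_ge0//; apply: le_lt_trans le1 _.
  by rewrite [X in (X < _)%E](sphere_measure_sphere R n_gt0) ltry.
apply: le_trans (sphere_measure_cap n_gt0 e0 z1) _.
have le2 : (sigma A <= sigma ((A `&` (@sphere_tuple R n)) `|` ~` (@sphere_tuple R n)))%E.
  apply: le_measure; rewrite ?inE//.
    by apply: measurableU; [exact: measurableI|exact: measurableC].
  by rewrite setUIl setUv setIT; exact: subsetUl.
have le3 : (sigma ((A `&` (@sphere_tuple R n)) `|` ~` (@sphere_tuple R n)) <=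
    sigma (A `&` (@sphere_tuple R n)) + sigma (~` (@sphere_tuple R n)))%E.
  by apply: measureU2; [exact: measurableI|exact: measurableC].
by apply: (le_trans le2); apply: (le_trans le3); rewrite sphere_measureC adde0.
Qed.

Lemma ball_regular_bounded F (r : R) : ball_regular F -> r < 1 ->
  exists2 K : R, 0 <= K & forall z, cvnorm z <= r -> cmod (F z) <= K.
Proof.
move=> [Fc _] r1; have [r0|r0] := ltP r 0.
  by exists 0 => // z zr; have := cvnorm_ge0 z; lra.
have [||||x x1 hx] := @cont_attains_max R n [set z | cvnorm z <= r] (fun z => cmod (F z)) r.
- by exists 0; rewrite /= cvnorm0.
- by [].
- move=> z h /=; rewrite leNgt; apply/negP => rz.
  have [|w wr] := h (cvnorm z - r); first by rewrite subr_gt0.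
  by rewrite cvnormB => /(le_lt_trans (cvnorm_distB _ _)); rewrite /= in wr; lra.
- move=> z zr e e0.
  have [d d0 hd] := Fc z (le_lt_trans zr r1) e e0.
  by exists d => // w _ /hd; apply: le_lt_trans; exact: cmod_dist.
by exists (cmod (F x)); [exact: cmod_ge0|exact: hx].
Qed.

Lemma dilation_in (r : R) z : 0 <= r -> cvnorm (r%:C%C *: z) = r * cvnorm z.
Proof. by move=> r0; rewrite cvnormZ cmod_real ger0_norm. Qed.

(** [p] is the real part, the imaginary part or the modulus. *)
Lemma nice_dilation F (p : C -> R) (r : R) : ball_fun F -> p 0 = 0 ->
  (forall x y, `|p x - p y| <= cmod (x - y)) -> 0 < r < 1 ->
  nice (fun z => p (F (r%:C%C *: z))).
Proof.
move=> [rF F0] p0 pl /andP[r0 r1]; split.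
  apply: (@measurable_cont R n [set z | cvnorm (r%:C%C *: z) < 1]
    (fun z => p (F (r%:C%C *: z)))).
  - move=> z /= zr; exists (1 - cvnorm (r%:C%C *: z)); first by rewrite subr_gt0.
    move=> w wz; have := cvnorm_distB (r%:C%C *: w) (r%:C%C *: z).
    rewrite -scalerBr (dilation_in (w - z) (ltW r0)).
    have : r * cvnorm (w - z) <= cvnorm (w - z) by rewrite ler_piMl ?cvnorm_ge0// ltW.
    lra.
  - move=> z /= zr e e0; have [d d0 hd] := rF.1 _ zr e e0.
    exists d => // w wz; apply: le_lt_trans (pl _ _) _; apply: hd.
    rewrite -scalerBr (dilation_in _ (ltW r0)) (le_lt_trans _ wz)//.
    by rewrite ler_piMl ?cvnorm_ge0// ltW.
  - by move=> z zr; rewrite F0.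
have [K K0 hK] := ball_regular_bounded rF r1.
exists K => z z1; have := pl (F (r%:C%C *: z)) 0; rewrite p0 !subr0 => /le_trans; apply.
by apply: hK; rewrite (dilation_in _ (ltW r0)) z1 mulr1.
Qed.

Lemma nice_Re F r : ball_fun F -> 0 < r < 1 ->
  nice (fun z => complex.Re (F (r%:C%C *: z))).
Proof.
move=> bF r01; apply: nice_dilation => // x y.
by apply: le_trans (Re_le_cmod (x - y)); case: x y => a b [].
Qed.

Lemma nice_Im F r : ball_fun F -> 0 < r < 1 ->
  nice (fun z => complex.Im (F (r%:C%C *: z))).
Proof.
move=> bF r01; apply: nice_dilation => // x y.
by apply: le_trans (Im_le_cmod (x - y)); case: x y => a b [].
Qed.

Lemma nice_cmod F r : ball_fun F -> 0 < r < 1 ->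
  nice (fun z => cmod (F (r%:C%C *: z))).
Proof.
move=> bF r01; apply: nice_dilation => //; first by rewrite cmod0.
by move=> x y; exact: cmod_dist.
Qed.

Definition mean_sq F (r : R) : R := mean (fun z => cmod (F (r%:C%C *: z)) ^+ 2).

Lemma nice_cmod_sq F r : ball_fun F -> 0 < r < 1 ->
  nice (fun z => cmod (F (r%:C%C *: z)) ^+ 2).
Proof. by move=> bF r01; apply: niceM; exact: nice_cmod. Qed.

Lemma mean_sq_ge0 F r : 0 <= mean_sq F r.
Proof. by apply: Rintegral_ge0 => t _; exact: sqr_ge0. Qed.

Lemma hardy_integral F r : ball_fun F -> 0 < r < 1 ->
  (\int[sigma]_t (cmod (F (r%:C%C *: to_Cn t)) ^+ 2)%:E)%E = (mean_sq F r)%:E.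
Proof.
move=> bF r01; have nF := nice_cmod_sq bF r01.
have mS := @measurable_sphere_tuple R n.
rewrite (@ge0_negligible_integral _ _ _ sigma setT (~` (@sphere_tuple R n)))//.
- rewrite setTD setCK /mean_sq /mean /Rintegral fineK//.
  exact: integrable_fin_num (nice_integrable n_gt0 nF).
- exact: measurableC.
- by apply/measurable_EFinP; exact: nF.1.
- by move=> t _; rewrite lee_fin sqr_ge0.
- exact: sphere_measureC.
Qed.

Lemma scale_unit_isometry (x : C) : cmod x = 1 ->
  forall z : Cn R n, cvnorm (x *: z) = cvnorm z.
Proof. by move=> x1 z; rewrite cvnormZ x1 mul1r. Qed.

Lemma mean_rotate (x : C) u : cmod x = 1 -> nice u ->
  nice (fun z => u (x *: z)) /\ mean (fun z => u (x *: z)) = mean u.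
Proof.
move=> x1 nu; have x0 : x != 0 by rewrite -cmod_eq0 x1 oner_eq0.
apply: (@mean_unitary R n n_gt0 (fun z => x *: z) (fun z => x^-1 *: z) u) => //.
- by move=> z w; rewrite scalerDr.
- by move=> a z; rewrite !scalerA mulrC.
- exact: scale_unit_isometry.
- by move=> z; rewrite scalerA mulfV// scale1r.
Qed.

Lemma analytic1_slice F z (x : C) : ball_regular F -> cvnorm z <= 1 -> cmod x < 1 ->
  analytic1 (fun y => F (y *: z)) x.
Proof.
move=> rF z1 x1; have : analytic1 (fun y => F (0 + y *: z)) x.
  apply: ball_regular_line => //; rewrite /unit_ball/= add0r cvnormZ.
  by rewrite (le_lt_trans _ x1)// ler_piMr// cmod_ge0.
by apply: analytic1_ext => y; rewrite add0r.
Qed.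

(** Rotation invariance lets one average over the N-th roots of unity without changing the means. On
    each complex line [mean_sqr_le] then compares the two radii, with an error that a large N brings
    below any [e]. *)
Lemma mean_sq_nondecreasing F r s : ball_fun F -> 0 < r -> r <= s -> s < 1 ->
  mean_sq F r <= mean_sq F s.
Proof.
move=> bF r0 rs s1; have s0 := lt_le_trans r0 rs.
have r01 : 0 < r < 1 by rewrite r0 (le_lt_trans rs).
have s01 : 0 < s < 1 by rewrite s0.
pose p := (1 + s) / 2.
have [p0 p1 sp] : [/\ 0 < p, p < 1 & s < p] by rewrite /p; split; lra.
have [K K0 hK] := ball_regular_bounded bF.1 p1.
apply/ler_addgt0Pr => e e0.
have q0 : 0 <= s / p by rewrite divr_ge0// ltW.
have q1 : s / p < 1 by rewrite ltr_pdivrMr// mul1r.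
have K1 : 0 < K + 1 by lra.
(* The error of [mean_sqr_le] is [4 (K + d) d]; with [d <= 1] it is at most [4 (K + 1) d <= e]. *)
pose d := Num.min 1 (e / (4 * (K + 1))).
have d0 : 0 < d by rewrite lt_min ltr01 divr_gt0// mulr_gt0.
have [N0 hN] := natmul_expr_small q0 q1 (divr_gt0 d0 K1).
pose N := N0.+1; have [w wN] := prim_root_exists R (ltn0Sn N0).
have hd : N.+1%:R * K * (s / p) ^+ N <= d.
  have := hN N (leqnSn _); rewrite ltr_pdivlMr// => /ltW; apply: le_trans.
  rewrite mulrAC ler_wpM2l// ?lerDl//.
  by rewrite mulr_ge0// exprn_ge0.
have dE : 4 * (K + d) * d <= e.
  have h1 : d <= 1 by rewrite ge_min lexx.
  have h2 : d <= e / (4 * (K + 1)) by rewrite ge_min lexx orbT.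
  apply: (@le_trans _ _ (4 * (K + 1) * d)).
    by rewrite ler_wpM2r ?(ltW d0)// ler_wpM2l// lerD2l.
  by rewrite mulrC -ler_pdivlMr ?mulr_gt0.
have wj j := cmod_prim_root wN j.
have avg (t : R) : 0 < t < 1 ->
  nice (fun z => N%:R^-1 * \sum_(j < N) cmod (F ((w ^+ j * t%:C%C) *: z)) ^+ 2) /\
  mean (fun z => N%:R^-1 * \sum_(j < N) cmod (F ((w ^+ j * t%:C%C) *: z)) ^+ 2) =
  mean_sq F t.
  move=> t01; have nF := nice_cmod_sq bF t01.
  have nj (j : 'I_N) : nice (fun z => cmod (F ((w ^+ j * t%:C%C) *: z)) ^+ 2) /\
     mean (fun z => cmod (F ((w ^+ j * t%:C%C) *: z)) ^+ 2) = mean_sq F t.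
    have := mean_rotate (wj j) nF.
    by under eq_fun do rewrite scalerA mulrC.
  split; first by apply: niceZ; apply: nice_sum => j; exact: (nj j).1.
  rewrite meanZ//; last by apply: nice_sum => j; exact: (nj j).1.
  rewrite (mean_sum n_gt0 _ (fun j => (nj j).1)).
  under eq_bigr => j _ do rewrite (nj j).2.
  by rewrite sumr_const card_ord -[X in _ * X]mulr_natl mulrA mulVf ?mul1r// pnatr_eq0.
have [nr <-] := avg _ r01; have [ns <-] := avg _ s01.
rewrite -[e](mean_cst n_gt0) -meanD//; last exact: nice_cst.
apply: le_mean => //; first exact: niceD ns (nice_cst n e).
move=> z z1 /=.
have ha x : cmod x < 1 -> analytic1 (fun y => F (y *: z)) x.
  by apply: analytic1_slice; [exact: bF.1|rewrite z1].
have hK' (x : C) : cmod x <= p -> cmod (F (x *: z)) <= K.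
  by move=> xp; apply: hK; rewrite cvnormZ z1 mulr1.
have [c [b [L [b0 hc]]]] := ha 0 (eq_ind_r (fun y => y < 1) ltr01 (cmod0 R)).
have := mean_sqr_le p0 p1 ha hK' b0 hc wN (ltW r0) rs (ltW sp) hd.
by move=> /le_trans; apply; rewrite lerD2l.
Qed.

End dilation_means.

(** * Complex means and limits, taken componentwise *)

Definition cmean (R : realType) n (u : Cn R n -> R[i]) : R[i] :=
  (mean (fun z => complex.Re (u z)) +i* mean (fun z => complex.Im (u z)))%C.

Definition cnice (R : realType) n (u : Cn R n -> R[i]) : Prop :=
  nice (fun z => complex.Re (u z)) /\ nice (fun z => complex.Im (u z)).

Definition ccvg (R : realType) (u : nat -> R[i]) (l : R[i]) : Prop :=
  (fun k => complex.Re (u k)) @ \oo --> complex.Re l /\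
  (fun k => complex.Im (u k)) @ \oo --> complex.Im l.

Section complex_limits.
Variable R : realType.
Implicit Types (u v : nat -> R[i]) (l m : R[i]).

Lemma ReD (x y : R[i]) : complex.Re (x + y) = complex.Re x + complex.Re y.
Proof. by case: x y => a b []. Qed.

Lemma ImD (x y : R[i]) : complex.Im (x + y) = complex.Im x + complex.Im y.
Proof. by case: x y => a b []. Qed.

Lemma ReB (x y : R[i]) : complex.Re (x - y) = complex.Re x - complex.Re y.
Proof. by case: x y => a b []. Qed.

Lemma ImB (x y : R[i]) : complex.Im (x - y) = complex.Im x - complex.Im y.
Proof. by case: x y => a b []. Qed.

Lemma ReM (x y : R[i]) : complex.Re (x * y) =
  complex.Re x * complex.Re y - complex.Im x * complex.Im y.
Proof. by case: x y => a b []. Qed.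

Lemma ImM (x y : R[i]) : complex.Im (x * y) =
  complex.Re x * complex.Im y + complex.Im x * complex.Re y.
Proof. by case: x y => a b []. Qed.

Lemma ReJ (x : R[i]) : complex.Re (x^*)%C = complex.Re x.
Proof. by case: x. Qed.

Lemma ImJ (x : R[i]) : complex.Im (x^*)%C = - complex.Im x.
Proof. by case: x. Qed.

Lemma complex_eqP (x y : R[i]) : complex.Re x = complex.Re y ->
  complex.Im x = complex.Im y -> x = y.
Proof. by case: x y => a b [c d] /= -> ->. Qed.

Lemma ccvg_unique u l m : ccvg u l -> ccvg u m -> l = m.
Proof.
move=> [h1 h2] [h3 h4]; apply: complex_eqP.
  by rewrite -(cvg_lim _ h1)// -(cvg_lim _ h3).
by rewrite -(cvg_lim _ h2)// -(cvg_lim _ h4).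
Qed.

Lemma ccvgD u v l m : ccvg u l -> ccvg v m -> ccvg (fun k => u k + v k) (l + m).
Proof.
move=> [h1 h2] [h3 h4]; split.
  by rewrite ReD; under eq_fun do rewrite ReD; exact: cvgD.
by rewrite ImD; under eq_fun do rewrite ImD; exact: cvgD.
Qed.

Lemma ccvgZ (a : R[i]) u l : ccvg u l -> ccvg (fun k => a * u k) (a * l).
Proof.
move=> [h1 h2]; split.
  rewrite ReM; under eq_fun do rewrite ReM.
  by apply: cvgB; apply: cvgMr.
rewrite ImM; under eq_fun do rewrite ImM.
by apply: cvgD; apply: cvgMr.
Qed.

Lemma ccvgJ u l : ccvg u l -> ccvg (fun k => ((u k)^*)%C) ((l^*)%C).
Proof.
move=> [h1 h2]; split.
  by rewrite ReJ; under eq_fun do rewrite ReJ.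
by rewrite ImJ; under eq_fun do rewrite ImJ; exact: cvgN.
Qed.

End complex_limits.

Section complex_means.
Variables (R : realType) (n : nat).
Hypothesis n_gt0 : (0 < n)%N.
Implicit Types (u v : Cn R n -> R[i]).

Lemma cniceD u v : cnice u -> cnice v -> cnice (fun z => u z + v z).
Proof.
move=> [h1 h2] [h3 h4]; split.
  by under eq_fun do rewrite ReD; exact: niceD.
by under eq_fun do rewrite ImD; exact: niceD.
Qed.

Lemma cnice_cst (a : R[i]) : cnice (fun _ : Cn R n => a).
Proof. by split; exact: nice_cst. Qed.

Lemma niceB (u v : Cn R n -> R) : nice u -> nice v -> nice (fun z => u z - v z).
Proof.
move=> nu nv; have := niceD nu (niceZ (-1) nv).
by congr nice; apply/funext => z /=; rewrite mulN1r.
Qed.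

Lemma cniceM u v : cnice u -> cnice v -> cnice (fun z => u z * v z).
Proof.
move=> [h1 h2] [h3 h4]; split.
  by under eq_fun do rewrite ReM; apply: niceB; exact: niceM.
by under eq_fun do rewrite ImM; apply: niceD; exact: niceM.
Qed.

Lemma cniceJ u : cnice u -> cnice (fun z => ((u z)^*)%C).
Proof.
move=> [h1 h2]; split.
  by move: h1; congr nice; apply/funext => z; case: (u z).
have := niceZ (-1) h2; congr nice; apply/funext => z; case: (u z) => a b /=.
by rewrite mulN1r.
Qed.

Lemma cmeanD u v : cnice u -> cnice v -> cmean (fun z => u z + v z) = cmean u + cmean v.
Proof.
move=> [h1 h2] [h3 h4]; apply: complex_eqP; rewrite ?ReD ?ImD /= -meanD//.
  by apply: eq_mean => z _; rewrite ReD.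
by apply: eq_mean => z _; rewrite ImD.
Qed.

Lemma meanB (u v : Cn R n -> R) : nice u -> nice v ->
  mean (fun z => u z - v z) = mean u - mean v.
Proof.
move=> nu nv; rewrite -[in RHS]mulN1r -meanZ// -meanD//; last exact: niceZ.
by apply: eq_mean => z _ /=; rewrite mulN1r.
Qed.

Lemma cmeanZ (a : R[i]) u : cnice u -> cmean (fun z => a * u z) = a * cmean u.
Proof.
move=> [h1 h2]; apply: complex_eqP; rewrite ?ReM ?ImM /= -!meanZ//.
  by rewrite -meanB; [apply: eq_mean => z _; rewrite ReM|exact: niceZ|exact: niceZ].
by rewrite -meanD; [apply: eq_mean => z _; rewrite ImM|by []|exact: niceZ|exact: niceZ].
Qed.

Lemma cmeanJ u : cnice u -> cmean (fun z => ((u z)^*)%C) = ((cmean u)^*)%C.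
Proof.
move=> [h1 h2]; apply: complex_eqP => /=.
  by apply: eq_mean => z _; case: (u z).
rewrite -[RHS]mulN1r -meanZ//; apply: eq_mean => z _; case: (u z) => a b /=.
by rewrite mulN1r.
Qed.

Lemma eq_cmean u v : (forall z, cvnorm z = 1 -> u z = v z) -> cmean u = cmean v.
Proof. by move=> uv; congr (_ +i* _)%C; apply: eq_mean => z z1; rewrite uv. Qed.

End complex_means.

(** * The Hardy norm and its inner product *)

Section hardy.
Variables (R : realType) (n : nat).
Hypothesis n_gt0 : (0 < n)%N.
Local Notation C := R[i].
Implicit Types (F G H : fct R n).

(** Contains [H2], with analyticity relaxed to [ball_fun]: closure under sums and bounded
    multipliers then involves no power series in several variables. *)
Definition hardy_fun F : Prop :=
  ball_fun F /\ exists B : R, forall r, 0 < r < 1 -> mean_sq F r <= B.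

(** With [k.+2] the first radius is [1 / 2]; [k.+1] would start at 0, outside the open interval of
    admissible radii. *)
Definition radius (k : nat) : R := 1 - k.+2%:R^-1.

Lemma radius_in k : 0 < radius k < 1.
Proof.
have h : 0 < k.+2%:R^-1 :> R by rewrite invr_gt0.
have : k.+2%:R^-1 < 1 :> R by rewrite invf_lt1// ltr1n.
by rewrite /radius => h'; rewrite subr_gt0 h' ltrBlDr ltrDl h.
Qed.

Lemma radius_le k m : (k <= m)%N -> radius k <= radius m.
Proof. by move=> km; rewrite lerB// lef_pV2 ?posrE ?ltr0n// ler_nat. Qed.

Lemma radius_cofinal r : r < 1 -> exists k, r <= radius k.
Proof.
move=> r1; exists (Num.truncn (1 - r)^-1).
have h : (1 - r)^-1 < (Num.truncn (1 - r)^-1).+1%:R by exact: truncnS_gt.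
have r0 : 0 < 1 - r by rewrite subr_gt0.
rewrite /radius lerBrDr addrC -lerBrDr.
rewrite -[leRHS]invrK lef_pV2 ?posrE ?invr_gt0 ?ltr0n//.
by apply: ltW; apply: lt_trans h _; rewrite ltr_nat.
Qed.

Lemma hardy_sqnormE F : ball_fun F ->
  hardy_sqnorm F = ereal_sup (EFin @` [set mean_sq F r | r in `]0, 1[]).
Proof.
move=> bF; congr ereal_sup; apply/seteqP; split=> x.
  move=> [r r01 <-]; have r01' : 0 < r < 1 by move: r01; rewrite /= in_itv.
  by exists (mean_sq F r); [exists r|rewrite hardy_integral].
move=> [_ [r r01 <-] <-]; exists r => //.
by rewrite hardy_integral//; move: r01; rewrite /= in_itv.
Qed.

Lemma hardy_funP F : ball_fun F -> (hardy_sqnorm F < +oo)%E <-> hardy_fun F.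
Proof.
move=> bF; rewrite hardy_sqnormE//; split=> [h|[_ [B hB]]].
  split=> //; set s := ereal_sup _ in h.
  have s0 : (0 <= s)%E.
    apply: (@le_trans _ _ (mean_sq F (radius 0))%:E); first by rewrite lee_fin mean_sq_ge0.
    apply: ereal_sup_ubound; exists (mean_sq F (radius 0)) => //.
    by exists (radius 0) => //; rewrite /= in_itv/= radius_in.
  exists (fine s) => r r01; rewrite -lee_fin (@fineK _ s) ?ge0_fin_numE//.
  apply: ereal_sup_ubound; exists (mean_sq F r) => //.
  by exists r => //; rewrite /= in_itv.
apply: (@le_lt_trans _ _ B%:E); last exact: ltry.
apply: ge_ereal_sup => _ [_ [r r01 <-] <-]; rewrite lee_fin hB//.
Qed.

Lemma H2_hardy F : H2 F -> hardy_fun F.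
Proof. by move=> [aF hF]; apply/hardy_funP => //; exact: analytic_ball_fun. Qed.

Lemma hardy_H2 F : analytic_ball F -> hardy_fun F -> H2 F.
Proof. by move=> aF hF; split => //; apply/hardy_funP => //; exact: hF.1. Qed.

Lemma hnorm_sqr F : hardy_fun F ->
  hnorm F ^+ 2 = sup [set mean_sq F r | r in `]0, 1[].
Proof.
move=> [bF [B hB]]; rewrite /hnorm hardy_sqnormE//.
have S0 : [set mean_sq F r | r in `]0, 1[] !=set0.
  by exists (mean_sq F (radius 0)), (radius 0) => //; rewrite /= in_itv/= radius_in.
rewrite ereal_sup_EFin//; last first.
  by exists B => _ [r r01 <-]; apply: hB; move: r01; rewrite /= in_itv.
rewrite /= sqr_sqrtr//.
have [x Sx] := S0; apply: (@le_trans _ _ x); first by case: Sx => r _ <-; exact: mean_sq_ge0.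
apply: sup_upper_bound => //; split => //.
by exists B => _ [r r01 <-]; apply: hB; move: r01; rewrite /= in_itv.
Qed.

Lemma mean_sq_le_hnorm F r : hardy_fun F -> 0 < r < 1 -> mean_sq F r <= hnorm F ^+ 2.
Proof.
move=> hF r01; rewrite hnorm_sqr//; have [_ [B hB]] := hF.
apply: sup_upper_bound; last by exists r => //; rewrite /= in_itv.
split; first by exists (mean_sq F r), r => //; rewrite /= in_itv.
by exists B => _ [s s01 <-]; apply: hB; move: s01; rewrite /= in_itv.
Qed.

(** The means are nondecreasing in the radius, so their supremum is a limit along [radius], and
    relations that hold at every radius pass to the norm. *)
Lemma hnorm_sqr_cvg F : hardy_fun F ->
  (fun k => mean_sq F (radius k)) @ \oo --> hnorm F ^+ 2.
Proof.
move=> hF; apply/cvgrPdist_lt => e e0; have [bF [B hB]] := hF.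
have : has_sup [set mean_sq F r | r in `]0, 1[].
  split; first by exists (mean_sq F (radius 0)), (radius 0) => //; rewrite /= in_itv/= radius_in.
  by exists B => _ [s s01 <-]; apply: hB; move: s01; rewrite /= in_itv.
move=> /(sup_adherent e0)[_ [r r01 <-]]; rewrite -hnorm_sqr// => hr.
have /andP[r0 r1] : 0 < r < 1 by move: r01; rewrite /= in_itv.
have [k0 hk0] := radius_cofinal r1.
exists k0 => // k /= kk0; have /andP[rk0 rk1] := radius_in k.
have le1 : mean_sq F r <= mean_sq F (radius k).
  by apply: mean_sq_nondecreasing => //; rewrite (le_trans hk0)// radius_le.
have le2 := mean_sq_le_hnorm hF (radius_in k).
move: (hnorm F ^+ 2) (mean_sq F (radius k)) (mean_sq F r) hr le1 le2 => x y z h1 h2 h3.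
by rewrite /= ltr_norml; apply/andP; split; lra.
Qed.

Lemma hnorm_le F (B : R) : hardy_fun F -> (forall r, 0 < r < 1 -> mean_sq F r <= B) ->
  hnorm F ^+ 2 <= B.
Proof.
move=> hF hB; rewrite hnorm_sqr//; apply: ge_sup.
  by exists (mean_sq F (radius 0)), (radius 0) => //; rewrite /= in_itv/= radius_in.
by move=> _ [s s01 <-]; apply: hB; move: s01; rewrite /= in_itv.
Qed.

Lemma hardy_funD F G : hardy_fun F -> hardy_fun G -> hardy_fun (F + G).
Proof.
move=> [bF [B hB]] [bG [B' hB']]; split; first exact: ball_funD.
exists (2 * B + 2 * B') => r r01.
have nF := nice_cmod_sq bF r01; have nG := nice_cmod_sq bG r01.
apply: (@le_trans _ _ (mean ((fun z => 2 * cmod (F (r%:C%C *: z)) ^+ 2) \+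
  (fun z => 2 * cmod (G (r%:C%C *: z)) ^+ 2)))).
  apply: le_mean => //; first by apply: nice_cmod_sq => //; exact: ball_funD.
    by apply: niceD; exact: niceZ.
  move=> z _ /=; set x := F _; set y := G _.
  have h : cmod (x + y) <= cmod x + cmod y by exact: cmodD.
  have h0 := cmod_ge0 (x + y).
  apply: (@le_trans _ _ ((cmod x + cmod y) ^+ 2)); first by rewrite lerXn2r// nnegrE ?addr_ge0 ?cmod_ge0.
  have := sqr_ge0 (cmod x - cmod y); nra.
rewrite meanD//; [|exact: niceZ|exact: niceZ].
by rewrite !meanZ// lerD// ler_wpM2l//; [exact: hB|exact: hB'].
Qed.

Lemma hardy_fun_mulop (g : fct R n) F (M : R) : ball_regular g -> hardy_fun F -> 0 <= M ->
  (forall z, unit_ball z -> cmod (g z) <= M) ->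
  hardy_fun (mulop g F) /\ hnorm (mulop g F) <= M * hnorm F.
Proof.
move=> rg hF M0 gM; have [bF _] := hF.
have le1 r : 0 < r < 1 -> mean_sq (mulop g F) r <= M ^+ 2 * mean_sq F r.
  move=> r01; have nF := nice_cmod_sq bF r01.
  rewrite /mean_sq -meanZ//; apply: le_mean => //.
  - by apply: nice_cmod_sq => //; exact: ball_fun_mulop.
  - exact: niceZ.
  - move=> z z1; rewrite /mulop cmodM exprMn ler_wpM2r ?sqr_ge0//.
    rewrite lerXn2r ?nnegrE ?cmod_ge0//; apply: gM.
    case/andP: r01 => r0 r1.
    by rewrite /unit_ball/= cvnormZ z1 mulr1 cmod_real gtr0_norm.
have le2 r : 0 < r < 1 -> mean_sq (mulop g F) r <= M ^+ 2 * hnorm F ^+ 2.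
  move=> r01; rewrite (le_trans (le1 _ r01))// ler_wpM2l ?sqr_ge0//.
  exact: mean_sq_le_hnorm.
have hgF : hardy_fun (mulop g F).
  by split; [exact: ball_fun_mulop|exists (M ^+ 2 * hnorm F ^+ 2)].
split=> //; rewrite -(@ler_pXn2r _ 2) ?nnegrE ?mulr_ge0 ?sqrtr_ge0//.
by rewrite exprMn; exact: hnorm_le.
Qed.

Lemma hardy_funZ (a : R[i]^o) F : hardy_fun F -> hardy_fun (a *: F).
Proof.
move=> hF; have [] := hardy_fun_mulop (ball_regular_cst n a) hF (cmod_ge0 a) (fun z _ => lexx _).
by [].
Qed.

Definition pairing F G (r : R) : C := cmean (fun z => F (r%:C%C *: z) * ((G (r%:C%C *: z))^*)%C).

Lemma cnice_dilation F r : ball_fun F -> 0 < r < 1 -> cnice (fun z => F (r%:C%C *: z)).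
Proof. by move=> bF r01; split; [exact: nice_Re|exact: nice_Im]. Qed.

Lemma cnice_pairing F G r : ball_fun F -> ball_fun G -> 0 < r < 1 ->
  cnice (fun z => F (r%:C%C *: z) * ((G (r%:C%C *: z))^*)%C).
Proof.
by move=> bF bG r01; apply: cniceM; [|apply: cniceJ]; exact: cnice_dilation.
Qed.

Lemma hdotE F G : hdot F G =
  Complex ((hnorm (F + G) ^+ 2 - hnorm (F + (-1 : R[i]^o) *: G) ^+ 2) / 4)
   ((hnorm (F + ('i%C : R[i]^o) *: G) ^+ 2 - hnorm (F + (- 'i%C : R[i]^o) *: G) ^+ 2) / 4).
Proof.
rewrite /hdot !big_ord_recl big_ord0 /= !expr0 /bump /= !add1n expr1.
have i2 : ('i%C : R[i]^o) ^+ 2 = -1 by exact: sqr_i.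
have i3 : ('i%C : R[i]^o) ^+ 3 = - 'i%C by rewrite exprS i2 mulrN1.
rewrite i2 i3 scale1r.
move: (hnorm (F + G)) (hnorm (F + (-1 : R[i]^o) *: G)) (hnorm (F + ('i%C : R[i]^o) *: G))
  (hnorm (F + (- 'i%C : R[i]^o) *: G)) => a b c d.
have -> : (4%:R : R[i]^o)^-1 = ((4%:R : R)^-1)%:C%C by rewrite fmorphV rmorph_nat.
by apply: complex_eqP => /=; field.
Qed.

Lemma pairing_polar F G r : ball_fun F -> ball_fun G -> 0 < r < 1 -> pairing F G r =
  Complex ((mean_sq (F + G) r - mean_sq (F + (-1 : R[i]^o) *: G) r) / 4)
   ((mean_sq (F + ('i%C : R[i]^o) *: G) r - mean_sq (F + (- 'i%C : R[i]^o) *: G) r) / 4).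
Proof.
move=> bF bG r01.
have nFG (a : R[i]^o) : nice (fun z => cmod ((F + a *: G) (r%:C%C *: z)) ^+ 2).
  by apply: nice_cmod_sq => //; apply: ball_funD => //; exact: ball_funZ.
have nFG1 : nice (fun z => cmod ((F + G) (r%:C%C *: z)) ^+ 2).
  by apply: nice_cmod_sq => //; exact: ball_funD.
rewrite /pairing /cmean /mean_sq; congr (_ +i* _)%C.
  rewrite -meanB// mulrC -meanZ//; last exact: niceB.
  apply: eq_mean => z _; have -> : (F + (-1 : R[i]^o) *: G) (r%:C%C *: z) =
    F (r%:C%C *: z) + (-1) * G (r%:C%C *: z) by [].
  have -> : (F + G) (r%:C%C *: z) = F (r%:C%C *: z) + G (r%:C%C *: z) by [].
  by rewrite !sqr_cmod; case: (F _) (G _) => a b [c d] /=; field.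
rewrite -meanB// mulrC -meanZ//; last exact: niceB.
apply: eq_mean => z _; have -> : (F + ('i%C : R[i]^o) *: G) (r%:C%C *: z) =
    F (r%:C%C *: z) + 'i%C * G (r%:C%C *: z) by [].
have -> : (F + (- 'i%C : R[i]^o) *: G) (r%:C%C *: z) =
    F (r%:C%C *: z) + (- 'i%C) * G (r%:C%C *: z) by [].
by rewrite !sqr_cmod; case: (F _) (G _) => a b [c d] /=; field.
Qed.

(** The polarization formula hides linearity. At each radius it computes the sesquilinear [pairing],
    and [hdot] inherits its laws in the limit. *)
Lemma pairing_cvg F G : hardy_fun F -> hardy_fun G ->
  ccvg (fun k => pairing F G (radius k)) (hdot F G).
Proof.
move=> hF hG; have [bF _] := hF; have [bG _] := hG.
have hFG (a : R[i]^o) : hardy_fun (F + a *: G) by apply: hardy_funD => //; exact: hardy_funZ.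
have hFG1 : hardy_fun (F + G) by exact: hardy_funD.
rewrite hdotE; split.
  under eq_fun do rewrite pairing_polar ?radius_in//=.
  by apply: cvgMl; apply: cvgB; exact: hnorm_sqr_cvg.
under eq_fun do rewrite pairing_polar ?radius_in//=.
by apply: cvgMl; apply: cvgB; exact: hnorm_sqr_cvg.
Qed.

Lemma hdotDl F G H : hardy_fun F -> hardy_fun G -> hardy_fun H ->
  hdot (F + G) H = hdot F H + hdot G H.
Proof.
move=> hF hG hH; apply: ccvg_unique (pairing_cvg (hardy_funD hF hG) hH) _.
have := ccvgD (pairing_cvg hF hH) (pairing_cvg hG hH).
congr ccvg; apply/funext => k; have r01 := radius_in k.
rewrite /pairing -cmeanD//; [|exact: cnice_pairing hF.1 hH.1 r01|exact: cnice_pairing hG.1 hH.1 r01].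
by apply: eq_cmean => z _; rewrite -mulrDl.
Qed.

Lemma hdotZl (a : R[i]^o) F G : hardy_fun F -> hardy_fun G -> hdot (a *: F) G = a * hdot F G.
Proof.
move=> hF hG; apply: ccvg_unique (pairing_cvg (hardy_funZ a hF) hG) _.
have := ccvgZ a (pairing_cvg hF hG).
congr ccvg; apply/funext => k; have r01 := radius_in k.
rewrite /pairing -cmeanZ//; last exact: cnice_pairing hF.1 hG.1 r01.
by apply: eq_cmean => z _; rewrite mulrA.
Qed.

Lemma hdotJ F G : hardy_fun F -> hardy_fun G -> ((hdot F G)^*)%C = hdot G F.
Proof.
move=> hF hG; apply: ccvg_unique (ccvgJ (pairing_cvg hF hG)) _.
have := pairing_cvg hG hF.
congr ccvg; apply/funext => k; have r01 := radius_in k.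
rewrite /pairing -cmeanJ//; last exact: cnice_pairing hF.1 hG.1 r01.
by apply: eq_cmean => z _; rewrite rmorphM/= conjcK mulrC.
Qed.

Lemma hdot_sqr F : hardy_fun F -> hdot F F = (hnorm F ^+ 2)%:C%C.
Proof.
move=> hF; apply: ccvg_unique (pairing_cvg hF hF) _.
have E k : pairing F F (radius k) = (mean_sq F (radius k))%:C%C.
  rewrite /pairing /cmean /mean_sq; apply: complex_eqP => /=.
    by apply: eq_mean => z _; rewrite -sqr_cmodC.
  by rewrite -[RHS](mean_cst n_gt0); apply: eq_mean => z _; rewrite -sqr_cmodC.
split; first by under eq_fun do rewrite E; exact: hnorm_sqr_cvg.
by under eq_fun do rewrite E; exact: cvg_cst.
Qed.

End hardy.

(** * Inner product spaces *)

(** Relative to a set [D], because the laws of [hdot] are stated on Hardy functions, which sit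
    inside the module of all functions. *)
Record inner_space (R : realType) (E : lmodType R[i]) (D : set E)
    (dot : E -> E -> R[i]) (nrm : E -> R) : Prop := InnerSpace {
  in_0 : D 0;
  in_D : forall x y, D x -> D y -> D (x + y);
  in_Z : forall a x, D x -> D (a *: x);
  dotDl : forall x y z, D x -> D y -> D z -> dot (x + y) z = dot x z + dot y z;
  dotZl : forall a x y, D x -> D y -> dot (a *: x) y = a * dot x y;
  dotJ : forall x y, D x -> D y -> ((dot x y)^*)%C = dot y x;
  dot_sqr : forall x, D x -> dot x x = (nrm x ^+ 2)%:C%C;
  nrm_ge0 : forall x, 0 <= nrm x;
  nrm_eq0 : forall x, D x -> nrm x = 0 -> x = 0
}.

Section inner_space.
Context (R : realType) (E : lmodType R[i]) (D : set E)
  (dot : E -> E -> R[i]) (nrm : E -> R).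
Hypothesis ip : inner_space D dot nrm.
Local Notation C := R[i].
Implicit Types (x y z : E) (a b : C).

Let D0 := in_0 ip.
Let DD := in_D ip.
Let DZ := in_Z ip.
Let DJ := dotJ ip.

Lemma in_N x : D x -> D (- x).
Proof. by move=> Dx; rewrite -scaleN1r; exact: DZ. Qed.

Lemma in_B x y : D x -> D y -> D (x - y).
Proof. by move=> Dx Dy; apply: DD => //; exact: in_N. Qed.

Lemma in_sum I (r : seq I) (P : pred I) (F : I -> E) : (forall i, P i -> D (F i)) ->
  D (\sum_(i <- r | P i) F i).
Proof. by move=> DF; elim/big_ind: _ => //. Qed.

Lemma dotDr x y z : D x -> D y -> D z -> dot x (y + z) = dot x y + dot x z.
Proof.
move=> Dx Dy Dz; rewrite -(DJ (DD Dy Dz) Dx) (dotDl ip)// rmorphD/=.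
by rewrite (DJ Dy Dx) (DJ Dz Dx).
Qed.

Lemma dotZr a x y : D x -> D y -> dot x (a *: y) = (a^*)%C * dot x y.
Proof.
by move=> Dx Dy; rewrite -(DJ (DZ a Dy) Dx) (dotZl ip)// rmorphM/= (DJ Dy Dx).
Qed.

Lemma dot0l x : D x -> dot 0 x = 0.
Proof. by move=> Dx; rewrite -(scale0r x) (dotZl ip)// mul0r. Qed.

Lemma dot0r x : D x -> dot x 0 = 0.
Proof. by move=> Dx; rewrite -(scale0r x) dotZr// conjc0 mul0r. Qed.

Lemma dotNl x y : D x -> D y -> dot (- x) y = - dot x y.
Proof. by move=> Dx Dy; rewrite -scaleN1r (dotZl ip)// mulN1r. Qed.

Lemma dotBl x y z : D x -> D y -> D z -> dot (x - y) z = dot x z - dot y z.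
Proof. by move=> Dx Dy Dz; rewrite (dotDl ip)// ?dotNl//; exact: in_N. Qed.

Lemma dotBr x y z : D x -> D y -> D z -> dot x (y - z) = dot x y - dot x z.
Proof.
move=> Dx Dy Dz; rewrite -(DJ (in_B Dy Dz) Dx) dotBl// rmorphB/=.
by rewrite (DJ Dy Dx) (DJ Dz Dx).
Qed.

Lemma dot_suml I (r : seq I) (P : pred I) (F : I -> E) y :
  (forall i, P i -> D (F i)) -> D y ->
  dot (\sum_(i <- r | P i) F i) y = \sum_(i <- r | P i) dot (F i) y.
Proof.
move=> DF Dy; elim: r => [|i r ih]; first by rewrite !big_nil dot0l.
rewrite !big_cons; case: ifPn => // Pi.
by rewrite (dotDl ip) ?ih//; [exact: DF|exact: in_sum].
Qed.

Lemma dot_sumr I (r : seq I) (P : pred I) (F : I -> E) y :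
  (forall i, P i -> D (F i)) -> D y ->
  dot y (\sum_(i <- r | P i) F i) = \sum_(i <- r | P i) dot y (F i).
Proof.
move=> DF Dy; elim: r => [|i r ih]; first by rewrite !big_nil dot0r.
rewrite !big_cons; case: ifPn => // Pi.
by rewrite dotDr ?ih//; [exact: DF|exact: in_sum].
Qed.

Lemma nrmD_sqr x y : D x -> D y ->
  nrm (x + y) ^+ 2 = nrm x ^+ 2 + nrm y ^+ 2 + 2 * complex.Re (dot x y).
Proof.
move=> Dx Dy; have := dot_sqr ip (DD Dx Dy).
rewrite (dotDl ip)//; last exact: DD.
rewrite !dotDr// (dot_sqr ip Dx) (dot_sqr ip Dy) -(DJ Dx Dy).
move=> /(congr1 (@complex.Re R)) /= <-; rewrite !ReD /= ReJ; ring.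
Qed.

Lemma nrmZ a x : D x -> nrm (a *: x) = cmod a * nrm x.
Proof.
move=> Dx; apply/eqP.
rewrite -(@eqrXn2 _ 2) ?mulr_ge0 ?cmod_ge0 ?(nrm_ge0 ip)//.
apply/eqP; apply: complexI; rewrite -(dot_sqr ip); last exact: DZ.
rewrite (dotZl ip)//; last exact: DZ.
by rewrite dotZr// (dot_sqr ip)// mulrA -sqr_cmodC -rmorphM exprMn.
Qed.

Lemma nrm0 : nrm 0 = 0.
Proof. by rewrite -(scale0r 0) nrmZ// cmod0 mul0r. Qed.

Lemma nrmN x : D x -> nrm (- x) = nrm x.
Proof. by move=> Dx; rewrite -scaleN1r nrmZ// cmodN cmod1 mul1r. Qed.

Lemma dot_CS x y : D x -> D y -> cmod (dot x y) <= nrm x * nrm y.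
Proof.
move=> Dx Dy; have [y0|y0] := eqVneq (nrm y) 0.
  by rewrite y0 mulr0 (nrm_eq0 ip Dy y0) dot0r// cmod0.
have Y0 : 0 < nrm y by rewrite lt_neqAle eq_sym y0 (nrm_ge0 ip).
pose a : C := (nrm y ^+ 2)%:C%C; pose b := dot x y.
have Dax := DZ a Dx; have Dby := DZ b Dy.
have : (nrm (a *: x - b *: y) ^+ 2)%:C%C =
       ((nrm y ^+ 2) * (nrm y ^+ 2 * nrm x ^+ 2 - cmod (dot x y) ^+ 2))%:C%C.
  rewrite -(dot_sqr ip); last exact: in_B.
  rewrite dotBl//; last exact: in_B.
  rewrite !dotBr// !(dotZl ip)// !dotZr// -(DJ Dx Dy) (dot_sqr ip Dx) (dot_sqr ip Dy).
  rewrite /a /b conjc_real [RHS]rmorphM/= rmorphB/= [X in _ * (X - _)]rmorphM/= sqr_cmodC.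
  ring.
move=> /complexI h; have := sqr_ge0 (nrm (a *: x - b *: y)).
rewrite h pmulr_rge0 ?exprn_gt0// subr_ge0 -exprMn mulrC.
by rewrite ler_pXn2r// ?nnegrE ?cmod_ge0// mulr_ge0 ?(nrm_ge0 ip).
Qed.

Lemma nrmD x y : D x -> D y -> nrm (x + y) <= nrm x + nrm y.
Proof.
move=> Dx Dy; rewrite -(@ler_pXn2r _ 2) ?nnegrE ?addr_ge0 ?(nrm_ge0 ip)//.
rewrite nrmD_sqr// sqrrD.
have : complex.Re (dot x y) <= nrm x * nrm y.
  by rewrite (le_trans (ler_norm _))// (le_trans (Re_le_cmod _))// dot_CS.
rewrite -mulr_natl; lra.
Qed.

Lemma nrm_dist x y : D x -> D y -> `|nrm x - nrm y| <= nrm (x - y).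
Proof.
move=> Dx Dy; rewrite ler_norml; apply/andP; split.
  have := nrmD (in_B Dy Dx) Dx; rewrite subrK -(nrmN (in_B Dy Dx)) opprB; lra.
have := nrmD (in_B Dx Dy) Dy; rewrite subrK; lra.
Qed.

Lemma nrm_sum I (r : seq I) (P : pred I) (F : I -> E) : (forall i, P i -> D (F i)) ->
  nrm (\sum_(i <- r | P i) F i) <= \sum_(i <- r | P i) nrm (F i).
Proof.
move=> DF; elim: r => [|i r ih]; first by rewrite !big_nil nrm0.
rewrite !big_cons; case: ifPn => // Pi.
by rewrite (le_trans (nrmD _ _)) ?lerD2l//; [exact: DF|exact: in_sum].
Qed.

(** [x - y] is orthogonal to [y], so [|x|^2] exceeds [|y|^2] by [|x - y|^2]. Applied with [y] the
    projection of [x], this gives [phi f = X f]. *)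
Lemma pythagoras_eq x y : D x -> D y -> dot (x - y) y = 0 -> nrm x <= nrm y -> x = y.
Proof.
move=> Dx Dy xy le; have Dxy := in_B Dx Dy.
have h : nrm x ^+ 2 = nrm (x - y) ^+ 2 + nrm y ^+ 2.
  by have := nrmD_sqr Dxy Dy; rewrite subrK xy /= mulr0 addr0.
have le2 : nrm x ^+ 2 <= nrm y ^+ 2 by rewrite lerXn2r ?nnegrE ?(nrm_ge0 ip).
have s0 : nrm (x - y) ^+ 2 = 0.
  by apply/le_anti; rewrite sqr_ge0 andbT; move: h le2; lra.
apply/eqP; rewrite -subr_eq0; apply/eqP; apply: (nrm_eq0 ip) => //.
by apply/eqP; rewrite -sqrf_eq0 s0.
Qed.

Definition orthonormal m (b : 'I_m -> E) : Prop :=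
  (forall j, D (b j)) /\ forall i j, dot (b i) (b j) = (i == j)%:R.

Lemma dot_orthonormal_sum m (b : 'I_m -> E) (c : 'I_m -> C) j : orthonormal b ->
  dot (\sum_i c i *: b i) (b j) = c j.
Proof.
move=> [Db bb]; rewrite dot_suml// => [|i _]; last exact: DZ.
rewrite (bigD1 j)//= (dotZl ip)// bb eqxx mulr1 big1 ?addr0// => i ij.
by rewrite (dotZl ip)// bb (negbTE ij) mulr0.
Qed.

Lemma nrm_orthonormal_sum m (b : 'I_m -> E) (c : 'I_m -> C) : orthonormal b ->
  nrm (\sum_i c i *: b i) ^+ 2 = \sum_i cmod (c i) ^+ 2.
Proof.
move=> ob; have [Db bb] := ob; apply: complexI.
have Ds : D (\sum_i c i *: b i) by apply: in_sum => i _; exact: DZ.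
rewrite -(dot_sqr ip)// dot_sumr// => [|i _]; last exact: DZ.
rewrite rmorph_sum/=; apply: eq_bigr => j _.
by rewrite dotZr// dot_orthonormal_sum// sqr_cmodC mulrC.
Qed.

(** The family may be dependent: a vector with zero residual [u] is dropped, so [m] can be smaller
    than [d]. *)
Lemma gram_schmidt d (e : 'I_d -> E) : (forall j, D (e j)) ->
  exists m (b : 'I_m -> E), orthonormal b /\
    [set \sum_(j < d) c j *: e j | c in [set: 'I_d -> C]] =
    [set \sum_(j < m) c j *: b j | c in [set: 'I_m -> C]].
Proof.
elim: d e => [|d ih] e De.
  by exists 0%N, e; split=> //; split=> // -[].
have [m [b [ob be]]] := ih (fun j => e (lift ord0 j)) (fun j => De _).
have [Db bb] := ob.
pose v := e ord0; pose p := \sum_j dot v (b j) *: b j; pose u := v - p.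
have Dp : D p by apply: in_sum => j _; exact: DZ.
have Dv : D v by exact: De.
have Du : D u by exact: in_B.
have ub j : dot u (b j) = 0 by rewrite dotBl// dot_orthonormal_sum// subrr.
have span_e x : [set \sum_(j < d.+1) c j *: e j | c in [set: 'I_d.+1 -> C]] x <->
    exists a (c : 'I_m -> C), x = a *: v + \sum_j c j *: b j.
  split=> [[c _ <-]|[a [c ->]]].
    rewrite big_ord_recl.
    have : [set \sum_(j < d) c j *: e (lift ord0 j) | c in [set: 'I_d -> C]]
      (\sum_(j < d) c (lift ord0 j) *: e (lift ord0 j)) by exists (c \o lift ord0).
    by rewrite be => -[c' _ <-]; exists (c ord0), c'.
  have : [set \sum_(j < m) c j *: b j | c in [set: 'I_m -> C]] (\sum_j c j *: b j) by exists c.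
  rewrite -be => -[c' _ <-].
  exists (fun i => if unlift ord0 i is Some j then c' j else a) => //.
  rewrite big_ord_recl unlift_none; congr (_ + _).
  by apply: eq_bigr => j _; rewrite liftK.
have [u0|u0] := eqVneq u 0.
  exists m, b; split=> //; apply/seteqP; split=> x.
    move=> /span_e[a [c ->]]; exists (fun j => a * dot v (b j) + c j) => //.
    have -> : v = p by apply/eqP; rewrite -subr_eq0 -/u u0.
    rewrite scaler_sumr -big_split/=; apply: eq_bigr => j _.
    rewrite scalerDl -scalerA; congr (_ *: (_ *: _) + _).
    by have := ub j; rewrite u0 dot0l// => _; rewrite -[in RHS](subrK p v) -/u u0 add0r.
  by move=> [c _ <-]; apply/span_e; exists 0, c; rewrite scale0r add0r.
have nu : nrm u != 0 by apply: contraNneq u0 => /(nrm_eq0 ip Du) ->.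
pose w := ((nrm u)^-1)%:C%C *: u.
have Dw : D w by exact: DZ.
have wb j : dot w (b j) = 0 by rewrite (dotZl ip)// ub mulr0.
have ww : dot w w = 1.
  rewrite (dotZl ip)// dotZr// (dot_sqr ip)// conjc_real -!rmorphM.
  by rewrite (_ : _ * _ = 1) ?rmorph1//; field.
have uw : u = (nrm u)%:C%C *: w by rewrite scalerA -rmorphM mulfV// scale1r.
pose b' (i : 'I_m.+1) := if unlift ord0 i is Some j then b j else w.
have b'0 : b' ord0 = w by rewrite /b' unlift_none.
have b'S j : b' (lift ord0 j) = b j by rewrite /b' liftK.
exists m.+1, b'; split.
  split=> [j|i j]; first by case: (unliftP ord0 j) => [k ->|->]; rewrite ?b'S ?b'0.
  case: (unliftP ord0 i) => [k ->|->]; case: (unliftP ord0 j) => [l ->|->];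
    rewrite ?b'S ?b'0.
  - by rewrite bb (inj_eq lift_inj).
  - by rewrite -(DJ Dw (Db k)) wb conjc0.
  - by rewrite wb.
  - by rewrite ww eqxx.
apply/seteqP; split=> x.
  move=> /span_e[a [c ->]].
  exists (fun i => if unlift ord0 i is Some j then a * dot v (b j) + c j else a * (nrm u)%:C%C) => //.
  rewrite big_ord_recl unlift_none b'0 -scalerA -uw.
  under eq_bigr do rewrite liftK b'S scalerDl -scalerA.
  by rewrite big_split/= -scaler_sumr -/p addrA -scalerDr /u subrK.
move=> [c _ <-]; apply/span_e; rewrite big_ord_recl b'0.
under eq_bigr do rewrite b'S.
exists (c ord0 * ((nrm u)^-1)%:C%C), (fun j => c (lift ord0 j) - c ord0 * ((nrm u)^-1)%:C%C * dot v (b j)).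
under [in RHS]eq_bigr do rewrite scalerBl -scalerA.
rewrite sumrB -scaler_sumr -/p /w /u scalerA scalerBr.
by rewrite addrA addrAC.
Qed.

End inner_space.

Section hilbert.
Variables (R : realType) (n : nat).
Hypothesis n_gt0 : (0 < n)%N.
Local Notation C := R[i].
Implicit Types (F G H : fct R n).

Lemma hardy_fun0 : hardy_fun (0 : fct R n).
Proof.
split; first by split; [exact: ball_regular_cst|].
by exists 0 => r _; rewrite /mean_sq -[leRHS](mean_cst n_gt0) le_eqVlt;
  apply/orP; left; apply/eqP; apply: eq_mean => z _; rewrite cmod0 expr0n.
Qed.

(** If [F z] is not 0, then [|F|] is at least [|F z| / 2] near [z], hence on a cap of a sphere of
    some radius [r], and the mean at that radius is positive. *)
Lemma hnorm_eq0 F : hardy_fun F -> hnorm F = 0 -> F = 0.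
Proof.
move=> hF hF0; apply/funext => z; apply: contrapT => Fz.
have [bF _] := hF.
have zb : unit_ball z by apply: contrapT => /bF.2.
have Fz0 : cmod (F z) != 0 by rewrite cmod_eq0; apply/eqP.
have Fz1 : 0 < cmod (F z) by rewrite lt_neqAle eq_sym Fz0 cmod_ge0.
have [d d0 hd] := bF.1.1 z zb (cmod (F z) / 2) (divr_gt0 Fz1 (ltr0n R 2)).
have big w : cvnorm (w - z) < d -> cmod (F z) / 2 <= cmod (F w).
  by move=> /hd; rewrite cmodB => h; have := cmod_distB (F z) (F w); lra.
have [e1 e1n] := unit_vector_exists R n_gt0.
have [r [u [r01 u1 ru]]] : exists r u, [/\ 0 < r < 1, cvnorm u = 1 & cvnorm (r%:C%C *: u - z) < d].
  (* The sphere through the origin degenerates; a small sphere around it is used instead. *)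
  have [->|z0] := eqVneq z 0.
    exists (Num.min 2^-1 (d / 2)), e1.
    have m0 : 0 < Num.min 2^-1 (d / 2) by rewrite lt_min; apply/andP; split; lra.
    have m1 : Num.min 2^-1 (d / 2) <= 2^-1 by rewrite ge_min lexx.
    have m2 : Num.min 2^-1 (d / 2) <= d / 2 by rewrite ge_min lexx orbT.
    split=> //; first by apply/andP; split; lra.
    by rewrite subr0 cvnormZ e1n mulr1 cmod_real gtr0_norm//; lra.
  have zn0 : 0 < cvnorm z by rewrite cvnorm_gt0.
  exists (cvnorm z), ((cvnorm z)^-1%:C%C *: z); split.
  - by rewrite zn0.
  - by rewrite cvnormZ cmod_real ger0_norm ?invr_ge0 ?cvnorm_ge0// mulVf// gt_eqF.
  - by rewrite scalerA -rmorphM mulfV ?gt_eqF// scale1r subrr cvnorm0.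
case/andP: (r01) => r0 r1.
pose e := (d - cvnorm (r%:C%C *: u - z)).
have e0 : 0 < e by rewrite subr_gt0.
have := mean_ge_cap n_gt0 (nice_cmod_sq bF r01) (fun w _ => sqr_ge0 _) u1 e0 (sqr_ge0 (cmod (F z) / 2)).
move=> h; have := mean_sq_le_hnorm n_gt0 hF r01.
rewrite hF0 expr0n /= leNgt => /negP; apply.
apply: lt_le_trans (h _).
  by rewrite mulr_gt0 ?cap_mass_gt0// exprn_gt0// divr_gt0.
move=> w w1 wu; rewrite lerXn2r ?nnegrE ?cmod_ge0 ?divr_ge0 ?cmod_ge0//; apply: big.
have -> : r%:C%C *: w - z = r%:C%C *: (w - u) + (r%:C%C *: u - z).
  by rewrite scalerBr addrA subrK.
apply: le_lt_trans (cvnormD _ _) _.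
have : cvnorm (r%:C%C *: (w - u)) <= cvnorm (w - u).
  by rewrite cvnormZ cmod_real gtr0_norm// ler_piMl ?cvnorm_ge0// ltW.
rewrite /e in wu; lra.
Qed.

Lemma hardy_inner : inner_space (E := fct R n) (@hardy_fun R n) (@hdot R n) (@hnorm R n).
Proof.
split.
- exact: hardy_fun0.
- by move=> F G; exact: hardy_funD.
- by move=> a F; exact: hardy_funZ.
- by move=> F G H; exact: hdotDl.
- by move=> a F G; exact: hdotZl.
- by move=> F G; exact: hdotJ.
- by move=> F; exact: hdot_sqr.
- by move=> F; exact: sqrtr_ge0.
- exact: hnorm_eq0.
Qed.

End hilbert.

(** * Homogeneous parts as inner products *)

Section two_phase_rotation.
Variables (R : realType) (n : nat) (zeta : Cn R n).
Hypothesis zeta1 : cvnorm zeta = 1.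
Local Notation C := R[i].
Implicit Types (z w : Cn R n) (x y : C).

(** For a unit vector [zeta], the linear map with eigenvalue [x] on [zeta] and [y] on its orthogonal
    complement: unitary when [x] and [y] are unimodular, and scaling the projection onto the line of
    [zeta] when [y = 0]. *)
Definition rot x y z : Cn R n := (x * cip z zeta) *: zeta + y *: (z - cip z zeta *: zeta).

Let cip_zeta : cip zeta zeta = 1.
Proof. by rewrite cip_sqr zeta1 expr1n. Qed.

Let cip_perp z : cip (z - cip z zeta *: zeta) zeta = 0.
Proof. by rewrite cipBl cipZl cip_zeta mulr1 subrr. Qed.

Lemma rotD x y : {morph rot x y : z w / z + w}.
Proof.
move=> z w; rewrite /rot cipDl mulrDr !scalerDl opprD addrACA scalerDr.
by rewrite addrACA.
Qed.

Lemma rotZ x y a z : rot x y (a *: z) = a *: rot x y z.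
Proof.
rewrite /rot cipZl; move: (cip z zeta) => c; rewrite !scalerDr !scalerA; congr (_ + _).
  by congr (_ *: _); exact: mulrCA.
rewrite !scalerN !scalerA [y * a]mulrC; congr (_ - _ *: _).
by have := @mulrCA C y a c; rewrite (@mulrA C a y c).
Qed.

Lemma cip_rot x y z : cip (rot x y z) zeta = x * cip z zeta.
Proof. by rewrite /rot cipDl !cipZl cip_perp cip_zeta mulr0 addr0 mulr1. Qed.

Lemma rot_comp x y x' y' z : rot x y (rot x' y' z) = rot (x * x') (y * y') z.
Proof.
rewrite {1}/rot cip_rot; congr (_ + _); first by rewrite mulrA.
by rewrite {1}/rot addrAC subrr add0r scalerA.
Qed.

Lemma rot11 z : rot 1 1 z = z.
Proof. by rewrite /rot mul1r scale1r subrKC. Qed.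

Lemma cvnorm_rot_sqr x y z : cvnorm (rot x y z) ^+ 2 =
  cmod x ^+ 2 * cmod (cip z zeta) ^+ 2 + cmod y ^+ 2 * cvnorm (z - cip z zeta *: zeta) ^+ 2.
Proof.
rewrite [LHS]cvnormD_sqr (cvnormZ (x * cip z zeta)) (cvnormZ y) zeta1 mulr1.
rewrite (cmodM x (cip z zeta)) (exprMn _ (cmod x)) (exprMn _ (cmod y)).
by rewrite cipZl cipZr -[cip zeta _]cipJ cip_perp conjc0 !mulr0 addr0.
Qed.

Lemma bessel z : cvnorm z ^+ 2 =
  cmod (cip z zeta) ^+ 2 + cvnorm (z - cip z zeta *: zeta) ^+ 2.
Proof. by rewrite -{1}(rot11 z) cvnorm_rot_sqr cmod1 expr1n !mul1r. Qed.

Lemma cvnorm_rot_le x y z (m : R) : cmod x <= m -> cmod y <= m ->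
  cvnorm (rot x y z) <= m * cvnorm z.
Proof.
move=> xm ym; have m0 : 0 <= m := le_trans (cmod_ge0 x) xm.
rewrite -(@ler_pXn2r _ 2) ?nnegrE ?mulr_ge0 ?cvnorm_ge0//.
rewrite cvnorm_rot_sqr exprMn (bessel z) [leRHS]mulrDr.
by apply: lerD; rewrite ler_wpM2r ?sqr_ge0// lerXn2r ?nnegrE ?cmod_ge0.
Qed.

Lemma cvnorm_rot x y z : cmod x = 1 -> cmod y = 1 -> cvnorm (rot x y z) = cvnorm z.
Proof.
move=> x1 y1; apply/eqP; rewrite -(@eqrXn2 _ 2) ?cvnorm_ge0//.
by rewrite cvnorm_rot_sqr x1 y1 expr1n !mul1r -bessel.
Qed.

Lemma cip_le_cvnorm z : cmod (cip z zeta) <= cvnorm z.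
Proof. by rewrite (le_trans (cip_CS _ _))// zeta1 mulr1. Qed.

Hypothesis n_gt0 : (0 < n)%N.

Lemma cmean_rot x y (u : Cn R n -> C) : cmod x = 1 -> cmod y = 1 -> cnice u ->
  cnice (u \o rot x y) /\ cmean (u \o rot x y) = cmean u.
Proof.
move=> x1 y1 [h1 h2].
have x0 : x != 0 by rewrite -cmod_eq0 x1 oner_eq0.
have y0 : y != 0 by rewrite -cmod_eq0 y1 oner_eq0.
have inv : cancel (rot x^-1 y^-1) (rot x y).
  by move=> z; rewrite rot_comp !mulfV// rot11.
have Z (a : C) z := rotZ x y a z.
have Nm z := cvnorm_rot z x1 y1.
have [n1 e1] := mean_unitary n_gt0 (rotD x y) Z Nm inv h1.
have [n2 e2] := mean_unitary n_gt0 (rotD x y) Z Nm inv h2.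
split; first by split.
by rewrite /cmean; congr (_ +i* _)%C; [exact: e1|exact: e2].
Qed.

End two_phase_rotation.

Section coefficient_formula.
Variables (R : realType) (n : nat).
Hypothesis n_gt0 : (0 < n)%N.
Local Notation C := R[i].
Implicit Types (F : fct R n) (z w zeta : Cn R n).

Lemma cmean_sum (I : Type) (r : seq I) (u : I -> Cn R n -> C) :
  (forall i, cnice (u i)) ->
  cnice (fun z => \sum_(i <- r) u i z) /\
  cmean (fun z => \sum_(i <- r) u i z) = \sum_(i <- r) cmean (u i).
Proof.
move=> nu; elim: r => [|i r [ih1 ih2]].
  split; first by have := cnice_cst n (0 : C); congr cnice; apply/funext => z; rewrite big_nil.
  rewrite big_nil; apply: complex_eqP => /=;
    by rewrite -[RHS](mean_cst n_gt0); apply: eq_mean => z _; rewrite big_nil.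
have E : (fun z => \sum_(j <- i :: r) u j z) = (fun z => u i z + \sum_(j <- r) u j z).
  by apply/funext => z; rewrite big_cons.
by rewrite E big_cons -ih2 -cmeanD//; split => //; exact: cniceD.
Qed.

Lemma cmean_le (u : Cn R n -> C) (B : R) : cnice u ->
  (forall z, cvnorm z = 1 -> cmod (u z) <= B) -> cmod (cmean u) <= 2 * B.
Proof.
move=> [n1 n2] uB; apply: (le_trans (cmod_le_ReIm _)) => /=.
have bd (v : Cn R n -> R) : nice v -> (forall z, cvnorm z = 1 -> `|v z| <= B) -> `|mean v| <= B.
  move=> nv vB; rewrite ler_norml; apply/andP; split.
    rewrite -(mean_cst n_gt0 (- B)); apply: le_mean => //; first exact: nice_cst.
    by move=> z /vB; rewrite ler_norml => /andP[].
  rewrite -[leRHS](mean_cst n_gt0); apply: le_mean => //; first exact: nice_cst.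
  by move=> z /vB; rewrite ler_norml => /andP[].
rewrite mulr_natl mulr2n lerD//; apply: bd => // z z1; apply: le_trans (uB z z1).
  exact: Re_le_cmod.
exact: Im_le_cmod.
Qed.

Lemma cnice_cip zeta : cnice (fun z : Cn R n => cip z zeta).
Proof.
have cont (p : C -> R) : (forall x y, `|p x - p y| <= cmod (x - y)) ->
    nice (fun z : Cn R n => p (cip z zeta)).
  move=> pl; split.
    apply: (@measurable_cont R n setT (fun z => p (cip z zeta))).
    - by move=> z _; exists 1.
    - move=> z _ e e0; have k0 : 0 < cvnorm zeta + 1 by rewrite ltr_wpDl// cvnorm_ge0.
      exists (e / (cvnorm zeta + 1)); first by rewrite divr_gt0.
      move=> w wz; apply: le_lt_trans (pl _ _) _; rewrite -cipBl.
      apply: le_lt_trans (cip_CS _ _) _.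
      apply: (@le_lt_trans _ _ (cvnorm (w - z) * (cvnorm zeta + 1))).
        by rewrite ler_wpM2l ?cvnorm_ge0// lerDl.
      by rewrite -ltr_pdivlMr.
    - by move=> z /(_ I).
  exists (`|p 0| + cvnorm zeta) => z z1.
  have -> : p (cip z zeta) = p 0 + (p (cip z zeta) - p 0) by ring.
  rewrite (le_trans (ler_normD _ _))// lerD2l (le_trans (pl _ _))// subr0.
  by rewrite (le_trans (cip_CS _ _))// z1 mul1r.
split; apply: cont => x y.
  by apply: le_trans (Re_le_cmod (x - y)); case: x y => a b [].
by apply: le_trans (Im_le_cmod (x - y)); case: x y => a b [].
Qed.

Lemma cniceX (u : Cn R n -> C) k : cnice u -> cnice (fun z => u z ^+ k).
Proof.
move=> nu; elim: k => [|k ih]; first exact: cnice_cst.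
have := cniceM nu ih; congr cnice; by apply/funext => z; rewrite exprS.
Qed.

Definition cip_moment zeta k : R := mean (fun z => cmod (cip z zeta) ^+ (2 * k)).

Lemma cnice_cmod_cip zeta k :
  cnice (fun z : Cn R n => (cmod (cip z zeta) ^+ (2 * k))%:C%C).
Proof.
have nl := cniceX k (cnice_cip zeta).
have := cniceM nl (cniceJ nl); congr cnice; apply/funext => z.
by rewrite -sqr_cmodC cmodX mulnC exprM.
Qed.

Lemma cmean_cip_moment zeta k (a : C) :
  cmean (fun z => a * (cmod (cip z zeta) ^+ (2 * k))%:C%C) = a * (cip_moment zeta k)%:C%C.
Proof.
rewrite (cmeanZ n_gt0); last exact: cnice_cmod_cip.
congr (_ * _); by apply: complex_eqP => //=; exact: mean_cst.
Qed.

Variables (F : fct R n) (zeta : Cn R n).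
Hypothesis zeta1 : cvnorm zeta = 1.
Hypothesis bF : ball_fun F.
Variables (c : {ffun 'I_n -> nat} -> R[i]^o) (t M : R).
Hypotheses (t_gt0 : 0 < t) (M_ge0 : 0 <= M).
Hypothesis hc : forall w, cvnorm w <= t -> forall N,
    cmod (F (0 + w) - \sum_(k < N) homog_part c k w) <= M * (cvnorm w / t) ^+ N.

(* Averaging over the rotations of [zeta] and of its orthogonal complement by
   roots of unity isolates the term of degree [k] along [zeta]. *)
Lemma pairing_cipX k r : 0 < r < 1 ->
  cmean (fun z => F (r%:C%C *: z) * (((cip z zeta) ^+ k)^*)%C) =
  r%:C%C ^+ k * homog_part c k zeta * (cip_moment zeta k)%:C%C.
Proof.
move=> r01; have /andP[r0 r1] := r01.
set G := fun z => _.
have nG : cnice G.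
  apply: cniceM; first exact: cnice_dilation.
  by apply: cniceJ; apply: cniceX; exact: cnice_cip.
rewrite -cmean_cip_moment; set H := fun z => _.
have nH : cnice H by apply: cniceM; [exact: cnice_cst|exact: cnice_cmod_cip].
apply/eqP; rewrite -subr_eq0 -cmod_eq0 eq_le cmod_ge0 andbT.
apply/ler_addgt0Pr => e e0; rewrite add0r.
(* For [|x|] and [|y|] below [rho] the dilated point [r * rot x y z] stays in the ball. Since [q]
   lies strictly between 1 and [rho], the errors of the averages have ratio [1 / q], and [K] bounds
   [F] up to the radius [p = r q]. *)
pose rho := r^-1; pose q := (1 + rho) / 2; pose p := (r + 1) / 2.
have rho1 : 1 < rho by rewrite invf_gt1.
have [q1 qrho p1] : [/\ 1 < q, q < rho & p < 1] by rewrite /q /p; split; lra.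
have q0 : 0 < q := lt_trans ltr01 q1.
have rq : r * q = p by rewrite /q /p mulrA mulrDr mulfV ?gt_eqF// mulr1.
have rrho : r * rho = 1 by rewrite mulfV// gt_eqF.
have [K K0 hK] := ball_regular_bounded bF.1 p1.
have qV0 : 0 <= q^-1 by rewrite invr_ge0 ltW.
have qV1 : q^-1 < 1 by rewrite invf_lt1.
have K1 : 0 < 4 * K + 1 by rewrite ltr_wpDl// mulr_ge0.
have [N0 hN] := natmul_expr_small qV0 qV1 (divr_gt0 e0 K1).
(* The N-th roots of unity isolate the degree [k] only if [k < N]. *)
pose N := (N0 + k).+1.
have kN : (k < N)%N by rewrite ltnS leq_addl.
have [w wN] := prim_root_exists R (ltn0Sn (N0 + k)).
have wj j := cmod_prim_root wN j.
pose d := N.+1%:R * K * q^-1 ^+ N.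
have d0 : 0 <= d by rewrite !mulr_ge0// exprn_ge0.
have hd : 4 * d <= e.
  have := hN N (leq_trans (leq_addr k N0) (leqnSn _)).
  rewrite ltr_pdivlMr// => /ltW; apply: le_trans; rewrite /d.
  have -> : 4 * (N.+1%:R * K * q^-1 ^+ N) = N.+1%:R * q^-1 ^+ N * (4 * K) by ring.
  by rewrite ler_wpM2l ?lerDl// mulr_ge0// exprn_ge0.
have N0' : (N%:R : C) != 0 by rewrite pnatr_eq0.
pose G2 z := N%:R^-1 * \sum_(j < N) (N%:R^-1 * \sum_(i < N) G (rot zeta (w ^+ j) (w ^+ i) z)).
have nGij (j i : nat) := cmean_rot zeta1 n_gt0 (wj j) (wj i) nG.
have [nG2 eG2] : cnice G2 /\ cmean G2 = cmean G.
  have h1 (j : 'I_N) : cnice (fun z => N%:R^-1 * \sum_(i < N) G (rot zeta (w ^+ j) (w ^+ i) z)) /\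
      cmean (fun z => N%:R^-1 * \sum_(i < N) G (rot zeta (w ^+ j) (w ^+ i) z)) = cmean G.
    have [s1 s2] := cmean_sum (index_enum 'I_N) (fun i : 'I_N => (nGij j i).1).
    split; first by apply: cniceM => //; exact: cnice_cst.
    rewrite cmeanZ// s2; under eq_bigr do rewrite (nGij _ _).2.
    by rewrite sumr_const card_ord -[X in _ * X]mulr_natl mulrA mulVf// mul1r.
  have [s1 s2] := cmean_sum (index_enum 'I_N) (fun j : 'I_N => (h1 j).1).
  split; first by apply: cniceM => //; exact: cnice_cst.
  rewrite cmeanZ// s2; under eq_bigr do rewrite (h1 _).2.
  by rewrite sumr_const card_ord -[X in _ * X]mulr_natl mulrA mulVf// mul1r.
rewrite -eG2.
have nGH : cnice (fun z => G2 z - H z).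
  have := cniceD nG2 (cniceM (cnice_cst n (-1 : C)) nH); congr cnice.
  by apply/funext => z; rewrite mulN1r.
have -> : cmean G2 - cmean H = cmean (fun z => G2 z - H z).
  rewrite -[- cmean H]mulN1r -cmeanZ// -cmeanD//; last by apply: cniceM => //; exact: cnice_cst.
  by apply: eq_cmean => z _; rewrite mulN1r.
(* One [d] for each of the two averages, doubled by [cmean_le]. *)
apply: (@le_trans _ _ (2 * (2 * d))); last by rewrite mulrA; lra.
apply: cmean_le => // z z1; set l := cip z zeta.
have l1 : cmod l <= 1 by rewrite -z1; exact: cip_le_cvnorm.
pose Fxy x y : C := F (r%:C%C *: rot zeta x y z).
have inball x y (m : R) : cmod x <= m -> cmod y <= m -> cvnorm (r%:C%C *: rot zeta x y z) <= r * m.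
  move=> xm ym; rewrite cvnormZ cmod_real gtr0_norm// ler_wpM2l ?(ltW r0)//.
  by have := cvnorm_rot_le zeta1 z xm ym; rewrite z1 mulr1.
have any x y : cmod x <= 1 -> cmod y < rho -> analytic1 (Fxy x) y.
  move=> x1 y1.
  have : analytic1 (fun s => F (r%:C%C *: ((x * l) *: zeta) + s *: (r%:C%C *: (z - l *: zeta)))) y.
    apply: ball_regular_line; first exact: bF.1.
    have := inball x y (Num.max 1 (cmod y)); rewrite !le_max x1 lexx orbT => /(_ isT isT).
    rewrite /rot scalerDr !scalerA [y * _]mulrC => /le_lt_trans; apply.
    by rewrite maxr_pMr ?(ltW r0)// mulr1 gt_max r1/= -rrho ltr_pM2l.
  apply: analytic1_ext => s; rewrite /Fxy; congr F.
  rewrite [RHS]scalerDr; congr (_ + _); rewrite !scalerA; congr (_ *: _); exact: mulrC.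
have bdy x y : cmod x <= 1 -> cmod y <= q -> cmod (Fxy x y) <= K.
  move=> x1 yq; apply: hK; rewrite -rq; apply: inball => //.
  by rewrite (le_trans x1)// ltW.
(* Averaging over [y] gives the coefficient of degree 0 in [y], that is the value at [y = 0], which
   removes the component orthogonal to [zeta]. *)
have inner (j : nat) : cmod (N%:R^-1 * (\sum_(i < N) Fxy (w ^+ j) (w ^+ i)) - Fxy (w ^+ j) 0) <= d.
  have xj : cmod (w ^+ j) <= 1 by rewrite wj.
  have rho0 : cmod (0 : C) < rho by rewrite cmod0 (lt_trans ltr01).
  have [b [s [L [s0 hb]]]] := any _ _ xj rho0.
  have := taylor_coef_avg q0 qrho (fun y => any _ y xj) (fun y => bdy _ y xj) s0 hb wN (ltn0Sn _) (ltW q1).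
  rewrite (expansion0 s0 hb); under eq_bigr do rewrite expr0 invr1 mul1r.
  by [].
pose v := (r%:C%C * l) *: zeta.
have h2E x : Fxy x 0 = F (0 + x *: v).
  by rewrite /Fxy /rot scale0r addr0 add0r /v !scalerA mulrCA.
have [s s0 hs] := homog_expansion v t_gt0 M_ge0 hc.
have any2 x : cmod x < rho -> analytic1 (fun x => F (0 + x *: v)) x.
  move=> xr; apply: ball_regular_line; first exact: bF.1.
  rewrite /unit_ball/= add0r !cvnormZ zeta1 mulr1 cmodM cmod_real gtr0_norm//.
  apply: (@le_lt_trans _ _ (cmod x * r)).
    by rewrite ler_wpM2l ?cmod_ge0// ler_piMr// ltW.
  by rewrite -rrho mulrC ltr_pM2l.
have bd2 x : cmod x <= q -> cmod (F (0 + x *: v)) <= K.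
  move=> xq; apply: hK; rewrite add0r !cvnormZ zeta1 mulr1 cmodM cmod_real gtr0_norm//.
  apply: (@le_trans _ _ (cmod x * r)).
    by rewrite ler_wpM2l ?cmod_ge0// ler_piMr// ltW.
  by rewrite -rq mulrC ler_wpM2l// ltW.
(* On the line of [zeta], the weighted average over [x] extracts the degree [k]. *)
have outer := taylor_coef_avg q0 qrho any2 bd2 s0 hs wN kN (ltW q1).
have GE (j i : nat) : G (rot zeta (w ^+ j) (w ^+ i) z) =
    ((l ^+ k)^*)%C * ((w ^+ j) ^- k * Fxy (w ^+ j) (w ^+ i)).
  rewrite /G (cip_rot zeta1) -/l exprMn rmorphM/= /Fxy.
  have -> : (((w ^+ j) ^+ k)^*)%C = (w ^+ j) ^- k.
    have w0 : (w ^+ j) ^+ k != 0.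
      by rewrite -cmod_eq0 cmodX wj expr1n oner_eq0.
    by apply: (mulfI w0); rewrite mulfV// -sqr_cmodC cmodX wj !expr1n.
  by rewrite mulrC -mulrA mulrCA.
have G2E : G2 z = ((l ^+ k)^*)%C * (N%:R^-1 * \sum_(j < N) (w ^+ j) ^- k *
    (N%:R^-1 * \sum_(i < N) Fxy (w ^+ j) (w ^+ i))).
  rewrite /G2 mulrCA; congr (_ * _); rewrite mulr_sumr; apply: eq_bigr => j _.
  under eq_bigr do rewrite GE.
  rewrite -mulr_sumr -mulr_sumr; ring.
have HE : H z = ((l ^+ k)^*)%C * homog_part c k v.
  rewrite /H -/l /v homog_partZ exprMn.
  have -> : (cmod l ^+ (2 * k))%:C%C = (l ^+ k) * ((l ^+ k)^*)%C.
    by rewrite -sqr_cmodC cmodX mulnC exprM.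
  ring.
rewrite G2E HE -mulrBr cmodM cmodJ cmodX.
apply: (@le_trans _ _ (1 * (2 * d))); last by rewrite mul1r.
apply: ler_pM; rewrite ?cmod_ge0 ?exprn_ge0 ?cmod_ge0 ?exprn_ile1 ?cmod_ge0//.
set S1 := N%:R^-1 * _.
pose S2 := N%:R^-1 * \sum_(j < N) (w ^+ j) ^- k * F (0 + w ^+ j *: v).
have -> : S1 - homog_part c k v = (S1 - S2) + (S2 - homog_part c k v) by rewrite addrA subrK.
apply: (le_trans (cmodD _ _)); rewrite mulr_natl mulr2n lerD//.
rewrite /S1 /S2 -mulrBr -sumrB cmodM cmodV -[N%:R](rmorph_nat (real_complex R)) cmod_real ger0_norm//.
rewrite mulrC ler_pdivrMr ?ltr0n//.
apply: (le_trans (cmod_sum _ _ _)).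
have -> : d * N%:R = \sum_(j < N) d by rewrite sumr_const card_ord mulr_natr.
apply: ler_sum => j _.
rewrite -h2E -mulrBr cmodM cmodV cmodX wj expr1n invr1 mul1r rmorph_nat.
exact: inner.
Qed.

End coefficient_formula.

Section cip_powers.
Variables (R : realType) (n : nat).
Hypothesis n_gt0 : (0 < n)%N.
Local Notation C := R[i].
Implicit Types (F : fct R n) (z w zeta : Cn R n).

Definition cip_pow zeta k : fct R n := ball_restr (fun z => cip z zeta ^+ k).

Lemma cip_pow_in zeta k z : unit_ball z -> cip_pow zeta k z = cip z zeta ^+ k.
Proof. exact: ball_restrE. Qed.

Lemma mulop_cip_pow zeta k :
  mulop (fun z => cip z zeta) (cip_pow zeta k) = cip_pow zeta k.+1.
Proof.
apply/funext => z; rewrite /mulop /cip_pow /ball_restr; case: ifP => _.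
  by rewrite exprS.
by rewrite mulr0.
Qed.

Lemma H2_cip_pow zeta k : cvnorm zeta <= 1 -> H2 (cip_pow zeta k).
Proof.
move=> zeta1; apply: (hardy_H2 n_gt0); first exact: analytic_ball_cipX.
split; first by apply: ball_fun_restr; apply: ball_regularX; exact: ball_regular_cip.
exists 1 => r /andP[r0 r1]; rewrite -[leRHS](mean_cst n_gt0); apply: (le_mean n_gt0).
- apply: nice_cmod_sq; last by rewrite r0.
  by apply: ball_fun_restr; apply: ball_regularX; exact: ball_regular_cip.
- exact: nice_cst.
move=> z z1; have rz : cvnorm (r%:C%C *: z) = r.
  by rewrite cvnormZ z1 mulr1 cmod_real gtr0_norm.
rewrite cip_pow_in; last by rewrite /unit_ball/= rz.
rewrite exprn_ile1// ?cmod_ge0// cmodX exprn_ile1// ?cmod_ge0//.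
apply: le_trans (cip_CS _ _) _; rewrite rz.
by apply: mulr_ile1 => //; [exact: ltW|exact: cvnorm_ge0|exact: ltW].
Qed.

Lemma radius_cvg : (@radius R) @ \oo --> (1 : R).
Proof.
rewrite -[X in _ --> X]subr0; apply: cvgB; first exact: cvg_cst.
have := @cvg_harmonic R; rewrite -(cvg_shiftS _).
by rewrite /harmonic /=.
Qed.

(** At radius [r] the pairing is [r^(2k)] times the claimed value: one [r^k] comes from
    [pairing_cipX], where only [F] is dilated, the other from dilating the power. Then [r] tends to
    1. *)
Lemma hdot_cip_pow F zeta c (t M : R) k : cvnorm zeta = 1 -> hardy_fun F ->
  0 < t -> 0 <= M ->
  (forall w, cvnorm w <= t -> forall N,
    cmod (F w - \sum_(k < N) homog_part c k w) <= M * (cvnorm w / t) ^+ N) ->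
  hdot F (cip_pow zeta k) = homog_part c k zeta * (cip_moment zeta k)%:C%C.
Proof.
move=> zeta1 hF t0 M0 hc.
have hP : hardy_fun (cip_pow zeta k) by apply: H2_hardy => //; apply: H2_cip_pow; rewrite zeta1.
apply: ccvg_unique (pairing_cvg n_gt0 hF hP) _.
have hc' w : cvnorm w <= t -> forall N,
    cmod (F (0 + w) - \sum_(k < N) homog_part c k w) <= M * (cvnorm w / t) ^+ N.
  by rewrite add0r; exact: hc.
set a := homog_part c k zeta * _.
have E m : pairing F (cip_pow zeta k) (radius R m) = (radius R m ^+ (2 * k))%:C%C * a.
  have r01 := radius_in R m; have /andP[r0 r1] := r01.
  have := pairing_cipX n_gt0 zeta1 hF.1 t0 M0 hc' k r01.
  set r := radius R m in r0 r1 *; rewrite /pairing => h.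
  have -> : (r ^+ (2 * k))%:C%C * a = r%:C%C ^+ k * (r%:C%C ^+ k * homog_part c k zeta * (cip_moment zeta k)%:C%C).
    by rewrite mulnC exprM expr2 rmorphM/= rmorphXn/= /a !mulrA.
  rewrite -h -cmeanZ//.
    apply: eq_cmean => z z1.
    have rz : unit_ball (r%:C%C *: z).
      by rewrite /unit_ball/= cvnormZ z1 mulr1 cmod_real gtr0_norm.
    have rJ : ((r%:C%C ^+ k : C)^*)%C = r%:C%C ^+ k by rewrite rmorphXn; congr (_ ^+ _); exact: conjc_real.
    by rewrite cip_pow_in// cipZl exprMn rmorphM/= rJ mulrCA.
  apply: cniceM; first exact: cnice_dilation hF.1 r01.
  by apply: cniceJ; apply: cniceX; exact: cnice_cip.
have -> : (fun m => pairing F (cip_pow zeta k) (radius R m)) = fun m => (radius R m ^+ (2 * k))%:C%C * a by apply/funext.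
have rk : (fun m => radius R m ^+ (2 * k)) @ \oo --> (1 : R).
  rewrite -[X in _ --> X](expr1n R (2 * k)).
  exact: (continuous_cvg _ (@exprn_continuous R (2 * k) 1) radius_cvg).
split; [rewrite -[X in _ --> X]mul1r|rewrite -[X in _ --> X]mul1r].
  under eq_fun do rewrite ReM /= mul0r subr0; exact: cvgMl.
under eq_fun do rewrite ImM /= mul0r addr0; exact: cvgMl.
Qed.

(** On the cap of radius [e] around [zeta] the linear form has modulus at least [1 - e], and the
    mass of the cap does not depend on [k]. *)
Lemma cip_moment_ge zeta k e : cvnorm zeta = 1 -> 0 < e -> e <= 1 ->
  (1 - e) ^+ (2 * k) * cap_mass n e <= cip_moment zeta k.
Proof.
move=> zeta1 e0 e1; have h0 : 0 <= 1 - e by rewrite subr_ge0.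
apply: (@mean_ge_cap R n n_gt0 _ zeta) => //.
- exact: (cnice_cmod_cip zeta k).1.
- by move=> w _; rewrite exprn_ge0// cmod_ge0.
- by rewrite exprn_ge0.
move=> w w1 wz; rewrite lerXn2r ?nnegrE ?cmod_ge0//.
have -> : cip w zeta = 1 + cip (w - zeta) zeta.
  by rewrite cipBl cip_sqr zeta1 expr1n addrC subrK.
have := cmod_distB 1 (- cip (w - zeta) zeta); rewrite opprK cmodN cmod1.
have := cip_CS (w - zeta) zeta; rewrite zeta1 mulr1; lra.
Qed.

End cip_powers.

(** * Contractivity of the adjoints *)

Section compact_families.
Context (R : realType) (E : lmodType R[i]) (D : set E)
  (dot : E -> E -> R[i]) (nrm : E -> R).
Hypothesis ip : inner_space D dot nrm.
Local Notation C := R[i].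

Lemma nrm_comb_dist (I : finType) (x y : I -> C) (a : I -> E) : (forall p, D (a p)) ->
  `|nrm (\sum_p x p *: a p) - nrm (\sum_p y p *: a p)| <=
  \sum_p cmod (x p - y p) * nrm (a p).
Proof.
move=> Da; have Ds (z : I -> C) : D (\sum_p z p *: a p).
  by apply: (in_sum ip) => p _; exact: (in_Z ip).
apply: le_trans (nrm_dist ip (Ds x) (Ds y)) _.
rewrite -sumrB; under eq_bigr do rewrite -scalerBl.
apply: le_trans (nrm_sum ip _ _) _ => [p _|]; first exact: (in_Z ip).
by apply: ler_sum => p _; rewrite (nrmZ ip).
Qed.

Lemma comb_attains_max d (y : 'I_d -> E) : (0 < d)%N -> (forall j, D (y j)) ->
  exists2 c : Cn R d, cvnorm c = 1 & forall c' : Cn R d, cvnorm c' = 1 ->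
    nrm (\sum_j c' ord0 j *: y j) <= nrm (\sum_j c ord0 j *: y j).
Proof.
move=> d0 Dy; have [e1 e1n] := unit_vector_exists R d0.
apply: (@cont_attains_max R d [set c | cvnorm c = 1]
  (fun c => nrm (\sum_j c ord0 j *: y j)) 1).
- by exists e1.
- by move=> z /= ->.
- move=> z hz /=; apply/eqP; apply/negP => /negP z1.
  have e0 : 0 < `|cvnorm z - 1| by rewrite normr_gt0 subr_eq0.
  have [w /= w1 wz] := hz _ e0; move: wz; rewrite ltNge => /negP; apply.
  rewrite ler_norml; have := cvnorm_distB z w; have := cvnorm_distB w z.
  by rewrite (cvnormB z w) w1; move=> h1 h2; apply/andP; split; lra.
move=> z _ e e0; pose S := \sum_j nrm (y j).
have S0 : 0 <= S by rewrite sumr_ge0// => j _; exact: (nrm_ge0 ip).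
have S1 : 0 < S + 1 by rewrite ltr_wpDl.
exists (e / (S + 1)); first by rewrite divr_gt0.
move=> w _ wz.
apply: le_lt_trans (nrm_comb_dist (fun j => w ord0 j) (fun j => z ord0 j) Dy) _.
apply: (@le_lt_trans _ _ (cvnorm (w - z) * (S + 1))); last by rewrite -ltr_pdivlMr.
rewrite (@le_trans _ _ (cvnorm (w - z) * S))//; last by rewrite ler_wpM2l ?cvnorm_ge0// lerDl.
rewrite mulr_sumr; apply: ler_sum => j _; rewrite ler_wpM2r ?(nrm_ge0 ip)//.
by have := coord_le_cvnorm (w - z) j; rewrite !mxE.
Qed.

(* The unit spheres being compact, strict pointwise contraction is uniform. *)
Lemma uniform_contraction n d (a : 'I_n -> 'I_d -> E) : (forall i j, D (a i j)) ->
  (forall (z : Cn R n) (c : Cn R d), cvnorm z = 1 -> cvnorm c = 1 ->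
    nrm (\sum_(p : 'I_n * 'I_d) (z ord0 p.1 * c ord0 p.2) *: a p.1 p.2) < 1) ->
  exists q, 0 <= q < 1 /\ forall (z : Cn R n) (c : Cn R d), cvnorm z = 1 ->
    nrm (\sum_(p : 'I_n * 'I_d) (z ord0 p.1 * c ord0 p.2) *: a p.1 p.2) <= q * cvnorm c.
Proof.
move=> Da hB; pose B (z : Cn R n) (c : Cn R d) :=
  \sum_(p : 'I_n * 'I_d) (z ord0 p.1 * c ord0 p.2) *: a p.1 p.2.
have unit (q : R) : (forall z c, cvnorm z = 1 -> cvnorm c = 1 -> nrm (B z c) <= q) ->
    forall z c, cvnorm z = 1 -> nrm (B z c) <= q * cvnorm c.
  move=> hq z c z1; have [->|c0] := eqVneq c 0.
    rewrite cvnorm0 mulr0 /B big1 ?(nrm0 ip)// => p _.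
    by rewrite mxE mulr0 scale0r.
  have C0 : 0 < cvnorm c by rewrite cvnorm_gt0.
  have c1 : cvnorm ((cvnorm c)^-1%:C%C *: c) = 1.
    by rewrite cvnormZ cmod_real gtr0_norm ?invr_gt0// mulVf// gt_eqF.
  have -> : B z c = (cvnorm c)%:C%C *: B z ((cvnorm c)^-1%:C%C *: c).
    rewrite /B scaler_sumr; apply: eq_bigr => p _; rewrite scalerA mxE; congr (_ *: _).
    move: (z ord0 p.1) (c ord0 p.2) => x y.
    by rewrite mulrCA (mulrA (cvnorm c)%:C%C) -rmorphM/= mulfV ?gt_eqF// mul1r.
  rewrite (nrmZ ip); last by apply: (in_sum ip) => p _; exact: (in_Z ip).
  by rewrite cmod_real gtr0_norm// mulrC ler_wpM2r ?cvnorm_ge0//; exact: hq.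
have sqr (v : Cn R (n + d)) : cvnorm v ^+ 2 = cvnorm (lsubmx v) ^+ 2 + cvnorm (rsubmx v) ^+ 2.
  by rewrite !sqr_cvnorm big_split_ord/=; congr (_ + _); apply: eq_bigr => i _; rewrite mxE.
have lle (v : Cn R (n + d)) : cvnorm (lsubmx v) <= cvnorm v.
  by rewrite -(@ler_pXn2r _ 2) ?nnegrE ?cvnorm_ge0// sqr lerDl sqr_ge0.
have rle (v : Cn R (n + d)) : cvnorm (rsubmx v) <= cvnorm v.
  by rewrite -(@ler_pXn2r _ 2) ?nnegrE ?cvnorm_ge0// sqr lerDr sqr_ge0.
(* Pairs of unit vectors are packed into single vectors of C^(n + d), so that [cont_attains_max]
   applies. *)
pose K : set (Cn R (n + d)) := [set v | cvnorm (lsubmx v) = 1 /\ cvnorm (rsubmx v) = 1].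
(* When one of the unit spheres is empty, as for [d = 0], the constant 0 works. *)
have [K0|/set0P K0] := eqVneq K set0.
  exists 0; rewrite lexx ltr01; split => //; apply: unit => z c z1 c1.
  suff : K (row_mx z c) by rewrite K0.
  by rewrite /K /= row_mxKl row_mxKr.
pose u v := nrm (B (lsubmx v) (rsubmx v)).
have [|||v [v1 v2] vmax] := @cont_attains_max R (n + d) K u 2 K0.
- move=> v [v1 v2]; rewrite -(@ler_pXn2r _ 2) ?nnegrE ?cvnorm_ge0// sqr v1 v2; lra.
- have cl m (f : Cn R (n + d) -> Cn R m) v : (forall x y, f (x - y) = f x - f y) ->
      (forall x, cvnorm (f x) <= cvnorm x) ->
      (forall e, 0 < e -> exists2 w, cvnorm (f w) = 1 & cvnorm (w - v) < e) -> cvnorm (f v) = 1.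
    move=> fB fle hv; apply/eqP; apply/negP => /negP v1.
    have e0 : 0 < `|cvnorm (f v) - 1| by rewrite normr_gt0 subr_eq0.
    have [w w1 wv] := hv _ e0; move: wv; rewrite ltNge => /negP; apply.
    apply: le_trans (fle _); rewrite fB ler_norml.
    have := cvnorm_distB (f v) (f w); have := cvnorm_distB (f w) (f v).
    by rewrite (cvnormB (f v) (f w)) w1; move=> h1 h2; apply/andP; split; lra.
  move=> v hv; split; apply: (cl _ _ v) => //;
    try (by move=> e /hv[w [w1 w2] wv]; exists w);
    by move=> x y; apply/rowP => i; rewrite !mxE.
- move=> v [v1 v2] e e0; pose S := \sum_(p : 'I_n * 'I_d) nrm (a p.1 p.2).
  have S0 : 0 <= S by rewrite sumr_ge0// => j _; exact: (nrm_ge0 ip).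
  have S1 : 0 < 2 * S + 1 by rewrite ltr_wpDl// mulr_ge0.
  exists (e / (2 * S + 1)); first by rewrite divr_gt0.
  move=> w [w1 w2] wv; rewrite /u /B.
  apply: le_lt_trans (nrm_comb_dist _ _ (fun p => Da p.1 p.2)) _.
  apply: (@le_lt_trans _ _ (cvnorm (w - v) * (2 * S + 1))); last by rewrite -ltr_pdivlMr.
  rewrite (@le_trans _ _ (cvnorm (w - v) * (2 * S)))//; last by rewrite ler_wpM2l ?cvnorm_ge0// lerDl.
  rewrite mulrA mulr_sumr; apply: ler_sum => p _; rewrite ler_wpM2r ?(nrm_ge0 ip)//.
  set x := lsubmx w ord0 _; set y := rsubmx w ord0 _.
  set x' := lsubmx v ord0 _; set y' := rsubmx v ord0 _.
  have -> : x * y - x' * y' = x * (y - y') + (x - x') * y' by rewrite mulrBr mulrBl addrA subrK.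
  apply: le_trans (cmodD _ _) _; rewrite !cmodM mulr_natr mulr2n lerD//.
    rewrite -[leRHS]mul1r ler_pM ?cmod_ge0//.
      by rewrite -w1; exact: coord_le_cvnorm.
    by have := coord_le_cvnorm (w - v) (rshift n p.2); rewrite /y /y' !mxE.
  rewrite -[leRHS]mulr1 ler_pM ?cmod_ge0//.
    by have := coord_le_cvnorm (w - v) (lshift d p.1); rewrite /x /x' !mxE.
  by rewrite -v2; exact: coord_le_cvnorm.
exists (u v); rewrite (nrm_ge0 ip) hB//; split=> //; apply: unit => z c z1 c1.
by have := vmax (row_mx z c); rewrite /u /K /= row_mxKl row_mxKr; apply.
Qed.

(** The form [<., z>] has the conjugates of [z] as coefficients, so its adjoint is linear in [z].
    The right-hand vector is thus bilinear in [(z, c)], the shape treated by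
    [uniform_contraction]. *)
Lemma dot_adjoint_comb n d (z : 'I_n -> C) (c : 'I_d -> C) (T : 'I_n -> E) (h : E)
    (b : 'I_d -> E) (a : 'I_n -> 'I_d -> E) :
  D h -> (forall i, D (T i)) -> (forall j, D (b j)) -> (forall i j, D (a i j)) ->
  (forall i j, dot (T i) (b j) = dot h (a i j)) ->
  dot (\sum_i ((z i)^*)%C *: T i) (\sum_j c j *: b j) =
  dot h (\sum_(p : 'I_n * 'I_d) (z p.1 * c p.2) *: a p.1 p.2).
Proof.
move=> Dh DT Db Da ha.
have DZ := in_Z ip.
have Ds : D (\sum_j c j *: b j) by apply: (in_sum ip) => j _; exact: DZ.
rewrite (dot_suml ip)// => [|i _]; last exact: DZ.
rewrite (dot_sumr ip)// => [|p _]; last exact: DZ.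
rewrite -(pair_bigA _ (fun i j => dot h ((z i * c j) *: a i j)))/=; apply: eq_bigr => i _.
rewrite (dotZl ip)// (dot_sumr ip)// => [|j _]; last exact: DZ.
rewrite mulr_sumr; apply: eq_bigr => j _.
by rewrite (dotZr ip)// (dotZr ip)// ha rmorphM mulrA.
Qed.

End compact_families.

(** * Multiplication by linear forms of norm 1 *)

Section linear_multipliers.
Variables (R : realType) (n : nat).
Hypothesis n_gt1 : (1 < n)%N.
Local Notation C := R[i].
Implicit Types (F : fct R n) (z w zeta eta : Cn R n).

Let n_gt0 : (0 < n)%N.
Proof. exact: ltnW. Qed.

Definition cipf zeta : fct R n := fun z => cip z zeta.

(** Otherwise every basis vector would be a multiple of [zeta], impossible for two distinct ones.
    Both uses of [n > 1], the strict contraction and the small discs, go through this lemma. *)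
Lemma orthogonal_unit_exists zeta : cvnorm zeta = 1 ->
  exists2 eta : Cn R n, cvnorm eta = 1 & cip eta zeta = 0.
Proof.
move=> zeta1; have cz : cip zeta zeta = 1 by rewrite cip_sqr zeta1 expr1n.
pose e i : Cn R n := delta_mx ord0 i.
pose u i := e i - cip (e i) zeta *: zeta.
have uz i : cip (u i) zeta = 0 by rewrite cipBl cipZl cz mulr1 subrr.
suff [i ui] : exists i, u i != 0.
  have U0 : 0 < cvnorm (u i) by rewrite cvnorm_gt0.
  exists ((cvnorm (u i))^-1%:C%C *: u i).
    by rewrite cvnormZ cmod_real gtr0_norm ?invr_gt0// mulVf// gt_eqF.
  by rewrite cipZl uz mulr0.
apply: contrapT => h.
have u0 i : e i = cip (e i) zeta *: zeta.
  by apply/eqP; rewrite -subr_eq0; apply: contrapT => /negP ui; apply: h; exists i.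
pose i0 := Ordinal n_gt0; pose i1 := Ordinal n_gt1.
have h00 := congr1 (fun v : Cn R n => v ord0 i0) (u0 i0).
have h01 := congr1 (fun v : Cn R n => v ord0 i1) (u0 i0).
have h11 := congr1 (fun v : Cn R n => v ord0 i1) (u0 i1).
move: h00 h01 h11; rewrite !mxE !eqxx /= => h00 h01 h11.
have /eqP := esym h01; rewrite mulf_eq0 => /orP[/eqP a0|/eqP b0].
  by move: h00; rewrite a0 mul0r => /eqP; rewrite oner_eq0.
by move: h11; rewrite b0 mulr0 => /eqP; rewrite oner_eq0.
Qed.

Lemma hardy_cipf zeta F : cvnorm zeta = 1 -> hardy_fun F -> hardy_fun (mulop (cipf zeta) F).
Proof.
move=> zeta1 hF; have [] // := hardy_fun_mulop n_gt0 (ball_regular_cip zeta) hF ler01.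
move=> z z1; apply: (le_trans (cip_CS _ _)); rewrite zeta1 mulr1; exact: ltW.
Qed.

Lemma bessel2 zeta eta z : cvnorm zeta = 1 -> cvnorm eta = 1 -> cip eta zeta = 0 ->
  cmod (cip z zeta) ^+ 2 + cmod (cip z eta) ^+ 2 <= cvnorm z ^+ 2.
Proof.
move=> zeta1 eta1 ez; rewrite (bessel zeta1 z) lerD2l.
have -> : cip z eta = cip (z - cip z zeta *: zeta) eta.
  by rewrite cipBl cipZl -(cipJ eta zeta) ez conjc0 mulr0 subr0.
rewrite lerXn2r ?nnegrE ?cmod_ge0 ?cvnorm_ge0//.
by apply: (le_trans (cip_CS _ _)); rewrite eta1 mulr1.
Qed.

Lemma hnorm_cipf2 zeta eta F : cvnorm zeta = 1 -> cvnorm eta = 1 -> cip eta zeta = 0 ->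
  hardy_fun F ->
  hnorm (mulop (cipf zeta) F) ^+ 2 + hnorm (mulop (cipf eta) F) ^+ 2 <= hnorm F ^+ 2.
Proof.
move=> zeta1 eta1 ez hF.
have h1 := hardy_cipf zeta1 hF; have h2 := hardy_cipf eta1 hF.
(* [le_limit] transfers lower bounds, hence the change of sign. *)
rewrite -lerN2; apply: (le_limit (cvgN (cvgD (hnorm_sqr_cvg n_gt0 h1) (hnorm_sqr_cvg n_gt0 h2)))) => k.
rewrite lerN2.
have r01 := radius_in R k; have /andP[r0 r1] := r01.
apply: le_trans (mean_sq_le_hnorm n_gt0 hF r01).
have N1 := nice_cmod_sq h1.1 r01; have N2 := nice_cmod_sq h2.1 r01.
rewrite fctE /mean_sq -(meanD n_gt0 N1 N2); apply: (le_mean n_gt0).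
- exact: niceD.
- exact: nice_cmod_sq hF.1 r01.
move=> z z1 /=; set x := radius R k in r0 r1 *.
have rz : cvnorm (x%:C%C *: z) <= 1.
  by rewrite cvnormZ z1 mulr1 cmod_real gtr0_norm// ltW.
rewrite /mulop /cipf !cmodM !exprMn -mulrDl ler_piMl ?sqr_ge0//.
apply: le_trans (bessel2 _ zeta1 eta1 ez) _.
by rewrite exprn_ile1// cvnorm_ge0.
Qed.

(** An orthogonal direction [eta] carries a positive part of the norm: the product of [F] and
    [<., eta>] is not identically 0, because a point where [F] is nonzero can be moved slightly
    along [eta], off the hyperplane orthogonal to [eta]. *)
Lemma hnorm_cipf_lt zeta F : cvnorm zeta = 1 -> hardy_fun F -> F <> 0 ->
  hnorm (mulop (cipf zeta) F) < hnorm F.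
Proof.
move=> zeta1 hF F0; have [eta eta1 ez] := orthogonal_unit_exists zeta1.
have h2 := hardy_cipf eta1 hF.
have := hnorm_cipf2 zeta1 eta1 ez hF.
have E0 : 0 < hnorm (mulop (cipf eta) F).
  rewrite lt_neqAle sqrtr_ge0 andbT eq_sym; apply/eqP => /(hnorm_eq0 n_gt0 h2) h0.
  apply: F0; apply/funext => z; apply: contrapT => Fz.
  have bF := hF.1.
  have z1 : unit_ball z by apply: contrapT => /bF.2.
  have Fz0 : 0 < cmod (F z) by rewrite cmod_gt0; apply/eqP.
  have [d d0 hd] := bF.1.1 z z1 _ Fz0.
  have [t [t0 ct]] : exists t, cmod t < d /\ cip (z + t *: eta) eta != 0.
    have [c0|c0] := eqVneq (cip z eta) 0; last first.
      by exists 0; rewrite cmod0 scale0r addr0.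
    exists (d / 2)%:C%C; rewrite cmod_real gtr0_norm ?divr_gt0//; split; first lra.
    rewrite cipDl c0 add0r cipZl cip_sqr eta1 expr1n mulr1 -cmod_eq0 cmod_real.
    by rewrite normr_eq0 gt_eqF// divr_gt0.
  have : F (z + t *: eta) = 0.
    have /eqP := congr1 (fun G : fct R n => G (z + t *: eta)) h0.
    by rewrite /mulop /cipf mulf_eq0 (negbTE ct) => /eqP.
  have := hd (z + t *: eta); rewrite addrAC subrr add0r cvnormZ eta1 mulr1 => /(_ t0).
  by move=> h F0'; move: h; rewrite F0' sub0r cmodN ltxx.
move: (hnorm (mulop (cipf eta) F)) (hnorm (mulop (cipf zeta) F)) (hnorm F) E0
  (sqrtr_ge0 _ : 0 <= hnorm F) (sqrtr_ge0 _ : 0 <= hnorm (mulop (cipf zeta) F)) => a b c.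
move=> a0 c0 b0 h; rewrite -(@ltr_pXn2r _ 2) ?nnegrE//.
by apply: lt_le_trans h; rewrite ltrDl exprn_gt0.
Qed.

End linear_multipliers.

(** * Uniform contraction on Q and geometric decay of homogeneous parts *)

Section quotient_regularity.
Variables (R : realType) (n : nat) (Q : set (fct R n)).
Hypothesis n_gt1 : (1 < n)%N.
Local Notation C := R[i].
Implicit Types (f g h : fct R n) (z w zeta : Cn R n).

Let n_gt0 : (0 < n)%N.
Proof. exact: ltnW. Qed.

Lemma quotient_hardy f : quotient_module Q -> Q f -> hardy_fun f.
Proof. by move=> [[QH _ _] _ _ _] /QH; exact: H2_hardy. Qed.

Lemma orthonormal_basis : quotient_module Q -> finite_dim Q ->
  exists (d : nat) (b : 'I_d -> fct R n),
    [/\ orthonormal (@hardy_fun R n) (@hdot R n) b, forall j, Q (b j) &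
    Q = [set \sum_(j < d) c j *: b j | c in [set: 'I_d -> C]]].
Proof.
move=> Qq [d [e Qe]].
have span m (b : 'I_m -> fct R n) j :
    [set \sum_(j < m) c j *: b j | c in [set: 'I_m -> C]] (b j).
  exists (fun i => (i == j)%:R) => //.
  by rewrite (bigD1 j)//= eqxx scale1r big1 ?addr0// => i /negbTE ->; rewrite scale0r.
have He j : hardy_fun (e j) by apply: (quotient_hardy Qq); rewrite Qe.
have [m [b [ob be]]] := gram_schmidt (hardy_inner R n_gt0) He.
have Qb : Q = [set \sum_(j < m) c j *: b j | c in [set: 'I_m -> C]] by rewrite Qe.
by exists m, b; split => // j; rewrite Qb.
Qed.

Lemma mulop_cipf_sum zeta h :
  mulop (cipf zeta) h = \sum_i ((zeta ord0 i)^*)%C *: mulop (coordf i) h.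
Proof.
apply/funext => z; rewrite fct_sumE /mulop /cipf /cip mulr_suml.
by apply: eq_bigr => i _; rewrite mulrAC mulrC.
Qed.

Lemma hardy_coord i h : hardy_fun h -> hardy_fun (mulop (coordf i) h).
Proof.
move=> hh; have [] // := hardy_fun_mulop n_gt0 (ball_regular_coord R i) hh ler01.
by move=> z z1; apply: le_trans (coord_le_cvnorm z i) _; exact: ltW.
Qed.

Lemma adjoint_contraction : quotient_module Q -> finite_dim Q ->
  exists q, 0 <= q < 1 /\ forall zeta f, cvnorm zeta = 1 -> Q f ->
    exists g, [/\ Q g, hnorm g <= q * hnorm f &
      forall h, H2 h -> hdot (mulop (cipf zeta) h) f = hdot h g].
Proof.
move=> Qq Qfd; have ip := hardy_inner R n_gt0.
have [d [b [ob Qbj Qb]]] := orthonormal_basis Qq Qfd.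
have Hb := ob.1.
have [[QH Q0 Qlin] _ _ Qad] := Qq.
have /choice[a ha] (p : 'I_n * 'I_d) : exists g, Q g /\ adjoint_at (mulop (coordf p.1)) (b p.2) g.
  by have [g Qg ag] := Qad p.1 _ (Qbj p.2); exists g.
pose a' i j := a (i, j).
have Ha i j : hardy_fun (a' i j) by apply: (quotient_hardy Qq); exact: (ha (i, j)).1.
pose comb (c : Cn R d) := \sum_j c ord0 j *: b j.
pose B zeta (c : Cn R d) := \sum_(p : 'I_n * 'I_d) (zeta ord0 p.1 * c ord0 p.2) *: a' p.1 p.2.
have Hcomb c : hardy_fun (comb c) by apply: (in_sum ip) => j _; exact: (in_Z ip).
have nrm_comb c : hnorm (comb c) = cvnorm c.
  apply/eqP; rewrite -(@eqrXn2 _ 2) ?cvnorm_ge0 ?(nrm_ge0 ip)//.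
  by rewrite (nrm_orthonormal_sum ip) // sqr_cvnorm.
have QB zeta c : Q (B zeta c).
  rewrite /B; apply: (big_ind Q) => [//|x y Qx Qy|p _].
    by rewrite -[x]scale1r; exact: Qlin.
  by rewrite -[_ *: _]addr0; apply: Qlin => //; exact: (ha (p.1, p.2)).1.
have adj zeta c h : H2 h -> hdot (mulop (cipf zeta) h) (comb c) = hdot h (B zeta c).
  move=> Hh; have hh := H2_hardy n_gt0 Hh.
  have hT i := hardy_coord i hh.
  have hadj i j : hdot (mulop (coordf i) h) (b j) = hdot h (a' i j).
    by have [_ [_ h2]] := ha (i, j); exact: h2.
  have := dot_adjoint_comb ip (fun i => zeta ord0 i) (fun j => c ord0 j) hh hT Hb Ha hadj.
  by rewrite -mulop_cipf_sum.
(* The adjoint inherits the strict bound: with [A] the adjoint of multiplication by the linear form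
   [l], and [|f| = 1], one has [|A f|^2 = <l A f, f> <= |l A f| < |A f|] unless [A f = 0]. *)
have lt1 zeta (c : Cn R d) : cvnorm zeta = 1 -> cvnorm c = 1 -> hnorm (B zeta c) < 1.
  move=> zeta1 c1; have HB : H2 (B zeta c) by exact: QH.
  have hB := H2_hardy n_gt0 HB.
  have [->|/eqP B0] := eqVneq (B zeta c) 0; first by rewrite (nrm0 ip).
  have h1 := adj zeta c _ HB; rewrite (hdot_sqr n_gt0 hB) in h1.
  have h2 := dot_CS ip (hardy_cipf n_gt1 zeta1 hB) (Hcomb c).
  have h3 := hnorm_cipf_lt n_gt1 zeta1 hB B0.
  move: h2; rewrite h1 nrm_comb c1 mulr1 cmod_real ger0_norm ?sqr_ge0//.
  move: h3; move: (hnorm _) (hnorm _) (nrm_ge0 ip (B zeta c)) => x y y0 xy h.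
  have {h xy} : y ^+ 2 < y by apply: le_lt_trans h xy.
  nra.
have [q [q01 hq]] := uniform_contraction ip Ha lt1.
exists q; split => // zeta f zeta1; rewrite {1}Qb => -[c0 _ <-].
pose c : Cn R d := \row_j c0 j.
have -> : \sum_j c0 j *: b j = comb c by apply: eq_bigr => j _; rewrite mxE.
exists (B zeta c); split; [exact: QB| |by move=> h; exact: adj].
by rewrite nrm_comb; exact: hq.
Qed.

Lemma homog_part_geometric f : quotient_module Q -> finite_dim Q -> Q f ->
  exists c (t M B q : R), [/\ 0 < t, 0 <= M, 0 <= B, 0 <= q < 1 &
    (forall w, cvnorm w <= t -> forall N,
      cmod (f w - \sum_(k < N) homog_part c k w) <= M * (cvnorm w / t) ^+ N) /\
    forall k w, cvnorm w <= 1 -> cmod (homog_part c k w) <= B * q ^+ k].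
Proof.
move=> Qq Qfd Qf; have [q [/andP[q0 q1] hq]] := adjoint_contraction Qq Qfd.
have ip := hardy_inner R n_gt0; have hf := quotient_hardy Qq Qf.
have H2f : H2 f by case: Qq => -[QH _ _] _ _ _; exact: QH.
have f0 : analytic_at f 0.
  by apply: H2f.1.1; rewrite /unit_ball/= cvnorm0.
have [c [t [M [t0 M0 hc]]]] := analytic_at_homog f0.
have {}hc w : cvnorm w <= t -> forall N,
    cmod (f w - \sum_(k < N) homog_part c k w) <= M * (cvnorm w / t) ^+ N.
  by move=> wt N; have := hc w wt N; rewrite add0r.
(* The constant 1 on the ball, which is the power of exponent 0 of every linear form; [L] is
   therefore independent of [zeta]. *)
pose one : fct R n := cip_pow 0 0.
have oneE zeta : cip_pow zeta 0 = one by [].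
pose L := hnorm one * hnorm f.
have L0 : 0 <= L by rewrite mulr_ge0 ?(nrm_ge0 ip).
(* Moving the linear form to the other side [k] times leaves the inner product of 1 with [A^k f];
   the induction has to let [f] vary in [Q]. *)
have bound zeta k : cvnorm zeta = 1 -> cmod (hdot (cip_pow zeta k) f) <= L * q ^+ k.
  move=> zeta1.
  have Hk j : H2 (cip_pow zeta j) by apply: H2_cip_pow => //; rewrite zeta1.
  rewrite /L -mulrA [hnorm f * _]mulrC; elim: k f Qf {hf H2f f0 hc L L0} => [|k ih] f Qf.
    rewrite expr0 mul1r -(oneE zeta); apply: (dot_CS ip).
      exact: H2_hardy (Hk 0).
    exact: quotient_hardy Qf.
  have [g [Qg gf adj]] := hq _ _ zeta1 Qf.
  rewrite -mulop_cip_pow adj//; apply: le_trans (ih _ Qg) _.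
  by rewrite exprS -mulrA ler_wpM2l ?(nrm_ge0 ip)// mulrCA ler_wpM2l ?exprn_ge0.
(* [s^2] lies strictly between [q] and 1. Caps with [1 - e = s] cost a factor [s^(2k)] in the
   moments, and the resulting ratio [q / s^2] is still less than 1. *)
pose s := Num.sqrt ((1 + q) / 2); pose e := 1 - s.
have h0 : 0 < (1 + q) / 2 by rewrite divr_gt0// ltr_wpDr.
have s2 : s ^+ 2 = (1 + q) / 2 by rewrite sqr_sqrtr// ltW.
have s0 : 0 < s by rewrite sqrtr_gt0.
have s1 : s < 1 by rewrite -(@ltr_pXn2r _ 2) ?nnegrE ?ltW// s2 expr1n; lra.
have e0 : 0 < e by rewrite subr_gt0.
have e1 : e <= 1 by rewrite /e; lra.
have es : 1 - e = s by rewrite /e; ring.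
pose m := cap_mass n e.
have m0 : 0 < m by exact: cap_mass_gt0.
pose q' := q / s ^+ 2.
have s20 : 0 < s ^+ 2 by rewrite exprn_gt0.
exists c, t, M, (L / m), q'; split => //.
- by rewrite divr_ge0// ltW.
- apply/andP; split; first by rewrite divr_ge0// ltW.
  by rewrite ltr_pdivrMr// mul1r s2; lra.
split=> // k w w1.
have unit zeta : cvnorm zeta = 1 -> cmod (homog_part c k zeta) <= L / m * q' ^+ k.
  move=> zeta1; have := bound zeta k zeta1.
  have hk : hardy_fun (cip_pow zeta k).
    by apply: H2_hardy => //; apply: H2_cip_pow => //; rewrite zeta1.
  rewrite -(hdotJ n_gt0 hf hk) cmodJ (hdot_cip_pow n_gt0 k zeta1 hf t0 M0 hc).
  have := cip_moment_ge n_gt0 k zeta1 e0 e1; rewrite es exprM -/m => hm.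
  have G0 : 0 < (s ^+ 2) ^+ k * m by rewrite mulr_gt0// exprn_gt0.
  rewrite cmodM cmod_real ger0_norm; last by apply: le_trans (ltW G0) hm.
  move=> hL.
  have : cmod (homog_part c k zeta) * ((s ^+ 2) ^+ k * m) <= L * q ^+ k.
    by apply: le_trans hL; rewrite ler_wpM2l ?cmod_ge0.
  rewrite -ler_pdivlMr// => h; apply: le_trans h _.
  have -> : q' ^+ k = q ^+ k / (s ^+ 2) ^+ k by rewrite -expr_div_n.
  rewrite invfM.
  by rewrite le_eqVlt; apply/orP; left; apply/eqP; ring.
have [->|w0] := eqVneq w 0.
  have [e1' e1n] := unit_vector_exists R n_gt0.
  rewrite -(scale0r e1') homog_partZ cmodM cmodX cmod0.
  apply: le_trans (unit _ e1n); rewrite ler_piMl ?cmod_ge0//.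
  by rewrite exprn_ile1.
have W0 : 0 < cvnorm w by rewrite cvnorm_gt0.
pose zeta := (cvnorm w)^-1%:C%C *: w.
have zeta1 : cvnorm zeta = 1.
  by rewrite cvnormZ cmod_real gtr0_norm ?invr_gt0// mulVf// gt_eqF.
have -> : w = (cvnorm w)%:C%C *: zeta.
  by rewrite scalerA -rmorphM mulfV ?gt_eqF// scale1r.
rewrite homog_partZ cmodM cmodX cmod_real gtr0_norm//.
apply: le_trans (unit _ zeta1); rewrite ler_piMl ?cmod_ge0//.
by rewrite exprn_ile1// ltW.
Qed.

End quotient_regularity.

(** * Boundary values *)

Definition closed_cont (R : realType) n (f : fct R n) : Prop :=
  forall z, cvnorm z <= 1 -> forall e, 0 < e -> exists2 d, 0 < d &
    forall w, cvnorm w <= 1 -> cvnorm (w - z) < d -> cmod (f w - f z) < e.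

Section continuous_extension.
Variables (R : realType) (n : nat).
Hypothesis n_gt1 : (1 < n)%N.
Local Notation C := R[i].
Implicit Types (f g : fct R n) (z w : Cn R n).

Let n_gt0 : (0 < n)%N.
Proof. exact: ltnW. Qed.

(** The supremum of the left ends [u N - t N] lies below every right end [u M + t M]. The error [t]
    is kept explicit because it will be uniform on the closed ball. *)
Lemma nested_limit (u : nat -> R) (t : nat -> R) :
  (forall N j, `|u (N + j)%N - u N| <= t N) -> exists l, forall N, `|u N - l| <= t N.
Proof.
move=> ut; pose A := range (fun N => u N - t N).
have ub M : ubound A (u M + t M).
  move=> _ [N _ <-]; have [NM|MN] := leqP N M.
    have := ut N (M - N)%N; rewrite subnKC// ler_norml => /andP[h1 h2].
    have := le_trans (normr_ge0 _) (ut M 0%N); lra.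
  have := ut M (N - M)%N; rewrite subnKC 1?ltnW// ler_norml => /andP[h1 h2].
  have := le_trans (normr_ge0 _) (ut N 0%N); lra.
exists (sup A) => N; rewrite ler_norml; apply/andP; split.
  have : sup A <= u N + t N by apply: ge_sup (ub N); exists (u 0%N - t 0%N), 0%N.
  lra.
have : u N - t N <= sup A.
  apply: sup_upper_bound; last by exists N.
  by split; [exists (u 0%N - t 0%N), 0%N|exists (u 0%N + t 0%N); exact: ub].
lra.
Qed.

Lemma cnested_limit (u : nat -> C) (t : nat -> R) :
  (forall N j, cmod (u (N + j)%N - u N) <= t N) ->
  exists l, forall N, cmod (u N - l) <= 2 * t N.
Proof.
move=> ut.
have [a ha] : exists a, forall N, `|complex.Re (u N) - a| <= t N.
  apply: nested_limit => N j; apply: le_trans (ut N j).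
  by apply: le_trans (Re_le_cmod _); rewrite ReB.
have [b hb] : exists b, forall N, `|complex.Im (u N) - b| <= t N.
  apply: nested_limit => N j; apply: le_trans (ut N j).
  by apply: le_trans (Im_le_cmod _); rewrite ImB.
exists (a +i* b)%C => N; apply: le_trans (cmod_le_ReIm _) _.
by rewrite ReB ImB /= mulr_natl mulr2n lerD.
Qed.

Lemma geometric_partial_sum (F : nat -> C) (B q : R) : 0 <= q < 1 -> 0 <= B ->
  (forall k, cmod (F k) <= B * q ^+ k) ->
  forall N j, cmod (\sum_(k < N + j) F k - \sum_(k < N) F k) <= B / (1 - q) * q ^+ N.
Proof.
move=> /andP[q0 q1] B0 hF N j; have q10 : 0 < 1 - q by rewrite subr_gt0.
(* The bound is sharpened to a telescoping difference, so that each step of the induction on [j]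
   adds exactly [B q^(N + j)]. *)
suff : cmod (\sum_(k < N + j) F k - \sum_(k < N) F k) <= B / (1 - q) * (q ^+ N - q ^+ (N + j)).
  move=> h; apply: (le_trans h).
  by rewrite ler_wpM2l ?divr_ge0 ?(ltW q10)// gerBl exprn_ge0.
elim: j => [|j ih]; first by rewrite addn0 !subrr cmod0 mulr0.
rewrite addnS big_ord_recr/= addrAC; apply: le_trans (cmodD _ _) _.
apply: le_trans (lerD ih (hF _)) _.
rewrite exprS le_eqVlt; apply/orP; left; apply/eqP; field.
by rewrite gt_eqF.
Qed.

(** The hypothesis gives convergence only on the small ball of radius [t]. On the whole ball it
    follows from [taylor_remainder] for the slice [x |-> f (x w)], evaluated at [x = 1]. *)
Lemma taylor_limit f c (t M : R) w : ball_fun f -> 0 < t -> 0 <= M ->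
  (forall w, cvnorm w <= t -> forall N,
    cmod (f w - \sum_(k < N) homog_part c k w) <= M * (cvnorm w / t) ^+ N) ->
  cvnorm w < 1 -> forall e, 0 < e ->
  exists N0, forall N, (N0 <= N)%N -> cmod (f w - \sum_(k < N) homog_part c k w) < e.
Proof.
move=> bf t0 M0 hc w1 e e0.
have hc' v : cvnorm v <= t -> forall N,
    cmod (f (0 + v) - \sum_(k < N) homog_part c k v) <= M * (cvnorm v / t) ^+ N.
  by rewrite add0r; exact: hc.
have [s s0 hs] := homog_expansion w t0 M0 hc'.
have a0 := cvnorm_ge0 w; set a := cvnorm w in w1 a0.
(* Chosen so that [1 < rho] and [rho * a < 1]: the slice is analytic on a disc that contains 1 in
   its interior, and [1 / r] is the ratio of the remainders. *)
pose rho := 2 / (1 + a); pose r := (1 + rho) / 2.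
have a1 : 0 < 1 + a by rewrite ltr_wpDr.
have rho1 : 1 < rho by rewrite ltr_pdivlMr// mul1r; lra.
have rhoa : rho * a < 1 by rewrite /rho mulrAC ltr_pdivrMr// mul1r; lra.
have r1 : 1 < r by rewrite /r; lra.
have rrho : r < rho by rewrite /r; lra.
have r0 : 0 < r := lt_trans ltr01 r1.
have ra : r * a < 1 by apply: le_lt_trans rhoa; rewrite ler_wpM2r// ltW.
have [K K0 hK] := ball_regular_bounded bf.1 ra.
have han x : cmod x < rho -> analytic1 (fun x => f (0 + x *: w)) x.
  move=> xr; apply: ball_regular_line; first exact: bf.1.
  rewrite /unit_ball/= add0r cvnormZ; apply: le_lt_trans rhoa.
  by rewrite ler_wpM2r// ltW.
have hle x : cmod x <= r -> cmod (f (0 + x *: w)) <= K.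
  by move=> xr; apply: hK; rewrite add0r cvnormZ ler_wpM2r.
have x1 : cmod (1 : C) <= r by rewrite cmod1 ltW.
have rV0 : 0 <= r^-1 by rewrite invr_ge0 ltW.
have rV1 : r^-1 < 1 by rewrite invf_lt1.
have K1 : 0 < K + 1 by rewrite ltr_wpDl.
have [N0 hN] := natmul_expr_small rV0 rV1 (divr_gt0 e0 K1).
exists N0 => N /hN; rewrite ltr_pdivlMr// => h.
have := taylor_remainder r0 rrho han hle s0 hs N x1.
rewrite scale1r add0r cmod1 mul1r; under eq_bigr do rewrite expr1n mulr1.
move=> h'; apply: le_lt_trans h' (le_lt_trans _ h).
by rewrite mulrAC ler_wpM2l ?mulr_ge0 ?exprn_ge0// lerDl.
Qed.

(** The geometric bound makes the partial sums, which are polynomials, converge uniformly on the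
    closed ball; inside the ball [taylor_limit] identifies the limit with [f]. *)
Lemma continuous_extension (Q : set (fct R n)) f : quotient_module Q -> finite_dim Q -> Q f ->
  exists2 fs : fct R n, (forall z, unit_ball z -> fs z = f z) & closed_cont fs.
Proof.
move=> Qq Qfd Qf; have hf := quotient_hardy n_gt1 Qq Qf.
have [c [t [M [B [q [t0 M0 B0 q01 [hc hF]]]]]]] := homog_part_geometric n_gt1 Qq Qfd Qf.
have /andP[q0 q1] := q01.
pose T := B / (1 - q).
have T0 : 0 <= T by rewrite divr_ge0// subr_ge0 ltW.
pose S N w := \sum_(k < N) homog_part c k w.
(* The condition is guarded by [cvnorm w <= 1]: values of [fs] outside the closed ball are left
   unspecified. *)
have /choice[fs hfs] w : exists l : C, cvnorm w <= 1 -> forall N, cmod (S N w - l) <= 2 * (T * q ^+ N).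
  have [w1|w1] := leP (cvnorm w) 1; last by exists 0.
  have [l hl] := cnested_limit (geometric_partial_sum q01 B0 (fun k => hF k w w1)).
  by exists l.
have small e : 0 < e -> exists N0, forall N, (N0 <= N)%N -> 2 * (T * q ^+ N) < e.
  move=> e0; have T1 : 0 < 2 * T + 1 by rewrite ltr_wpDl// mulr_ge0.
  have [N0 hN] := natmul_expr_small q0 q1 (divr_gt0 e0 T1).
  exists N0 => N /hN; rewrite ltr_pdivlMr//; apply: le_lt_trans.
  have qN : 0 <= q ^+ N by rewrite exprn_ge0.
  rewrite mulrA mulrC -mulrA; apply: (@le_trans _ _ (1 * (q ^+ N * (2 * T + 1)))).
    by rewrite mul1r ler_wpM2l// lerDl.
  by rewrite ler_wpM2r ?mulr_ge0 ?(ltW T1)// ler1n.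
exists fs => [z z1|z z1 e e0].
  apply/eqP; rewrite eq_sym -subr_eq0 -cmod_eq0 eq_le cmod_ge0 andbT.
  apply/ler_addgt0Pr => e e0; rewrite add0r.
  have e2 : 0 < e / 2 by rewrite divr_gt0.
  have [N1 h1] := taylor_limit hf.1 t0 M0 hc z1 e2.
  have [N2 h2] := small _ e2.
  pose N := maxn N1 N2.
  have := h1 N (leq_maxl _ _); have := h2 N (leq_maxr _ _).
  have := hfs z (ltW z1) N; rewrite -/(S N z).
  have -> : f z - fs z = (f z - S N z) + (S N z - fs z) by rewrite addrA subrK.
  have := cmodD (f z - S N z) (S N z - fs z); lra.
have e3 : 0 < e / 3 by rewrite divr_gt0.
have [N /(_ N (leqnn N)) hN] := small _ e3.
have cS : cont_at (S N : fct R n) z by apply: cont_at_sum => k _; exact: cont_at_homog_part.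
have [d d0 hd] := cS _ e3.
exists d => // w w1 /hd hw.
have := hfs w w1 N; have := hfs z z1 N; rewrite (cmodB _ (fs w)).
have tri (x y x' y' : C) : cmod (x - x') <= cmod (x - y) + cmod (y - y') + cmod (y' - x').
  apply: le_trans (lerD (cmodD _ _) (lexx _)); apply: le_trans (cmodD _ _).
  by rewrite !addrA !subrK.
have := tri (fs w) (S N w) (fs z) (S N z).
lra.
Qed.

End continuous_extension.

(** * Moduli on the sphere and the maximum modulus in the ball *)

Section boundary_values.
Variables (R : realType) (n : nat).
Hypothesis n_gt1 : (1 < n)%N.
Local Notation C := R[i].
Implicit Types (f g phi : fct R n) (z w zeta eta : Cn R n).

Let n_gt0 : (0 < n)%N.
Proof. exact: ltnW. Qed.

(* [|h + h a|] has a local maximum at [a], so it is constant near [a], and then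
   [h = h a] by the parallelogram law. *)
Lemma loc_max_constant (h : C -> C) a (M e : R) : analytic1 h a -> 0 < e ->
  (forall x, cmod (x - a) < e -> cmod (h x) <= M) -> cmod (h a) = M ->
  exists2 d, 0 < d & forall x, cmod (x - a) < d -> h x = h a.
Proof.
move=> ha e0 hM haM.
have hc : analytic1 (fun x => h x + h a) a := analytic1D ha (analytic1_cst (h a) a).
have top : cmod (h a + h a) = 2 * M.
  have -> : h a + h a = 2%:R * h a by rewrite mulr_natl mulr2n.
  by rewrite cmodM -[2%:R](rmorph_nat (real_complex R)) cmod_real ger0_norm// haM.
have [H|[d d0 H]] := loc_max_ratio hc (analytic1_cst 1 a) (oner_neq0 C).
  have [x /hM xM] := H e e0.
  rewrite cmod1 !divr1 top; have := cmodD (h x) (h a); rewrite haM; lra.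
exists (Num.min d e); first by rewrite lt_min d0.
move=> x; rewrite lt_min => /andP[/H]; rewrite cmod1 !divr1 top => Hx /hM xM.
apply/eqP; rewrite -subr_eq0 -cmod_eq0 -sqrf_eq0 eq_le sqr_ge0 andbT.
have P : cmod (h x - h a) ^+ 2 + cmod (h x + h a) ^+ 2 = 2 * (cmod (h x) ^+ 2 + cmod (h a) ^+ 2).
  by rewrite !sqr_cmod; case: (h x) (h a) => x1 x2 [y1 y2] /=; ring.
move: P; rewrite Hx haM => P.
have : cmod (h x) ^+ 2 <= M ^+ 2 by rewrite lerXn2r ?nnegrE ?cmod_ge0// -haM cmod_ge0.
by move: P; rewrite exprMn; lra.
Qed.

(** Connectedness along the segment from [a] to [b]: the set of times up to which [phi] keeps the
    value [phi a] reaches its supremum by continuity and extends beyond any time less than 1 by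
    [loc_max_constant]. *)
Lemma max_modulus_ball phi a (M : R) : ball_regular phi -> unit_ball a ->
  (forall z, unit_ball z -> cmod (phi z) <= M) -> cmod (phi a) = M ->
  forall b, unit_ball b -> phi b = phi a.
Proof.
move=> rphi a1 phiM phia b b1.
pose p (x : C) : Cn R n := a + x *: (b - a).
pose h (x : C) : C := phi (p x).
have p0 : p 0 = a by rewrite /p scale0r addr0.
have p1 : p 1 = b by rewrite /p scale1r addrC subrK.
have pin (t : R) : 0 <= t -> t <= 1 -> unit_ball (p t%:C%C).
  move=> t0 t1; rewrite /unit_ball/=.
  have -> : p t%:C%C = (1 - t)%:C%C *: a + t%:C%C *: b.
    by rewrite /p scalerBr rmorphB/= scalerBl scale1r [LHS]addrA [LHS]addrAC.
  apply: le_lt_trans (cvnormD _ _) _; rewrite !cvnormZ !cmod_real !ger0_norm ?subr_ge0//.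
  move: a1 b1; rewrite /unit_ball/= => a1 b1.
  have [->|t0'] := eqVneq t 0; first by rewrite subr0 mul1r mul0r addr0.
  have t00 : 0 < t by rewrite lt_neqAle eq_sym t0'.
  by nra.
have han (t : R) : 0 <= t -> t <= 1 -> analytic1 h t%:C%C.
  by move=> t0 t1; apply: ball_regular_line => //; exact: pin.
have loc (t : R) : 0 <= t -> t <= 1 -> h t%:C%C = phi a ->
    exists2 d, 0 < d & forall x, cmod (x - t%:C%C) < d -> h x = phi a.
  move=> t0 t1 ht.
  have [r r0 hr] := ball_nbhs (pin t t0 t1).
  have [e e0 he] := line_near (p t%:C%C) (b - a) r0.
  have hM x : cmod (x - t%:C%C) < e -> cmod (h x) <= M.
    move=> xt; apply: phiM; apply: hr.
    have -> : p x = p t%:C%C + (x - t%:C%C) *: (b - a).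
      rewrite /p -addrA -scalerDl; congr (_ + _ *: _).
      by rewrite addrC subrK.
    by apply: he; exact: ltW.
  have htM : cmod (h t%:C%C) = M by rewrite ht.
  have [d d0 hd] := loc_max_constant (han t t0 t1) e0 hM htM.
  by exists d => // x /hd ->.
pose A := [set t : R | 0 <= t <= 1 /\ forall s, 0 <= s <= t -> h s%:C%C = phi a].
have A0 : A 0.
  split; first by rewrite lexx ler01.
  by move=> s s0; rewrite (_ : s = 0) ?/h ?p0//; lra.
have hA : has_sup A by split; [exists 0|exists 1 => t [/andP[]]].
pose s := sup A.
have s0 : 0 <= s by exact: sup_upper_bound.
have s1 : s <= 1 by apply: ge_sup; [exists 0|move=> t [/andP[]]].
have hs : h s%:C%C = phi a.
  apply/eqP; rewrite -subr_eq0 -cmod_eq0 eq_le cmod_ge0 andbT.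
  apply/ler_addgt0Pr => e e0; rewrite add0r.
  have [d d0 hd] := analytic1_cont (han s s0 s1) e0.
  have [t At ts] := sup_adherent d0 hA.
  have tles : t <= s by exact: sup_upper_bound.
  have [/andP[t0 t1] hAt] := At.
  rewrite -(hAt t) ?t0 ?lexx// cmodB; apply: ltW; apply: hd.
  by rewrite -rmorphB cmod_real ler0_norm; rewrite -/s in ts; lra.
have [d d0 hd] := loc s s0 s1 hs.
suff s1' : s = 1 by move: hs; rewrite s1' /h p1.
apply/eqP; rewrite eq_le s1/= leNgt; apply/negP => slt1.
pose t := Num.min 1 (s + d / 2).
have st : s < t by rewrite lt_min slt1/=; lra.
have t1 : t <= 1 by rewrite ge_min lexx.
have td : t <= s + d / 2 by rewrite ge_min lexx orbT.
suff : A t by move=> At; have := sup_upper_bound hA At; rewrite -/s; lra.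
split; first by rewrite t1 andbT; lra.
move=> x /andP[x0 xt].
have [t' [_ hAt'] ts] := sup_adherent d0 hA; rewrite -/s in ts.
have [xt'|xt'] := leP x t'; first by apply: hAt'; rewrite x0.
by apply: hd; rewrite -rmorphB cmod_real ltr_norml; apply/andP; split; lra.
Qed.

(** A gap between [M |fs|] and [|gs|] at [zeta] persists on a neighbourhood, so near radius 1 every
    mean of [|g|^2] falls short of [|g|^2 = M^2 |f|^2] by a fixed amount [c], against the supremum
    in the norm. *)
Lemma sphere_modulus_eq f g fs gs (M : R) : 0 <= M -> hardy_fun f -> hardy_fun g ->
  (forall z, unit_ball z -> fs z = f z) -> (forall z, unit_ball z -> gs z = g z) ->
  closed_cont fs -> closed_cont gs ->
  (forall z, unit_ball z -> cmod (g z) <= M * cmod (f z)) -> hnorm g = M * hnorm f ->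
  forall zeta, cvnorm zeta = 1 -> cmod (gs zeta) = M * cmod (fs zeta).
Proof.
move=> M0 hf hg fsE gsE cf cg gf ng zeta zeta1.
pose u z := M * cmod (fs z) - cmod (gs z).
suff u0 : u zeta = 0 by move: u0; rewrite /u; lra.
apply/eqP; apply: contrapT => /negP; rewrite -normr_gt0 => d0; pose d : R := `|u zeta|; rewrite -/d in d0.
have d4 : 0 < d / 4 by rewrite divr_gt0.
have M1 : 0 < M + 1 by rewrite ltr_wpDl.
have z1 : cvnorm zeta <= 1 by rewrite zeta1.
have [e1 e10 he1] := cf zeta z1 _ (divr_gt0 d4 M1).
have [e2 e20 he2] := cg zeta z1 _ d4.
pose e := Num.min e1 e2.
have e0 : 0 < e by rewrite lt_min e10.
have big w : cvnorm w <= 1 -> cvnorm (w - zeta) < e -> d / 2 <= `|u w|.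
  move=> w1; rewrite lt_min => /andP[/(he1 w w1) h1 /(he2 w w1) h2].
  have k1 := cmod_dist (fs w) (fs zeta); have k2 := cmod_dist (gs w) (gs zeta).
  move: h1; rewrite ltr_pdivlMr// => h1.
  have uu : `|u w - u zeta| <= M * cmod (fs w - fs zeta) + cmod (gs w - gs zeta).
    have -> : u w - u zeta = M * (cmod (fs w) - cmod (fs zeta)) - (cmod (gs w) - cmod (gs zeta)).
      by rewrite /u; ring.
    apply: le_trans (ler_normB _ _) _; rewrite normrM (ger0_norm M0).
    by rewrite lerD// ler_wpM2l.
  have c0 := cmod_ge0 (fs w - fs zeta).
  have h3 : d <= `|u w| + `|u w - u zeta|.
    have -> : d = `|u w - (u w - u zeta)| by rewrite opprB addrC subrK.
    exact: ler_normB.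
  have : M * cmod (fs w - fs zeta) <= d / 4 by nra.
  lra.
(* A point of the cap of radius [e / 2] stays within [e] of [zeta] after dilation by
   [r > 1 - e / 2]. *)
pose c := (d / 2) ^+ 2 * cap_mass n (e / 2).
have e2' : 0 < e / 2 by rewrite divr_gt0.
have c0 : 0 < c by rewrite mulr_gt0 ?cap_mass_gt0// exprn_gt0// divr_gt0.
have near_bound r : 0 < r < 1 -> 1 - e / 2 < r -> mean_sq g r <= hnorm g ^+ 2 - c.
  move=> r01 re; have /andP[r0 r1] := r01.
  have rb z : cvnorm z = 1 -> unit_ball (r%:C%C *: z).
    by move=> zz; rewrite /unit_ball/= cvnormZ zz mulr1 cmod_real gtr0_norm.
  pose v z := M ^+ 2 * cmod (f (r%:C%C *: z)) ^+ 2 - cmod (g (r%:C%C *: z)) ^+ 2.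
  have nf := nice_cmod_sq hf.1 r01; have nG := nice_cmod_sq hg.1 r01.
  have nv : nice v by apply: niceB => //; exact: niceZ.
  have mv : mean v = M ^+ 2 * mean_sq f r - mean_sq g r.
    by rewrite /mean_sq -meanZ// -(meanB n_gt0)//; exact: niceZ.
  (* Uses [(a - b)^2 <= a^2 - b^2] for [0 <= b <= a], with [a = M |f|] and [b = |g|]. *)
  have vu z : cvnorm z = 1 -> `|u (r%:C%C *: z)| ^+ 2 <= v z.
    move=> zz; rewrite real_normK ?num_real// /u /v fsE ?gsE; [|exact: rb|exact: rb].
    have := gf _ (rb z zz); have := cmod_ge0 (g (r%:C%C *: z)).
    move: (cmod (f _)) (cmod (g _)) => x y; nra.
  have : c <= mean v.
    apply: (@mean_ge_cap R n n_gt0 v zeta) => //.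
    - by move=> w w1; apply: le_trans (vu w w1); exact: sqr_ge0.
    - exact: sqr_ge0.
    move=> w w1 wz; apply: le_trans (vu w w1).
    suff h : d / 2 <= `|u (r%:C%C *: w)| by rewrite lerXn2r// nnegrE// divr_ge0// ltW.
    apply: big; first by apply: ltW; exact: rb.
    have -> : r%:C%C *: w - zeta = (r - 1)%:C%C *: w + (w - zeta).
      by rewrite rmorphB/= scalerBl scale1r addrA subrK.
    apply: le_lt_trans (cvnormD _ _) _.
    rewrite cvnormZ w1 mulr1 cmod_real ltr0_norm; lra.
  rewrite mv; have := mean_sq_le_hnorm n_gt0 hf r01; rewrite ng exprMn => h1 h2.
  have : M ^+ 2 * mean_sq f r <= M ^+ 2 * hnorm f ^+ 2 by rewrite ler_wpM2l ?sqr_ge0.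
  lra.
have : hnorm g ^+ 2 <= hnorm g ^+ 2 - c; last by lra.
apply: (hnorm_le n_gt0 hg) => r r01; have /andP[r0 r1] := r01.
(* By monotonicity of the means only radii close to 1 have to be examined. *)
pose r' := Num.max r (1 - e / 4).
have r'r : r <= r' by rewrite le_max lexx.
have r'e : 1 - e / 4 <= r' by rewrite le_max lexx orbT.
have r'1 : r' < 1 by rewrite gt_max r1/=; lra.
apply: (@le_trans _ _ (mean_sq g r')); first exact: mean_sq_nondecreasing hg.1 r0 r'r r'1.
by apply: near_bound; [apply/andP; split|]; lra.
Qed.

(** If [fs] vanished on the sphere, the maximum principle on the disc cut out of the ball by the
    line through [z] and the origin would give [f z = 0]. *)
Lemma boundary_nonzero f fs : hardy_fun f -> f <> 0 ->
  (forall z, unit_ball z -> fs z = f z) -> closed_cont fs ->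
  exists2 zeta, cvnorm zeta = 1 & fs zeta != 0.
Proof.
move=> hf f0 fsE cf; apply: contrapT => H; apply: f0; apply/funext => z.
have S0 zeta : cvnorm zeta = 1 -> fs zeta = 0.
  by move=> z1; apply/eqP; apply: contrapT => /negP h; apply: H; exists zeta.
have [z1|/hf.1.2 ->//] := pselect (unit_ball z).
have [w [l [w1 zE]]] : exists w (l : C), cvnorm w = 1 /\ z = l *: w.
  have [->|z0] := eqVneq z 0.
    have [e e1] := unit_vector_exists R n_gt0.
    by exists e, 0; rewrite scale0r.
  have Z0 : 0 < cvnorm z by rewrite cvnorm_gt0.
  exists ((cvnorm z)^-1%:C%C *: z), (cvnorm z)%:C%C; split.
    by rewrite cvnormZ cmod_real gtr0_norm ?invr_gt0// mulVf// gt_eqF.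
  by rewrite scalerA -rmorphM mulfV ?gt_eqF// scale1r.
have nx (x : C) : cvnorm (x *: w) = cmod x by rewrite cvnormZ w1 mulr1.
have l1 : cmod l < 1 by rewrite -nx -zE.
rewrite -(fsE z z1); apply/eqP; rewrite -cmod_eq0 eq_le cmod_ge0 andbT zE.
apply: (@maximum_principle R (fun x => cmod (fs (x *: w))) 1 0) => //; last exact: ltW.
- move=> x x1 e e0; have xw1 : cvnorm (x *: w) <= 1 by rewrite nx.
  have [d d0 hd] := cf _ xw1 e e0; exists d => // y y1 yx.
  apply: le_lt_trans (cmod_dist _ _) _; apply: hd; first by rewrite nx.
  by rewrite -scalerBl nx.
- move=> x x1.
  have an : analytic1 (fun y => f (0 + y *: w)) x.
    by apply: ball_regular_line hf.1.1 _; rewrite /unit_ball/= add0r nx.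
  have := loc_max_ratio an (analytic1_cst 1 x) (oner_neq0 C).
  have e0 : 0 < 1 - cmod x by rewrite subr_gt0.
  apply: loc_max_prop_near e0 _ => y yx; rewrite cmod1 divr1 add0r fsE//.
  rewrite /unit_ball/= nx; have := cmodD (y - x) x; rewrite subrK; lra.
- by move=> x x1; rewrite S0 ?cmod0// nx.
Qed.

Lemma cont1_on_div (D : set C) (u v : C -> R) : cont1_on D u -> cont1_on D v ->
  (forall x, D x -> 0 <= u x) -> (forall x, D x -> 0 < v x) ->
  cont1_on D (fun x => u x / v x).
Proof.
move=> cu cv u0 v0 x Dx e e0.
have U0 := u0 x Dx; have V0 := v0 x Dx; set U := u x in U0 *; set V := v x in V0 *.
have U1 : 0 < U + 1 by rewrite ltr_wpDl.
have a0 : 0 < e * V / 4 by rewrite divr_gt0// mulr_gt0.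
have b0 : 0 < Num.min (V / 2) (e * V ^+ 2 / (4 * (U + 1))).
  by rewrite lt_min !divr_gt0// ?mulr_gt0// exprn_gt0.
have [d d0 hd] := cu x Dx _ a0; have [d' d'0 hd'] := cv x Dx _ b0.
exists (Num.min d d'); first by rewrite lt_min d0.
move=> y Dy; rewrite lt_min => /andP[/(hd y Dy) h1 /(hd' y Dy)].
rewrite lt_min -/V => /andP[h2]; rewrite ltr_pdivlMr ?mulr_gt0// => h3.
have vy : V / 2 < v y by move: h2; rewrite ltr_norml => /andP[]; lra.
have vy0 := v0 y Dy.
have -> : u y / v y - U / V = ((u y - U) * V - U * (v y - V)) / (v y * V).
  by field; rewrite !gt_eqF.
have vV : 0 < v y * V by rewrite mulr_gt0.
rewrite normrM normfV (gtr0_norm vV) ltr_pdivrMr//.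
apply: le_lt_trans (ler_normB _ _) _; rewrite !normrM (gtr0_norm V0) (ger0_norm U0).
rewrite -/U in h1; move: `|u y - U| `|v y - V| (normr_ge0 (u y - U)) (normr_ge0 (v y - V)) h1 h3 {h2}.
move=> a b a_ge0 b_ge0 h1 h3.
have k1 : a * V <= e * V / 4 * V by rewrite ler_wpM2r ?ltW.
have k2 : 4 * (U * b) <= e * V ^+ 2 by apply: le_trans (ltW h3); nra.
have k3 : e * V * (V / 2) < e * V * v y by rewrite ltr_pM2l// mulr_gt0.
have -> : e * (v y * V) = e * V * v y by ring.
have k4 : e * V * (V / 2) = e * V ^+ 2 / 2 by field.
have k5 : e * V / 4 * V = e * V ^+ 2 / 4 by field.
lra.
Qed.

(* The discs [t zeta + x eta] with [t] near 1 have their boundary on the sphere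
   and stay close to [zeta]; there the maximum principle applies to [f / g]. *)
Lemma interior_modulus_ge f g fs gs phi (M : R) : 0 < M -> hardy_fun f -> hardy_fun g ->
  (forall z, unit_ball z -> fs z = f z) -> (forall z, unit_ball z -> gs z = g z) ->
  closed_cont fs -> closed_cont gs ->
  (forall zeta, cvnorm zeta = 1 -> cmod (gs zeta) = M * cmod (fs zeta)) ->
  (forall z, unit_ball z -> g z = phi z * f z) ->
  (exists2 zeta, cvnorm zeta = 1 & fs zeta != 0) ->
  exists2 a, unit_ball a & M <= cmod (phi a).
Proof.
move=> M0 hf hg fsE gsE cf cg bnd gphi [zeta zeta1 fz].
have [eta eta1 ez] := orthogonal_unit_exists n_gt1 zeta1.
have z1 : cvnorm zeta <= 1 by rewrite zeta1.
have F0 : 0 < cmod (fs zeta) by rewrite cmod_gt0.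
have G0 : 0 < cmod (gs zeta) by rewrite bnd// mulr_gt0.
have [d1 d10 hd1] := cf _ z1 _ F0; have [d2 d20 hd2] := cg _ z1 _ G0.
pose d := Num.min d1 d2.
have d0 : 0 < d by rewrite lt_min d10.
have fpos w : cvnorm w <= 1 -> cvnorm (w - zeta) < d -> 0 < cmod (fs w).
  move=> w1; rewrite lt_min => /andP[/(hd1 w w1) h _].
  by have := cmod_distB (fs zeta) (fs w); rewrite cmodB; lra.
have gpos w : cvnorm w <= 1 -> cvnorm (w - zeta) < d -> 0 < cmod (gs w).
  move=> w1; rewrite lt_min => /andP[_ /(hd2 w w1) h].
  by have := cmod_distB (gs zeta) (gs w); rewrite cmodB; lra.
(* [t^2 + rho^2 = 1] puts the boundary of the disc on the sphere; [1 - t <= rho <= d / 3] keeps the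
   whole disc within [d] of [zeta]. *)
pose rho := Num.min (d / 3) 2^-1; pose t := Num.sqrt (1 - rho ^+ 2).
have rho0 : 0 < rho by rewrite lt_min; apply/andP; split; lra.
have rhod : rho <= d / 3 by rewrite ge_min lexx.
have rho2 : rho <= 2^-1 by rewrite ge_min lexx orbT.
have t2 : t ^+ 2 = 1 - rho ^+ 2 by rewrite sqr_sqrtr//; nra.
have t0 : 0 <= t by exact: sqrtr_ge0.
have t1 : t <= 1 by nra.
have t1' : 1 - t <= rho by nra.
pose p (x : C) : Cn R n := t%:C%C *: zeta + x *: eta.
have pn x : cvnorm (p x) ^+ 2 = 1 - rho ^+ 2 + cmod x ^+ 2.
  rewrite cvnormD_sqr !cvnormZ zeta1 eta1 !mulr1 cmod_real (ger0_norm t0) t2.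
  by rewrite cipZl cipZr -(cipJ eta) ez conjc0 !mulr0 addr0.
have ple x : cmod x <= rho -> cvnorm (p x) <= 1.
  move=> xr; rewrite -(@ler_pXn2r _ 2) ?nnegrE ?cvnorm_ge0// pn expr1n.
  have : cmod x ^+ 2 <= rho ^+ 2 by rewrite lerXn2r ?nnegrE ?cmod_ge0// ltW.
  lra.
have plt x : cmod x < rho -> unit_ball (p x).
  move=> xr; rewrite /unit_ball/= -(@ltr_pXn2r _ 2) ?nnegrE ?cvnorm_ge0// pn expr1n.
  have : cmod x ^+ 2 < rho ^+ 2 by rewrite ltr_pXn2r ?nnegrE ?cmod_ge0// ltW.
  lra.
have pz x : cmod x <= rho -> cvnorm (p x - zeta) < d.
  move=> xr; have -> : p x - zeta = (t - 1)%:C%C *: zeta + x *: eta.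
    by rewrite rmorphB/= scalerBl scale1r addrAC.
  apply: le_lt_trans (cvnormD _ _) _; rewrite !cvnormZ zeta1 eta1 !mulr1 cmod_real.
  rewrite ler0_norm; lra.
have r0 : cmod (0 : C) <= rho by rewrite cmod0 ltW.
have cD h : closed_cont h -> cont1_on [set x | cmod x <= rho] (fun x => cmod (h (p x))).
  move=> ch x /= xr e e0; have [k k0 hk] := ch _ (ple x xr) e e0.
  exists k => // y yr yx; apply: le_lt_trans (cmod_dist _ _) _; apply: hk; first exact: ple.
  have -> : p y - p x = (y - x) *: eta by rewrite /p scalerBl opprD addrACA subrr add0r.
  by rewrite cvnormZ eta1 mulr1.
(* On the boundary circle the ratio equals [1 / M]; the upper bound [|f| / |g| <= 1 / M] at the
   centre is the lower bound wanted for [|phi|]. *)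
have := @maximum_principle R (fun x => cmod (fs (p x)) / cmod (gs (p x))) rho M^-1 rho0.
move=> /(_ _ _ _ 0 r0) H.
have a0 : unit_ball (p 0) by apply: plt; rewrite cmod0.
exists (p 0) => //.
have : cmod (fs (p 0)) / cmod (gs (p 0)) <= M^-1.
  apply: H.
  - apply: cont1_on_div; [exact: cD|exact: cD| |].
      by move=> x _; exact: cmod_ge0.
    by move=> x xr; apply: gpos; [exact: ple|exact: pz].
  - move=> x xr; have xr' := ltW xr.
    have af := ball_regular_line hf.1.1 (plt x xr).
    have ag := ball_regular_line hg.1.1 (plt x xr).
    have gx : g (p x) != 0 by rewrite -cmod_gt0 -(gsE _ (plt x xr)); apply: gpos; [exact: ple|exact: pz].
    have := loc_max_ratio af ag gx.
    have e0 : 0 < rho - cmod x by rewrite subr_gt0.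
    apply: loc_max_prop_near e0 _ => y yx.
    have yr : cmod y < rho by have := cmodD (y - x) x; rewrite subrK; lra.
    by rewrite (fsE _ (plt y yr)) (gsE _ (plt y yr)).
  - move=> x xr; have px : cvnorm (p x) = 1.
      by apply/eqP; rewrite -(@eqrXn2 _ 2) ?cvnorm_ge0// pn xr expr1n subrK.
    have P : 0 < cmod (fs (p x)) by apply: fpos; [rewrite px|apply: pz; rewrite xr].
    by rewrite bnd// invfM mulrCA mulfV ?mulr1// gt_eqF.
have P : 0 < cmod (fs (p 0)) by apply: fpos; [exact: ple|exact: pz].
have P' : 0 < cmod (gs (p 0)) by apply: gpos; [exact: ple|exact: pz].
rewrite ler_pdivrMr// ler_pdivlMl// gsE// gphi// -fsE// cmodM.
by rewrite ler_pM2r.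
Qed.

End boundary_values.

(** * Norm attaining vectors and norm preserving lifts *)

Section quotient_operators.
Variables (R : realType) (n : nat) (Q : set (fct R n)) (X : fct R n -> fct R n).
Hypothesis n_gt1 : (1 < n)%N.
Hypotheses (Qq : quotient_module Q) (Qfd : finite_dim Q).
Hypothesis BX : bounded_operator Q X.
Local Notation C := R[i].
Implicit Types (f g phi : fct R n).

Let n_gt0 : (0 < n)%N.
Proof. exact: ltnW. Qed.

Let ip : inner_space (E := fct R n) (@hardy_fun R n) (@hdot R n) (@hnorm R n).
Proof. exact: hardy_inner. Qed.

Let hQ f : Q f -> hardy_fun f.
Proof. exact: quotient_hardy. Qed.

Let Q0 : Q 0.
Proof. by case: Qq => -[]. Qed.

Let Qlin (a : C) f g : Q f -> Q g -> Q (a *: f + g).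
Proof. by case: Qq => -[_ _ h] _ _ _; exact: h. Qed.

Let XQ f : Q f -> Q (X f).
Proof. by case: BX => h _ _; exact: h. Qed.

Let Xlin (a : C) f g : Q f -> Q g -> X (a *: f + g) = a *: X f + X g.
Proof. by case: BX => _ h _; exact: h. Qed.

Let X0 : X 0 = 0.
Proof.
have := Xlin 1 Q0 Q0; rewrite !scale1r addr0 => /eqP.
by rewrite -subr_eq0 opprD addrA subrr sub0r oppr_eq0 => /eqP.
Qed.

Lemma operator_comb d (b : 'I_d -> fct R n) (c : 'I_d -> C) : (forall j, Q (b j)) ->
  Q (\sum_j c j *: b j) /\ X (\sum_j c j *: b j) = \sum_j c j *: X (b j).
Proof.
move=> Qb; elim: (index_enum _) => [|j s [ih1 ih2]]; first by rewrite !big_nil.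
by rewrite !big_cons; split; [exact: Qlin|rewrite Xlin// ih2].
Qed.

(** In orthonormal coordinates the unit sphere of [Q] is that of C^d, with [d > 0] because [Q] is
    nonzero; [comb_attains_max] gives a maximum there, and scaling extends the bound to the unit
    ball. *)
Lemma opnorm_attained : exists f, [/\ Q f, hnorm f = 1 & opnorm Q X = (hnorm (X f))%:E].
Proof.
have [d [b [ob Qbj Qb]]] := orthonormal_basis n_gt1 Qq Qfd.
have d0 : (0 < d)%N.
  have [_ _ [f + f0] _] := Qq; rewrite Qb => -[c _ fE].
  rewrite lt0n; apply/eqP => dz; apply: f0; rewrite -fE.
  by clear -dz; subst d; rewrite big_ord0.
have HX j : hardy_fun (X (b j)) by apply: hQ; exact: XQ.
have [c c1 cmax] := comb_attains_max ip d0 HX.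
pose comb (v : Cn R d) := \sum_j v ord0 j *: b j.
have Qcomb v : Q (comb v) := (operator_comb (fun j => v ord0 j) Qbj).1.
have Xcomb v : X (comb v) = \sum_j v ord0 j *: X (b j) := (operator_comb (fun j => v ord0 j) Qbj).2.
have nrm_comb v : hnorm (comb v) = cvnorm v.
  apply/eqP; rewrite -(@eqrXn2 _ 2) ?cvnorm_ge0 ?(nrm_ge0 ip)//.
  by rewrite (nrm_orthonormal_sum ip) // sqr_cvnorm.
have max v : cvnorm v = 1 -> hnorm (X (comb v)) <= hnorm (X (comb c)).
  by move=> v1; rewrite (Xcomb v) (Xcomb c); exact: cmax.
exists (comb c); split; [exact: Qcomb|by rewrite nrm_comb|].
apply/le_anti/andP; split; last first.
  by apply: ereal_sup_ubound; exists (comb c) => //; split; [exact: Qcomb|rewrite nrm_comb c1].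
apply: ge_ereal_sup => _ [f [Qf f1] <-]; rewrite lee_fin.
have [v fE] : exists v, f = comb v.
  move: Qf; rewrite {1}Qb => -[c' _ <-]; exists (\row_j c' j).
  by apply: eq_bigr => j _; rewrite mxE.
rewrite fE nrm_comb in f1 *.
have [->|v0] := eqVneq v 0.
  have -> : comb 0 = 0 by apply: big1 => j _; rewrite mxE scale0r.
  by rewrite X0 (nrm0 ip) (nrm_ge0 ip).
have V0 : 0 < cvnorm v by rewrite cvnorm_gt0.
pose v' := (cvnorm v)^-1%:C%C *: v.
have v'1 : cvnorm v' = 1.
  by rewrite cvnormZ cmod_real gtr0_norm ?invr_gt0// mulVf// gt_eqF.
have -> : X (comb v) = (cvnorm v)%:C%C *: X (comb v').
  have -> : comb v = (cvnorm v)%:C%C *: comb v' + 0.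
    rewrite addr0 scaler_sumr; apply: eq_bigr => j _; rewrite mxE scalerA; congr (_ *: _).
    by rewrite mulrA -rmorphM/= mulfV ?gt_eqF// mul1r.
  by rewrite Xlin// X0 addr0.
rewrite (nrmZ ip); last by apply: hQ; exact: XQ.
rewrite cmod_real gtr0_norm//; apply: le_trans (max _ v'1).
by rewrite ler_piMl// (nrm_ge0 ip).
Qed.

Lemma hproj_id f : Q f -> hproj Q f = f.
Proof.
move=> Qf; apply: xget_unique => /=.
  split=> // h Qh; rewrite subrr; exact: (dot0l ip (hQ Qh)).
move=> g [Qg hg]; have hf := hQ Qf; have hg' := hQ Qg.
have Qd : Q (f - g).
  by have := Qlin (-1) Qg Qf; rewrite scaleN1r addrC.
have d0 : hdot (f - g) (f - g) = 0 by exact: hg.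
have hd := hQ Qd.
apply/esym/eqP; rewrite -subr_eq0; apply/eqP; apply: (nrm_eq0 ip hd).
move: d0; rewrite (dot_sqr ip hd) => /complexI/eqP.
by rewrite sqrf_eq0 => /eqP.
Qed.

(** [hproj] falls back on 0 when no projection exists; [g <> 0] excludes that case, so existence of
    projections is never established. *)
Lemma hproj_norm_eq f g : hardy_fun f -> hproj Q f = g -> g <> 0 -> hnorm f <= hnorm g -> f = g.
Proof.
move=> hf; rewrite /hproj; case: xgetP => [x -> [Qx hx] <- _|_ <- //] le.
by apply: (pythagoras_eq ip) => //; [exact: hQ|exact: hx].
Qed.

Lemma lift_constant_on_ball phi : norm_preserving_lift Q X phi ->
  exists c : C, forall z, unit_ball z -> phi z = c.
Proof.
move=> [[[aphi sfin] s1] Xphi nX].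
have rphi : ball_regular phi := (analytic_ball_fun aphi).1.
have [f [Qf f1 fM]] := opnorm_attained.
have hf := hQ Qf; have Qg := XQ Qf; have hg := hQ Qg.
pose M := hnorm (X f); have M0 : 0 <= M := nrm_ge0 ip _.
have phiM z : unit_ball z -> cmod (phi z) <= M.
  move=> z1; rewrite -lee_fin -fM nX; apply: ereal_sup_ubound; by exists z.
(* For [M = 0] the function [phi] itself is 0 on the ball; in the other case [X f] is nonzero, as
   [hproj_norm_eq] demands. *)
have [Mz|Mz] := eqVneq M 0.
  exists 0 => z /phiM; rewrite Mz => h; apply/eqP.
  by rewrite -cmod_eq0 eq_le h cmod_ge0.
have Mpos : 0 < M by rewrite lt_neqAle eq_sym Mz.
have [hpf npf] := hardy_fun_mulop n_gt0 rphi hf M0 phiM.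
have gE : mulop phi f = X f.
  apply: hproj_norm_eq => //; first by rewrite Xphi.
    by move=> g0; move: Mz; rewrite /M g0 (nrm0 ip) eqxx.
  by rewrite f1 mulr1 in npf.
have f0 : f <> 0.
  by move=> f0; move: f1; rewrite f0 (nrm0 ip) => /eqP; rewrite eq_sym oner_eq0.
have [fs fsE cfs] := continuous_extension n_gt1 Qq Qfd Qf.
have [gs gsE cgs] := continuous_extension n_gt1 Qq Qfd Qg.
have gphi z : unit_ball z -> X f z = phi z * f z by rewrite -gE.
have gf z : unit_ball z -> cmod (X f z) <= M * cmod (f z).
  by move=> z1; rewrite gphi// cmodM ler_wpM2r ?cmod_ge0//; exact: phiM.
have ng : hnorm (X f) = M * hnorm f by rewrite f1 mulr1.
have bnd := sphere_modulus_eq n_gt1 M0 hf hg fsE gsE cfs cgs gf ng.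
have nz := boundary_nonzero n_gt1 hf f0 fsE cfs.
have [a a1 aM] := interior_modulus_ge n_gt1 Mpos hf hg fsE gsE cfs cgs bnd gphi nz.
have phia : cmod (phi a) = M by apply/eqP; rewrite eq_le aM phiM.
exists (phi a); exact: (max_modulus_ball rphi a1 phiM phia).
Qed.

End quotient_operators.

Theorem theorem5 (R : realType) (n : nat) (Q : set (fct R n))
    (X : fct R n -> fct R n)
    (n_gt1 : (1 < n)%N)
    (Q_quot : quotient_module Q)
    (Q_findim : finite_dim Q)
    (X_mod : module_map Q X)
    (X_nonconst : nonconstant_on Q X) :
  ~ exists phi : fct R n, norm_preserving_lift Q X phi.
Proof.
move=> [phi lift]; have BX := X_mod.1.
have [c phic] := lift_constant_on_ball n_gt1 Q_quot Q_findim BX lift.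
apply: X_nonconst; exists c => f Qf.
have [_ Xphi _] := lift; rewrite Xphi// /compression.
have hf := quotient_hardy n_gt1 Q_quot Qf.
(* [phi = c] is known on the ball only; outside it both sides vanish with [f]. *)
have -> : mulop phi f = c *: f.
  apply/funext => z; rewrite /mulop; have [z1|z1] := pselect (unit_ball z).
    by rewrite phic.
  by rewrite fctE hf.1.2// mulr0 scaler0.
apply: hproj_id => //.
have [[_ Q0 Qlin] _ _ _] := Q_quot.
by have := Qlin c f 0 Qf Q0; rewrite addr0.
Qed.
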